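(* Let $X$ be a smooth projective geometrically irreducible curve over $\mathbb{F}_q$ with function field $F$. Let $\mathcal{V}_{\rm tor}$ be the complex vector space of all functions $f:\mathrm{PGL}_2(F)\backslash\mathrm{PGL}_2(\mathbb{A})/K\to\mathbb{C}$ that are $E$-toroidal for $E=\mathbb{F}_{q^2}F$, i.e. such that $$\int_{T(F)\backslash T(\mathbb{A})}\Phi(f)(t)\,dt=0\qquad\text{for all }\Phi\in\mathcal{H}_K.$$ Then the dimension of $\mathcal{V}_{\rm tor}$ is finite, bounded by $$\dim\mathcal{V}_{\rm tor}\le\#\bigl(\mathbb{P}\mathrm{Bun}_2X-\{c_D\}_{[D]\in\mathrm{Cl}^{\rm eff}X}\bigr).$$
   Context: $\mathbb{A}$ is the adele ring of $F$, $\mathcal{O}_{\mathbb{A}}=\prod_x\mathcal{O}_x$, $G=\mathrm{PGL}_2$, $K=G(\mathcal{O}_{\mathbb{A}})$; the Haar measure on $G(\mathbb{A})$ is normalized by $\mathrm{vol}\,K=1$. $\mathcal{H}_K$ is the algebra of compactly supported, locally constant, bi-$K$-invariant functions $\Phi:G(\mathbb{A})\to\mathbb{C}$ under convolution, acting by $\Phi(f)(g)=\int_{G(\mathbb{A})}\Phi(h)f(gh)\,dh$. Choose a basis of $\mathbb{F}_{q^2}$ over $\mathbb{F}_q$. It is a basis of $E=\mathbb{F}_{q^2}F$ over $F$ and defines, via multiplication, an embedding of $E$ into the algebra of $2\times2$-matrices over $F$, hence a non-split torus $T'\subset\mathrm{GL}_2$ with $T'(F)$ the image of $E^\times$. $T\subset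 G$ is the image of $T'$ in $\mathrm{PGL}_2$. $dt$ is a (non-zero) Haar measure on $T(F)\backslash T(\mathbb{A})$. $\mathbb{P}\mathrm{Bun}_2X$ is the set of isomorphism classes of rank $2$ vector bundles on $X$ modulo tensoring with line bundles; $c_D$ is the class of $\mathcal{L}_D\oplus\mathcal{O}_X$, where $\mathcal{L}_D$ is the line bundle associated to the divisor $D$; $\mathrm{Cl}^{\rm eff}X$ is the set of divisor classes of $X$ that are represented by effective divisors (including $0$). *)

(* Defs.v *)
From HB Require Import structures.
From mathcomp Require Import all_boot all_order all_algebra all_field.
From mathcomp Require Import all_classical all_reals all_analysis complex.

Set Implicit Arguments.
Unset Strict Implicit.
Unset Printing Implicit Defensive.

Import Order.TTheory GRing.Theory Num.Theory.

Local Open Scope classical_set_scope.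
Local Open Scope ring_scope.

(* [v 0] stands for +oo; it is fixed to the junk value [0] so that a valuation
   is determined by its values on the nonzero elements. *)
Record is_dval (K : fieldType) (v : K -> int) : Prop := IsDval {
  dval0 : v 0 = 0;
  dvalM : forall a b, a != 0 -> b != 0 -> v (a * b) = v a + v b;
  dvalD : forall a b, a != 0 -> b != 0 -> a + b != 0 ->
    Num.min (v a) (v b) <= v (a + b);
  dval_unif : exists2 t, t != 0 & v t = 1
}.

(* "v a >= n", true for [a = 0] *)
Definition vge (K : fieldType) (v : K -> int) (n : int) (a : K) : bool :=
  (a == 0) || (n <= v a).

Section ValuationTheory.
Variables (K : fieldType) (v : K -> int).
Hypothesis vP : is_dval v.

Lemma dval1 : v 1 = 0.
Proof.
have := dvalM vP (oner_neq0 K) (oner_neq0 K); rewrite mulr1 => /eqP.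
by rewrite eq_sym -subr_eq0 addrK => /eqP.
Qed.

Lemma dvalN a : v (- a) = v a.
Proof.
have [->|a0] := eqVneq a 0; first by rewrite oppr0.
have N10 : -1 != 0 :> K by rewrite oppr_eq0 oner_neq0.
have vN1 : v (-1) = 0.
  have := dvalM vP N10 N10; rewrite mulrNN mulr1 dval1 => /esym/eqP.
  by rewrite -mulr2n mulrn_eq0 /= => /eqP.
by rewrite -mulN1r (dvalM vP) // vN1 add0r.
Qed.

Lemma vge0 n : vge v n 0. Proof. by rewrite /vge eqxx. Qed.

Lemma vge1 : vge v 0 1. Proof. by rewrite /vge dval1 lexx orbT. Qed.

Lemma vgeD n a b : vge v n a -> vge v n b -> vge v n (a + b).
Proof.
rewrite /vge; have [->|a0] /= := eqVneq a 0; first by rewrite add0r.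
have [->|b0] /= := eqVneq b 0; first by rewrite addr0 (negbTE a0).
have [//|ab0 /=] := eqVneq (a + b) 0.
move=> na nb; apply: le_trans (dvalD vP a0 b0 ab0).
by rewrite le_min na nb.
Qed.

Lemma vgeN n a : vge v n (- a) = vge v n a.
Proof. by rewrite /vge oppr_eq0 dvalN. Qed.

Lemma vgeB n a b : vge v n a -> vge v n b -> vge v n (a - b).
Proof. by move=> ? ?; apply: vgeD; rewrite ?vgeN. Qed.

Lemma vgeM m n a b : vge v m a -> vge v n b -> vge v (m + n) (a * b).
Proof.
rewrite /vge mulf_eq0; have [|a0] /= := eqVneq a 0; first by [].
have [|b0] /= := eqVneq b 0; first by [].
by move=> ma nb; rewrite (dvalM vP) // lerD.
Qed.

End ValuationTheory.

(* A smooth projective geometrically irreducible curve X over the finite field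
   k is given by its function field: X is the set of places of F/k (closed
   points) with the cofinite topology and the sheaf U |-> \bigcap_(x in U) O_x,
   both introduced below.
   [geom_irr]: for p irreducible over k, the generic point of the base change
   of X to the finite extension k[T]/(p) of k is F (x) k[T]/(p) = F[T]/(p);
   every finite extension of k is of this form. *)
Record curve (k : finFieldType) := Curve {
  ffield :> fieldType;
  const : {rmorphism k -> ffield};
  (* F is a finite extension of k(t) with t transcendental over k *)
  ffield_fin : exists t : ffield,
    (forall p : {poly k}, p != 0 -> (map_poly const p).[t] != 0) /\
    exists (n : nat) (b : 'I_n -> ffield), forall z : ffield,
      exists (p : 'I_n -> {poly k}) (d : {poly k}), d != 0 /\
        z = \sum_i (map_poly const (p i)).[t] / (map_poly const d).[t] * b i;
  geom_irr : forall p : {poly k},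
    irreducible_poly p -> irreducible_poly (map_poly const p)
}.

(* closed points of the curve *)
Record place (k : finFieldType) (X : curve k) := Place {
  ord :> X -> int;
  ord_dval : is_dval ord;
  ord_const : forall c : k, c != 0 -> ord (const X c) = 0
}.

(* Nonempty open subsets of X: they contain the generic point, and are
   therefore given by a cofinite set of closed points. *)
Record opn (k : finFieldType) (X : curve k) := Opn {
  opn_set :> set (place X);
  opn_cofinite : finite_set (~` opn_set)
}.

Section StructureSheaf.
Variables (k : finFieldType) (X : curve k).

Definition regular (U : opn X) : pred X :=
  fun a => `[< forall x, opn_set U x -> vge (ord x) 0 a >].

Lemma regularP (U : opn X) a :
  reflect (forall x, opn_set U x -> vge (ord x) 0 a) (a \in regular U).
Proof. exact: asboolP. Qed.

Lemma regular_subring (U : opn X) : subring_closed (regular U).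
Proof.
split=> [|a b /regularP aU /regularP bU|a b /regularP aU /regularP bU].
- by apply/regularP => x _; exact: vge1 (ord_dval x).
- by apply/regularP => x xU; apply: (vgeB (ord_dval x)); [exact: aU|exact: bU].
- by apply/regularP => x xU; apply: (@vgeM _ _ (ord_dval x) 0 0);
    [exact: aU|exact: bU].
Qed.
HB.instance Definition _ (U : opn X) :=
  GRing.isSubringClosed.Build X (regular U) (@regular_subring U).

(* O_X(U) *)
Record OX (U : opn X) := MkOX { OX_val :> X; OX_regular : OX_val \in regular U }.
HB.instance Definition _ (U : opn X) := [isSub for @OX_val U].
HB.instance Definition _ (U : opn X) := [Choice of OX U by <:].
HB.instance Definition _ (U : opn X) :=
  [SubChoice_isSubComNzRing of OX U by <:].

Lemma OX_res_subproof (U V : opn X) (VU : V `<=` U) (a : OX U) :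
  OX_val a \in regular V.
Proof. by apply/regularP => x /VU xU; exact: (regularP _ _ (OX_regular a)). Qed.

Definition OX_res (U V : opn X) (VU : V `<=` U) (a : OX U) : OX V :=
  MkOX (OX_res_subproof VU a).

End StructureSheaf.

(* Sheaves of O_X-modules. The value on the empty set is 0 and is omitted. In
   [glue] the cover has to be [inhabited] so that it covers the generic point;
   W ranges over the nonempty open subsets of the intersection of V i and V j
   (one of which is the intersection itself). *)
Record omodule (k : finFieldType) (X : curve k) := OModule {
  sect : forall U : opn X, lmodType (OX U);
  res : forall U V : opn X, V `<=` U -> sect U -> sect V;
  res_lin : forall (U V : opn X) (VU : V `<=` U) (a : OX U) (s t : sect U),
    res VU (a *: s + t) = OX_res VU a *: res VU s + res VU t;
  res_id : forall (U : opn X) (UU : U `<=` U) (s : sect U), res UU s = s;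
  res_comp : forall (U V W : opn X) (VU : V `<=` U) (WV : W `<=` V)
    (WU : W `<=` U) (s : sect U), res WV (res VU s) = res WU s;
  glue : forall (U : opn X) (I : Type) (V : I -> opn X)
    (VU : forall i, V i `<=` U) (s : forall i, sect (V i)),
    inhabited I -> U `<=` \bigcup_i V i ->
    (forall i j (W : opn X) (Wi : W `<=` V i) (Wj : W `<=` V j),
       res Wi (s i) = res Wj (s j)) ->
    exists! t : sect U, forall i, res (VU i) t = s i
}.

Section Morphisms.
Variables (k : finFieldType) (X : curve k).
Implicit Types M N P Q : omodule X.

Record omorphism M N := OMorphism {
  omor :> forall U : opn X, sect M U -> sect N U;
  omor_lin : forall (U : opn X) (a : OX U) (s t : sect M U),
    omor (a *: s + t) = a *: omor s + omor t;
  omor_res : forall (U V : opn X) (VU : V `<=` U) (s : sect M U),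
    omor (res VU s) = res VU (omor s)
}.

Record obilinear M N P := OBilinear {
  obil :> forall U : opn X, sect M U -> sect N U -> sect P U;
  obil_linl : forall (U : opn X) (a : OX U) (s s' : sect M U) (t : sect N U),
    obil (a *: s + s') t = a *: obil s t + obil s' t;
  obil_linr : forall (U : opn X) (a : OX U) (s : sect M U) (t t' : sect N U),
    obil s (a *: t + t') = a *: obil s t + obil s t';
  obil_res : forall (U V : opn X) (VU : V `<=` U) (s : sect M U) (t : sect N U),
    obil (res VU s) (res VU t) = res VU (obil s t)
}.

(* P is isomorphic to the tensor product of M and N over O_X, described by its
   universal property. *)
Definition is_tensor M N P : Prop :=
  exists b : obilinear M N P, forall Q (c : obilinear M N Q),
    exists! f : omorphism P Q,
      forall (U : opn X) (s : sect M U) (t : sect N U), f U (b U s t) = c U s t.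

(* M is locally isomorphic to O_X^n. *)
Definition vector_bundle (n : nat) M : Prop :=
  forall x : place X, exists U : opn X, opn_set U x /\
    exists b : 'I_n -> sect M U, forall (V : opn X) (VU : V `<=` U)
      (s : sect M V),
      exists! a : {ffun 'I_n -> OX V}, s = \sum_i a i *: res VU (b i).

Section DirectSum.
Variables M N : omodule X.
Let S (U : opn X) : lmodType (OX U) := (sect M U * sect N U)%type.
Let r (U V : opn X) (VU : V `<=` U) (s : S U) : S V :=
  (res VU s.1, res VU s.2).

Fact osum_lin (U V : opn X) (VU : V `<=` U) (a : OX U) (s t : S U) :
  r VU (a *: s + t) = OX_res VU a *: r VU s + r VU t.
Proof. by rewrite /r /= !res_lin. Qed.

Fact osum_id (U : opn X) (UU : U `<=` U) (s : S U) : r UU s = s.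
Proof. by case: s => s t; rewrite /r /= !res_id. Qed.

Fact osum_comp (U V W : opn X) (VU : V `<=` U) (WV : W `<=` V)
  (WU : W `<=` U) (s : S U) : r WV (r VU s) = r WU s.
Proof. by rewrite /r /= !(res_comp VU WV WU). Qed.

Fact osum_glue (U : opn X) (I : Type) (V : I -> opn X)
    (VU : forall i, V i `<=` U) (s : forall i, S (V i)) :
    inhabited I -> U `<=` \bigcup_i V i ->
    (forall i j (W : opn X) (Wi : W `<=` V i) (Wj : W `<=` V j),
       r Wi (s i) = r Wj (s j)) ->
    exists! t : S U, forall i, r (VU i) t = s i.
Proof.
move=> I0 cov compat.
have [i j W Wi Wj|t [tP tU]] := glue VU (s := fun i => (s i).1) I0 cov.
  by have [] := compat i j W Wi Wj.
have [i j W Wi Wj|t' [tP' tU']] := glue VU (s := fun i => (s i).2) I0 cov.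
  by have [] := compat i j W Wi Wj.
exists (t, t'); split=> [i|[u u'] uP].
  by rewrite /r /= tP tP'; case: (s i).
congr pair.
  by apply: tU => i; rewrite -(uP i).
by apply: tU' => i; rewrite -(uP i).
Qed.

Definition osum : omodule X := OModule osum_lin osum_id osum_comp osum_glue.
End DirectSum.

End Morphisms.

Record divisor (k : finFieldType) (X : curve k) := Divisor {
  dmult :> place X -> int;
  dmult_fin : finite_set [set x | dmult x != 0]
}.

Section LineBundle.
Variables (k : finFieldType) (X : curve k) (D : place X -> int).

Definition div_sect (U : opn X) : pred X :=
  fun a => `[< forall x, opn_set U x -> vge (ord x) (- D x) a >].

Lemma div_sectP (U : opn X) a :
  reflect (forall x, opn_set U x -> vge (ord x) (- D x) a) (a \in div_sect U).
Proof. exact: asboolP. Qed.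

Lemma div_sect_zmod (U : opn X) : zmod_closed (div_sect U).
Proof.
split=> [|a b /div_sectP aU /div_sectP bU].
  by apply/div_sectP => x _; exact: vge0.
by apply/div_sectP => x xU; apply: (vgeB (ord_dval x)); [exact: aU|exact: bU].
Qed.
HB.instance Definition _ (U : opn X) :=
  GRing.isZmodClosed.Build X (div_sect U) (@div_sect_zmod U).

Record divS (U : opn X) := DivS { divS_val : X; divS_P : divS_val \in div_sect U }.
HB.instance Definition _ (U : opn X) := [isSub for @divS_val U].
HB.instance Definition _ (U : opn X) := [Choice of divS U by <:].
HB.instance Definition _ (U : opn X) := [SubChoice_isSubZmodule of divS U by <:].

Section Scale.
Variable U : opn X.

Fact divS_scale_subproof (a : OX U) (s : divS U) :
  OX_val a * divS_val s \in div_sect U.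
Proof.
apply/div_sectP => x xU; rewrite -[- D x]add0r; apply: (vgeM (ord_dval x)).
  exact: (regularP _ _ (OX_regular a)).
exact: (div_sectP _ _ (divS_P s)).
Qed.

Definition divS_scale (a : OX U) (s : divS U) : divS U :=
  DivS (divS_scale_subproof a s).

Fact divS_scaleA a b s : divS_scale a (divS_scale b s) = divS_scale (a * b) s.
Proof. by apply: val_inj => /=; rewrite mulrA. Qed.
Fact divS_scale1 : left_id 1 divS_scale.
Proof. by move=> s; apply: val_inj => /=; rewrite mul1r. Qed.
Fact divS_scaleDr : right_distributive divS_scale +%R.
Proof. by move=> a s t; apply: val_inj; rewrite /= mulrDr. Qed.
Fact divS_scaleDl s : {morph divS_scale^~ s : a b / a + b}.
Proof. by move=> a b; apply: val_inj; rewrite /= mulrDl. Qed.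
HB.instance Definition _ := GRing.Zmodule_isLmodule.Build (OX U) (divS U)
  divS_scaleA divS_scale1 divS_scaleDr divS_scaleDl.
End Scale.

Fact divS_res_subproof (U V : opn X) (VU : V `<=` U) (s : divS U) :
  divS_val s \in div_sect V.
Proof. by apply/div_sectP => x /VU xU; exact: (div_sectP _ _ (divS_P s)). Qed.

Definition divS_res (U V : opn X) (VU : V `<=` U) (s : divS U) : divS V :=
  DivS (divS_res_subproof VU s).

Fact divS_lin (U V : opn X) (VU : V `<=` U) (a : OX U) (s t : divS U) :
  divS_res VU (a *: s + t) = OX_res VU a *: divS_res VU s + divS_res VU t.
Proof. exact: val_inj. Qed.

Fact divS_id (U : opn X) (UU : U `<=` U) (s : divS U) : divS_res UU s = s.
Proof. exact: val_inj. Qed.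

Fact divS_comp (U V W : opn X) (VU : V `<=` U) (WV : W `<=` V)
  (WU : W `<=` U) (s : divS U) : divS_res WV (divS_res VU s) = divS_res WU s.
Proof. exact: val_inj. Qed.

Fact divS_glue (U : opn X) (I : Type) (V : I -> opn X)
    (VU : forall i, V i `<=` U) (s : forall i, divS (V i)) :
    inhabited I -> U `<=` \bigcup_i V i ->
    (forall i j (W : opn X) (Wi : W `<=` V i) (Wj : W `<=` V j),
       divS_res Wi (s i) = divS_res Wj (s j)) ->
    exists! t : divS U, forall i, divS_res (VU i) t = s i.
Proof.
move=> [i0] cov compat.
have sE i j : divS_val (s i) = divS_val (s j).
  have finW : finite_set (~` (V i `&` V j)).
    by rewrite setCI finite_setU; split; exact: opn_cofinite.
  have := compat i j (Opn finW) (@subIsetl _ _ _) (@subIsetr _ _ _).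
  by move/(congr1 (@divS_val _)).
have sU : divS_val (s i0) \in div_sect U.
  apply/div_sectP => x /cov[i _ xVi]; rewrite (sE i0 i).
  exact: (div_sectP _ _ (divS_P (s i))).
exists (DivS sU); split=> [i|t tP]; apply: val_inj; first exact: sE.
by rewrite /= -(tP i0).
Qed.

(* The line bundle L_D, i.e. O_X(D). *)
Definition line_bundle : omodule X :=
  OModule (sect := fun U => (divS U : lmodType (OX U)))
    divS_lin divS_id divS_comp divS_glue.

End LineBundle.

Section PBun.
Variables (k : finFieldType) (X : curve k).

Definition lin_equiv (D D' : divisor X) : Prop :=
  exists2 a : X, a != 0 & forall x, D x = D' x + ord x a.

Definition effective (D : divisor X) : Prop := forall x, 0 <= D x.

(* [D] belongs to Cl^eff X *)
Definition cl_eff (D : divisor X) : Prop :=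
  exists2 D' : divisor X, effective D' & lin_equiv D D'.

(* The equivalence class of M under isomorphism and tensoring with line bundles.
   (Sheaves live in too large a universe for [set (omodule X)].) *)
Definition pclass (M : omodule X) : omodule X -> Prop :=
  fun M' => vector_bundle 2 M' /\
    exists L : omodule X, vector_bundle 1 L /\ is_tensor M L M'.

(* PBun_2 X *)
Definition PBun2 : Type :=
  {c : omodule X -> Prop | exists M, vector_bundle 2 M /\ c = pclass M}.

(* c_D; the structure sheaf O_X is L_0. *)
Definition c_ (D : divisor X) : omodule X -> Prop :=
  pclass (osum (line_bundle D) (line_bundle (fun=> 0))).

(* n <= #(PBun_2 X - {c_D : [D] in Cl^eff X}), as cardinals *)
Definition le_card_PBun2_diff (n : nat) : Prop :=
  exists phi : 'I_n -> PBun2,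
    (forall i j, phi i = phi j -> i = j) /\
    (forall i (D : divisor X), cl_eff D -> proj1_sig (phi i) <> c_ D).

End PBun.

(* A completion F_x of F at the place x; it is unique up to a unique
   isomorphism. *)
Record completion (k : finFieldType) (X : curve k) (x : place X) := Completion {
  cfield :> fieldType;
  cval : cfield -> int;
  cval_dval : is_dval cval;
  emb : {rmorphism X -> cfield};
  cval_emb : forall a, cval (emb a) = ord x a;
  emb_dense : forall (b : cfield) (n : int), exists a, vge cval n (b - emb a);
  cval_complete : forall u : nat -> cfield,
    (forall n : int, exists N : nat, forall i j : nat,
       (N <= i)%N -> (N <= j)%N -> vge cval n (u i - u j)) ->
    exists l, forall n : int, exists N : nat, forall i : nat,
       (N <= i)%N -> vge cval n (u i - l)
}.

Section Adeles.
Variables (k : finFieldType) (X : curve k).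
Variable C : forall x : place X, completion x.

(* The adele ring A of F: restricted product of the F_x with respect to the O_x *)
Record adele := Adele {
  acomp :> forall x, C x;
  acomp_int : finite_set [set x | ~~ vge (@cval _ _ _ (C x)) 0 (acomp x)]
}.
HB.instance Definition _ := gen_eqMixin adele.
HB.instance Definition _ := gen_choiceMixin adele.

Lemma adeleP (a b : adele) : (forall x, a x = b x) -> a = b.
Proof.
case: a b => [a aP] [b bP] /= ab; have {}ab : a = b by apply: functional_extensionality_dep.
by case: _ / ab bP => bP; congr Adele; exact: Prop_irrelevance.
Qed.

Let vx x : is_dval (@cval _ _ _ (C x)) := cval_dval (C x).

Fact adele_cst_int (P : bool) :
  finite_set [set x | ~~ vge (@cval _ _ _ (C x)) 0 (if P then 1 else 0)].
Proof.
apply: (sub_finite_set (B := set0)) => // x /=.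
by case: P; rewrite ?vge0 ?(vge1 (vx x)).
Qed.
Fact adele_opp_int (a : adele) :
  finite_set [set x | ~~ vge (@cval _ _ _ (C x)) 0 (- a x)].
Proof.
by apply: sub_finite_set (acomp_int a) => x /=; rewrite (vgeN (vx x)).
Qed.
Fact adele_add_int (a b : adele) :
  finite_set [set x | ~~ vge (@cval _ _ _ (C x)) 0 (a x + b x)].
Proof.
have abU : finite_set ([set x | ~~ vge (@cval _ _ _ (C x)) 0 (a x)] `|`
                       [set x | ~~ vge (@cval _ _ _ (C x)) 0 (b x)]).
  by rewrite finite_setU; split; exact: acomp_int.
apply: sub_finite_set abU => x /=; apply: contraNP => /not_orP[].
by move=> /negP/negPn ax /negP/negPn bx; apply: (vgeD (vx x)).
Qed.
Fact adele_mul_int (a b : adele) :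
  finite_set [set x | ~~ vge (@cval _ _ _ (C x)) 0 (a x * b x)].
Proof.
have abU : finite_set ([set x | ~~ vge (@cval _ _ _ (C x)) 0 (a x)] `|`
                       [set x | ~~ vge (@cval _ _ _ (C x)) 0 (b x)]).
  by rewrite finite_setU; split; exact: acomp_int.
apply: sub_finite_set abU => x /=; apply: contraNP => /not_orP[].
by move=> /negP/negPn ax /negP/negPn bx; apply: (@vgeM _ _ (vx x) 0 0).
Qed.

Definition adele0 := @Adele (fun=> 0) (adele_cst_int false).
Definition adele1 := @Adele (fun=> 1) (adele_cst_int true).
Definition adele_opp a := Adele (adele_opp_int a).
Definition adele_add a b := Adele (adele_add_int a b).
Definition adele_mul a b := Adele (adele_mul_int a b).

Fact adele_addA : associative adele_add.
Proof. by move=> a b c; apply: adeleP => x /=; rewrite addrA. Qed.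
Fact adele_addC : commutative adele_add.
Proof. by move=> a b; apply: adeleP => x /=; rewrite addrC. Qed.
Fact adele_add0 : left_id adele0 adele_add.
Proof. by move=> a; apply: adeleP => x /=; rewrite add0r. Qed.
Fact adele_addN : left_inverse adele0 adele_opp adele_add.
Proof. by move=> a; apply: adeleP => x /=; rewrite addNr. Qed.
HB.instance Definition _ :=
  GRing.isZmodule.Build adele adele_addA adele_addC adele_add0 adele_addN.

Fact adele_mulA : associative adele_mul.
Proof. by move=> a b c; apply: adeleP => x /=; rewrite mulrA. Qed.
Fact adele_mulC : commutative adele_mul.
Proof. by move=> a b; apply: adeleP => x /=; rewrite mulrC. Qed.
Fact adele_mul1 : left_id adele1 adele_mul.
Proof. by move=> a; apply: adeleP => x /=; rewrite mul1r. Qed.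
Fact adele_mulD : left_distributive adele_mul adele_add.
Proof. by move=> a b c; apply: adeleP => x /=; rewrite mulrDl. Qed.
HB.instance Definition _ := GRing.Zmodule_isComPzRing.Build adele
  adele_mulA adele_mulC adele_mul1 adele_mulD.

(* O_A *)
Definition adele_int : set adele :=
  [set a | forall x, vge (@cval _ _ _ (C x)) 0 (a x)].

Definition vopen x (U : set (C x)) : Prop :=
  forall a, U a -> exists n : int, forall b,
    vge (@cval _ _ _ (C x)) n (b - a) -> U b.

(* boxes \prod_x U x, with U x open for all x and U x = O_x for almost all x *)
Definition adele_box : set (forall x, set (C x)) :=
  [set U | (forall x, vopen (U x)) /\
     finite_set [set x | U x <> [set a | vge (@cval _ _ _ (C x)) 0 a]]].

HB.instance Definition _ := isSubBaseTopological.Build adele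
  (I := forall x, set (C x)) adele_box (fun U => [set a | forall x, U x (a x)]).
HB.instance Definition _ := isPointed.Build adele 0.

End Adeles.

Record GL2 (R : comPzRingType) := MkGL2 {
  gmx :> 'M[R]_2;
  ginv : 'M[R]_2;
  gmxK : gmx *m ginv = 1%:M;
  ginvK : ginv *m gmx = 1%:M
}.

Section GL2Group.
Variable R : comPzRingType.
Implicit Types g h : GL2 R.

HB.instance Definition _ := gen_eqMixin (GL2 R).
HB.instance Definition _ := gen_choiceMixin (GL2 R).

Lemma GL2P g h : gmx g = gmx h -> g = h.
Proof.
case: g h => [g g' gK g'K] [h h' hK h'K] /= gh; move: gK g'K; rewrite gh => gK g'K.
have g'h' : g' = h' by rewrite -[g']mulmx1 -hK mulmxA g'K mul1mx.
by move: gK g'K; rewrite g'h' => gK g'K; congr MkGL2; exact: Prop_irrelevance.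
Qed.

Fact GL2_mulP g h : (g *m h) *m (ginv h *m ginv g) = 1%:M.
Proof. by rewrite -mulmxA (mulmxA _ (ginv h)) gmxK mul1mx gmxK. Qed.
Fact GL2_mulP' g h : (ginv h *m ginv g) *m (g *m h) = 1%:M.
Proof. by rewrite -mulmxA (mulmxA _ (gmx g)) ginvK mul1mx ginvK. Qed.

Definition GL2_one : GL2 R := MkGL2 (mulmx1 1%:M) (mulmx1 1%:M).
Definition GL2_mul g h : GL2 R := MkGL2 (GL2_mulP g h) (GL2_mulP' g h).
Definition GL2_inv g : GL2 R := MkGL2 (ginvK g) (gmxK g).

Fact GL2_mulA : associative GL2_mul.
Proof. by move=> g h l; apply: GL2P; rewrite /= mulmxA. Qed.
Fact GL2_mul1 : left_id GL2_one GL2_mul.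
Proof. by move=> g; apply: GL2P; rewrite /= mul1mx. Qed.
Fact GL2_mulr1 : right_id GL2_one GL2_mul.
Proof. by move=> g; apply: GL2P; rewrite /= mulmx1. Qed.
Fact GL2_mulV : left_inverse GL2_one GL2_inv GL2_mul.
Proof. by move=> g; apply: GL2P; rewrite /= ginvK. Qed.
Fact GL2_mulrV : right_inverse GL2_one GL2_inv GL2_mul.
Proof. by move=> g; apply: GL2P; rewrite /= gmxK. Qed.
HB.instance Definition _ := isGroup.Build (GL2 R)
  GL2_mulA GL2_mul1 GL2_mulr1 GL2_mulV GL2_mulrV.
HB.instance Definition _ := isPointed.Build (GL2 R) 1%g.

(* equality of the classes modulo the centre R^x of scalar matrices *)
Definition pgl_eq : rel (GL2 R) :=
  fun g h => `[< exists2 z : GL2 R, (exists a, gmx z = a%:M) & h = (z * g)%g >].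

Lemma centre_comm (z g : GL2 R) a : gmx z = a%:M -> (z * g = g * z)%g.
Proof. by move=> za; apply: GL2P; rewrite /= za mul_scalar_mx mul_mx_scalar. Qed.

Lemma centreV (z : GL2 R) a : gmx z = a%:M -> exists b, gmx z^-1%g = b%:M.
Proof.
move=> za; exists (ginv z 0 0); apply/matrixP => i j; rewrite mxE.
have aV r s : a * ginv z r s = (r == s)%:R.
  by move/matrixP: (gmxK z) => /(_ r s); rewrite za mul_scalar_mx !mxE.
have aV0 : a * ginv z 0 0 = 1 by rewrite aV eqxx.
by rewrite -[LHS]mulr1 -aV0 mulrCA mulrA aV mulr_natl.
Qed.

Fact pgl_eq_refl : reflexive pgl_eq.
Proof. by move=> g; apply/asboolP; exists 1%g; [exists 1|rewrite mul1g]. Qed.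
Fact pgl_eq_sym : symmetric pgl_eq.
Proof.
suff sub g h : pgl_eq g h -> pgl_eq h g by move=> g h; apply/idP/idP; exact: sub.
move=> /asboolP[z [a za] ->]; apply/asboolP.
by exists z^-1%g; [exact: centreV za|rewrite mulKg].
Qed.
Fact pgl_eq_trans : transitive pgl_eq.
Proof.
move=> h g l /asboolP[z [a za] ->] /asboolP[y [b yb] ->]; apply/asboolP.
exists (y * z)%g; last by rewrite mulgA.
by exists (b * a); rewrite /= za yb mul_mx_scalar scale_scalar_mx mulrC.
Qed.
Canonical pgl_equiv := EquivRel pgl_eq pgl_eq_refl pgl_eq_sym pgl_eq_trans.

End GL2Group.

Section PGL2.
Variables (k : finFieldType) (X : curve k).
Variable C : forall x : place X, completion x.
Local Open Scope quotient_scope.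

(* GL_2(A) has the coarsest topology making g |-> (g, g^-1) continuous *)
HB.instance Definition _ := Topological.copy (GL2 (adele C))
  (initial_topology (fun g : GL2 (adele C) => (gmx g, ginv g))).

(* PGL_2(A) = GL_2(A) / A^x *)
Definition PGL2A : Type := quotient_topology {eq_quot @pgl_equiv (adele C)}.
HB.instance Definition _ := PointedTopological.on PGL2A.
HB.instance Definition _ := Quotient.on PGL2A.

Definition pgl (g : GL2 (adele C)) : PGL2A := \pi g.

Lemma pgl_eqP (g h : GL2 (adele C)) :
  (pgl g = pgl h) <-> exists2 z, (exists a, gmx z = a%:M) & h = (z * g)%g.
Proof. by split => [/eqmodP/asboolP|?]; [|apply/eqmodP/asboolP]. Qed.

Lemma pglM (g h : GL2 (adele C)) :
  pgl (repr (pgl g) * repr (pgl h))%g = pgl (g * h)%g.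
Proof.
have [z [a za] zE] : exists2 z, (exists a, gmx z = a%:M) & g = (z * repr (pgl g))%g.
  by apply/pgl_eqP; rewrite /pgl reprK.
have [y [b yb] yE] : exists2 z, (exists a, gmx z = a%:M) & h = (z * repr (pgl h))%g.
  by apply/pgl_eqP; rewrite /pgl reprK.
apply/pgl_eqP; exists (z * y)%g.
  by exists (a * b); rewrite /= za yb mul_mx_scalar scale_scalar_mx mulrC.
rewrite {1}zE {1}yE -!mulgA; congr (z * _)%g.
by rewrite mulgA -(centre_comm _ yb) -mulgA.
Qed.

Definition PGL2_one : PGL2A := pgl 1%g.
Definition PGL2_mul (g h : PGL2A) : PGL2A := pgl (repr g * repr h)%g.
Definition PGL2_inv (g : PGL2A) : PGL2A := pgl (repr g)^-1%g.

Fact PGL2_mulA : associative PGL2_mul.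
Proof.
move=> f g h; rewrite /PGL2_mul -{1}(reprK f) -{2}(reprK h).
by rewrite -![\pi_PGL2A _]/(pgl _) !pglM mulgA.
Qed.
Fact PGL2_mul1 : left_id PGL2_one PGL2_mul.
Proof.
move=> g; rewrite /PGL2_mul -{1}(reprK g) -[\pi_PGL2A _]/(pgl _) pglM mul1g.
exact: reprK.
Qed.
Fact PGL2_mulr1 : right_id PGL2_one PGL2_mul.
Proof.
move=> g; rewrite /PGL2_mul -{1}(reprK g) -[\pi_PGL2A _]/(pgl _) pglM mulg1.
exact: reprK.
Qed.
Fact PGL2_mulV : left_inverse PGL2_one PGL2_inv PGL2_mul.
Proof.
move=> g; rewrite /PGL2_mul -{2}(reprK g) -[\pi_PGL2A _]/(pgl _) pglM.
by rewrite mulVg.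
Qed.
Fact PGL2_mulrV : right_inverse PGL2_one PGL2_inv PGL2_mul.
Proof.
move=> g; rewrite /PGL2_mul -{1}(reprK g) -[\pi_PGL2A _]/(pgl _) pglM.
by rewrite mulgV.
Qed.
HB.instance Definition _ := isGroup.Build PGL2A
  PGL2_mulA PGL2_mul1 PGL2_mulr1 PGL2_mulV PGL2_mulrV.

(* G(F), embedded diagonally *)
Definition PGL2F : set PGL2A := pgl @`
  [set g : GL2 (adele C) | exists2 m : 'M[X]_2, m \in unitmx &
     forall x i j, g i j x = emb (C x) (m i j)].

(* K = G(O_A) *)
Definition PGL2O : set PGL2A := pgl @`
  [set g : GL2 (adele C) | forall i j, adele_int (g i j) /\ adele_int (ginv g i j)].

End PGL2.

(* E is the compositum of F and the quadratic extension F_q2 of k = F_q, and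
   [qbasis] is a basis of F_q2 over F_q. *)
Record const_ext (k : finFieldType) (X : curve k) := ConstExt {
  Fq2 : fieldExtType k;
  qbasis : 2.-tuple Fq2;
  qbasisP : basis_of fullv qbasis;
  cext : fieldExtType (X : fieldType);
  cincl : {rmorphism Fq2 -> cext};
  cincl_const : forall c : k, cincl c%:A = (const X c)%:A;
  cext_gen : forall S : {subfield cext},
    (forall z, cincl z \in S) -> S = fullv :> {vspace cext}
}.

Section Torus.
Variables (k : finFieldType) (X : curve k) (E : const_ext X).
Variable C : forall x : place X, completion x.

Definition cbasis : 2.-tuple (cext E) := [tuple of map (@cincl _ _ E) (qbasis E)].

(* the matrix of multiplication by z in the basis [cbasis] of E over F *)
Definition mulE_mx (z : cext E) : 'M[X]_2 :=
  \matrix_(i, j) coord cbasis i (z * cbasis`_j).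

(* T'(A) = (E (x)_F A)^x consists of the A-linear combinations of the image of E
   in the 2x2-matrices that are invertible. *)
Definition torA' : set (GL2 (adele C)) :=
  [set g : GL2 (adele C) | exists a : 'I_2 -> adele C, forall x i j,
     g i j x = \sum_s a s x * emb (C x) (mulE_mx cbasis`_s i j)].

Definition torF' : set (GL2 (adele C)) :=
  [set g : GL2 (adele C) | exists2 z : cext E, z != 0 &
     forall x i j, g i j x = emb (C x) (mulE_mx z i j)].

Definition torA : set (PGL2A C) := @pgl _ _ C @` torA'.
Definition torF : set (PGL2A C) := @pgl _ _ C @` torF'.

End Torus.
Arguments torA' {k X} E C.
Arguments torF' {k X} E C.
Arguments torA {k X} E C.
Arguments torF {k X} E C.
Arguments PGL2F {k X} C.
Arguments PGL2O {k X} C.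

Section TorusTheory.
Variables (k : finFieldType) (X : curve k) (E : const_ext X).

Lemma cincl_in_F (th : Fq2 E) (a : X) : cincl E th = a%:A -> th \in 1%VS.
Proof.
move=> tha.
have [/polyOver1P[q qE] pm] := (minPolyOver 1 th, monic_minPoly 1 th).
have sq : size q = size (minPoly 1 th) by rewrite qE size_map_poly.
have q_irr : irreducible_poly q.
  split; first by rewrite sq size_minPoly ltnS adjoin_degreeE divn_gt0 ?adim_gt0 // dimvS //; exact: subv_adjoin.
  move=> r r1 rq; have : map_poly (in_alg (Fq2 E)) r %| minPoly 1 th.
    by rewrite qE dvdp_map.
  move/minPoly_irr; have rO : map_poly (in_alg (Fq2 E)) r \is a polyOver 1%VS.
    by apply/polyOver1P; exists r.
  move/(_ rO) => /orP[|]; first by rewrite qE eqp_map.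
  by move/eqp_size; rewrite size_map_poly size_poly1 => r1'; rewrite r1' in r1.
have rt : root (map_poly (const X) q) a.
  rewrite -(fmorph_root (in_alg (cext E))) -map_poly_comp.
  rewrite (eq_map_poly (g := cincl E \o in_alg (Fq2 E))); last first.
    by move=> c /=; rewrite -cincl_const.
  rewrite map_poly_comp /= -tha fmorph_root -qE.
  exact: root_minPoly.
have [_ /(_ ('X - a%:P))] := geom_irr X q_irr.
rewrite size_XsubC dvdp_XsubCl rt => /(_ isT isT) /eqp_size.
rewrite size_XsubC size_map_poly sq size_minPoly => -[] ad1.
rewrite -(@adjoin_deg_eq1 _ _ 1%AS th).
by rewrite /adjoin_degree -ad1.
Qed.

Lemma cbasis_free : free (cbasis E).
Proof.
have := basis_free (qbasisP E); rewrite /cbasis /=.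
case: (qbasis E) => -[|e0 [|e1 [|? ?]]] //= _.
rewrite !free_cons !nil_free !span_seq1 !span_nil !memv0 !andbT.
rewrite fmorph_eq0 => /andP[e01 e1_neq0]; rewrite e1_neq0 andbT.
apply: contraNN e01 => /vlineP[a e0E].
have : e0 / e1 \in 1%VS.
  apply: (@cincl_in_F _ a); rewrite rmorphM fmorphV e0E -scalerAl divff //.
  by rewrite fmorph_eq0.
move=> /vlineP[c cE]; apply/vlineP; exists c.
by rewrite -[LHS](divfK e1_neq0) cE mulr_algl.
Qed.

Lemma mulE_mx1 : mulE_mx (1 : cext E) = 1%:M.
Proof.
by apply/matrixP => i j; rewrite !mxE mul1r coord_free ?cbasis_free // eq_sym.
Qed.

Lemma mulE_mxD (a b : X) (z w : cext E) :
  mulE_mx (a *: z + b *: w) = a *: mulE_mx z + b *: mulE_mx w.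
Proof.
by apply/matrixP => i j; rewrite !mxE mulrDl -!scalerAl linearD !linearZ.
Qed.

Lemma one_cbasis : exists c : 'I_2 -> k, 1 = \sum_s (const X (c s)) *: (cbasis E)`_s.
Proof.
exists (fun s => coord (qbasis E) s 1).
rewrite -(rmorph1 (cincl E)) {1}(coord_basis (qbasisP E) (memvf 1)) rmorph_sum.
apply: eq_bigr => i _; rewrite (nth_map 0) ?size_tuple //.
by rewrite -mulr_algl rmorphM cincl_const mulr_algl.
Qed.

End TorusTheory.

Section TorusOne.
Variables (k : finFieldType) (X : curve k) (E : const_ext X).
Variable C : forall x : place X, completion x.

Fact adele_const_int (c : k) :
  finite_set [set x | ~~ vge (@cval _ _ _ (C x)) 0 (emb (C x) (const X c))].
Proof.
apply: (sub_finite_set (B := set0)) => // x /=; case/negP.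
have [->|c0] := eqVneq c 0; first by rewrite !rmorph0 vge0.
by rewrite /vge cval_emb ord_const ?lexx ?orbT.
Qed.

Lemma torA'1 : torA' E C 1%g.
Proof.
have [c cE] := one_cbasis E.
exists (fun s => Adele (adele_const_int (c s))) => x i j /=.
under eq_bigr do rewrite -rmorphM.
rewrite -rmorph_sum /=.
have -> : \sum_s const X (c s) * mulE_mx (cbasis E)`_s i j = (1%:M : 'M[X]_2) i j.
  rewrite -(mulE_mx1 E) cE mxE mulr_suml linear_sum; apply: eq_bigr => s _.
  by rewrite mxE -scalerAl linearZ.
by rewrite !mxE; case: (i == j); rewrite /= ?rmorph1 ?rmorph0.
Qed.

Lemma torA1 : torA E C 1%g.
Proof. by exists 1%g => //; exact: torA'1. Qed.

End TorusOne.

Section TorusQuotient.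
Variables (k : finFieldType) (X : curve k) (E : const_ext X).
Variable C : forall x : place X, completion x.
Local Open Scope quotient_scope.

Definition TA : Type := torA E C.
HB.instance Definition _ := Topological.on TA.
Definition TA_one : torA E C := exist _ 1%g (mem_set (torA1 E C)).
HB.instance Definition _ := isPointed.Build TA TA_one.

(* equality of the cosets T(F)t and T(F)t' *)
Definition torF_eq : rel TA :=
  fun t t' => `[< [set (c * val t)%g | c in torF E C] =
                  [set (c * val t')%g | c in torF E C] >].

Fact torF_eq_refl : reflexive torF_eq.
Proof. by move=> t; apply/asboolP. Qed.
Fact torF_eq_sym : symmetric torF_eq.
Proof. by move=> t t'; apply/asboolP/asboolP. Qed.
Fact torF_eq_trans : transitive torF_eq.
Proof. by move=> u t v /asboolP tu /asboolP uv; apply/asboolP; rewrite tu. Qed.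
Canonical torF_equiv := EquivRel torF_eq torF_eq_refl torF_eq_sym torF_eq_trans.

(* T(F)\T(A) *)
Definition TFA : Type := quotient_topology {eq_quot torF_equiv}.
HB.instance Definition _ := PointedTopological.on TFA.
HB.instance Definition _ := Quotient.on TFA.

Definition trepr (u : TFA) : PGL2A C := val (repr u).

(* the translation u |-> tu of T(F)\T(A) by t in T(A); the default value of
   [insubd] is not used since t * trepr u is in T(A). *)
Definition ttrans (t : TA) (u : TFA) : TFA :=
  \pi_TFA (insubd TA_one (val t * trepr u)%g : TA).

End TorusQuotient.

Definition borel (T : ptopologicalType) := g_sigma_algebraType (@open T).

(* mu is a nonzero Borel measure, finite on compact sets and invariant under
   the action of G. On the second countable locally compact spaces considered
   here such a measure is automatically regular. *)
Definition is_haar (R : realType) (T : ptopologicalType) (G : Type)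
    (act : G -> T -> T) (mu : {measure set (borel T) -> \bar R}) : Prop :=
  [/\ exists2 B : set (borel T), measurable B & mu B <> 0%E,
      forall B : set (borel T), compact (B : set T) -> measurable B ->
        (mu B < +oo)%E
    & forall (g : G) (B : set (borel T)), measurable B ->
        mu (act g @^-1` B) = mu B].

Definition cintegral (R : realType) (d : measure_display) (T : measurableType d)
    (mu : {measure set T -> \bar R}) (f : T -> complex R) : complex R :=
  Complex (\int[mu]_x complex.Re (f x)) (\int[mu]_x complex.Im (f x)).

Section Toroidal.
Variables (R : realType) (k : finFieldType) (X : curve k) (E : const_ext X).
Variable C : forall x : place X, completion x.
Variable mu : {measure set (borel (PGL2A C)) -> \bar R}.
Variable dt : {measure set (borel (TFA E C)) -> \bar R}.
Implicit Types f Phi : PGL2A C -> complex R.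

Definition hecke_algebra : set (PGL2A C -> complex R) :=
  [set Phi : PGL2A C -> complex R | [/\ forall g : PGL2A C, \forall h \near g, Phi h = Phi g,
     compact ( closure [set g : PGL2A C | Phi g != 0])
   & forall g a b, PGL2O C a -> PGL2O C b -> Phi (a * g * b)%g = Phi g]].

Definition hecke_act Phi f : PGL2A C -> complex R :=
  fun g => cintegral mu (fun h : borel (PGL2A C) => Phi h * f (g * h)%g).

(* [hecke_act Phi f] is left T(F)-invariant when f is left G(F)-invariant, so that
   its values do not depend on the representatives [trepr t]. *)
Definition toroidal f : Prop :=
  forall Phi, hecke_algebra Phi ->
    cintegral dt (fun t : borel (TFA E C) => hecke_act Phi f (trepr t)) = 0.

(* functions on PGL_2(F)\PGL_2(A)/K that are E-toroidal *)
Definition Vtor : set (PGL2A C -> complex R) :=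
  [set f | (forall g c a, PGL2F C c -> PGL2O C a -> f (c * g * a)%g = f g) /\
           toroidal f].

End Toroidal.

(* the space V of functions has a basis with n elements *)
Definition has_dim (S : Type) (K : fieldType) (V : set (S -> K)) (n : nat) : Prop :=
  exists b : 'I_n -> S -> K,
    (forall c : 'I_n -> K, (forall s, \sum_i c i * b i s = 0) ->
       forall i, c i = 0) /\
    V = [set f | exists c : 'I_n -> K, forall s, f s = \sum_i c i * b i s].

(* Main.v *)
Require Import Defs.
From HB Require Import structures.
From mathcomp Require Import all_boot all_order all_algebra all_field.
From mathcomp Require Import all_classical all_reals all_analysis complex.
From mathcomp Require Import zify ring lra finmap.

Set Implicit Arguments.
Unset Strict Implicit.
Unset Printing Implicit Defensive.

Import Order.TTheory GRing.Theory Num.Theory.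

Local Open Scope classical_set_scope.
Local Open Scope ring_scope.

(* The toroidal functions are determined by their values on finitely many double
   cosets. Write deg D multiplicatively as nrm D = q^(deg D). Counting the cosets of
   A(D) = \prod_x p_x^(-D x) in A gives Riemann-Roch in the form
   nrm D * #H^1(D) = kappa * #H^0(D), from which one gets the product formula, the
   vanishing of H^1 and the existence of sections in large degree. For
   g in GL_2(A), a nonzero vector of F^2 in the lattice of g yields a triangular
   representative of the double coset of g; with finitely many exceptions, the double
   cosets are those of the c_D with D effective.

   Now let f be toroidal and zero on all the other double cosets. By induction on
   deg D, f(c_D) = 0: take for Phi the characteristic function of K c_D K and suppose
   that t h is in the double coset of c_D', with t in T(A), h in K c_D K, D' effective
   and f(t h) <> 0, hence deg D' >= deg D. The first column of the matrix of GL_2(F)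
   involved is an element z of E^x such that w = t^-1 z maps 1 in E to an integral
   vector. Its entries are the coefficients of w in the basis, whose elements act by
   constant matrices; so w is integral. Comparing degrees, w is in K and D' ~ D. The
   toroidal integral is thus f(c_D) times a positive volume.

   Finally, the locally free sheaf attached to g has as local sections the vectors of
   F^2 in g_x O_x^2. A universal bilinear map to such a sheaf from another one and a
   line bundle is given generically by a matrix of GL_2(F), and matches the local
   lattices up to an idele, so that distinct double cosets give distinct elements of
   PBun_2. *)

(** * Indices of subgroups *)

(** The curve is given only by its field F, so its geometry has to come from counting in F. That F
    has degree n over k(t) is used in this form: combinations of fixed elements of F, with
    coefficients polynomials in t of degree below J, number O(q^(n J)). This bounds zeros and
    residue fields, and a count from below yields sections; together they give Riemann's inequality.
    Sizes replace dimensions: H^0(D) is a finite group, H^1(D) appears only as the index of A(D) + F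
    in A, and exact sequences become products of indices. Places with prescribed zeros have to be
    constructed in order to know that a function without poles is constant; there geometric
    irreducibility says that the constants are those of F_q. The integrals in the toroidal condition
    have default values, so even the linearity of that condition needs proof. It rests on
    finiteness: each integrand is invariant under K or under the intersection of K with T(A), takes
    finitely many values, and vanishes outside a set of finite measure. The induction on degrees is
    well founded because the norm of an effective divisor is an index, hence a positive integer. *)

Section Index.
Variable V : zmodType.
Implicit Types (G H L P : set V).

Definition subgrp G := G 0 /\ forall a b, G a -> G b -> G (a - b).

Definition sumset G H : set V := [set v | exists2 g, G g & H (v - g)].

(* [G : H] = n, for a subgroup H of G *)
Definition idx G H (n : nat) := exists (T : finType) (r : T -> V),
  [/\ #|T| = n, forall i, G (r i) & forall v, G v -> exists! i, H (v - r i)].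

Lemma subgrpN G a : subgrp G -> G a -> G (- a).
Proof. by move=> [G0 GB] Ga; rewrite -sub0r; exact: GB. Qed.

Lemma subgrpD G a b : subgrp G -> G a -> G b -> G (a + b).
Proof. by move=> gG Ga Gb; rewrite -[b]opprK; apply: gG.2 => //; exact: subgrpN. Qed.

Lemma subgrpC G a b : subgrp G -> G (a - b) -> G (b - a).
Proof. by move=> gG /(subgrpN gG); rewrite opprB. Qed.

Lemma subgrpI G H : subgrp G -> subgrp H -> subgrp (G `&` H).
Proof.
by move=> [G0 GB] [H0 HB]; split=> // a b [? ?] [? ?]; split; [exact: GB|exact: HB].
Qed.

Lemma subgrp_sumset G H : subgrp G -> subgrp H -> subgrp (sumset G H).
Proof.
move=> gG gH; split; first by exists 0; [exact: gG.1|rewrite subr0; exact: gH.1].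
move=> a b [g Gg Ha] [g' Gg' Hb]; exists (g - g'); first exact: gG.2.
have -> : a - b - (g - g') = (a - g) - (b - g').
  by rewrite !opprB addrACA [RHS]addrACA (addrC (- b)).
exact: gH.2.
Qed.

Lemma sub_sumsetl G H : subgrp H -> G `<=` sumset G H.
Proof. by move=> gH v Gv; exists v => //; rewrite subrr; exact: gH.1. Qed.

Lemma sub_sumsetr G H : subgrp G -> H `<=` sumset G H.
Proof. by move=> gG v Hv; exists 0; rewrite ?subr0 //; exact: gG.1. Qed.

(** Pigeonhole on cosets: pairwise incongruent elements have distinct representatives. *)
Lemma idx_le G H n (T : finType) (s : T -> V) : subgrp H -> idx G H n ->
  (forall i, G (s i)) -> (forall i j, H (s i - s j) -> i = j) -> (#|T| <= n)%N.
Proof.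
move=> gH [U [r [<- Gr rP]]] Gs sH.
have /choice[f fP] : forall i : T, exists j : U, H (s i - r j).
  by move=> i; have [j [Hj _]] := rP _ (Gs i); exists j.
apply: (@leq_card _ _ f) => i j fij; apply: sH.
have -> : s i - s j = (s i - r (f i)) - (s j - r (f j)) by rewrite fij opprB subrKA.
by apply: gH.2.
Qed.

Lemma idx_sep (G H : set V) (T : finType) (r : T -> V) i j : subgrp H ->
  (forall i, G (r i)) -> (forall v, G v -> exists! i, H (v - r i)) ->
  H (r i - r j) -> i = j.
Proof.
move=> gH Gr rP Hij; have [l [_ lU]] := rP _ (Gr i).
transitivity l; last exact: lU.
by apply/esym/lU; rewrite subrr; exact: gH.1.
Qed.

Lemma idx_uniq G H m n : subgrp H -> idx G H m -> idx G H n -> m = n.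
Proof.
move=> gH Im In; apply/eqP; rewrite eqn_leq; apply/andP; split.
  case: Im => [T [r [<- Gr rP]]]; apply: (idx_le gH In Gr) => i j.
  exact: (idx_sep gH Gr rP).
case: In => [T [r [<- Gr rP]]]; apply: (idx_le gH Im Gr) => i j.
exact: (idx_sep gH Gr rP).
Qed.

Lemma idx_trans G H L m n : subgrp G -> subgrp H -> subgrp L -> H `<=` G -> L `<=` H ->
  idx G H m -> idx H L n -> idx G L (m * n)%N.
Proof.
move=> gG gH gL HG LH [T [r [<- Gr rP]]] [U [s [<- Hs sP]]].
exists (T * U)%type, (fun p => r p.1 + s p.2); rewrite card_prod; split=> // [p|v Gv].
  by apply: subgrpD => //; apply: HG.
have [i [Hi iU]] := rP v Gv; have [j [Lj jU]] := sP _ Hi.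
exists (i, j); split=> [|[i' j'] /=]; first by rewrite /= opprD addrA.
rewrite opprD addrA => L'.
have ii' : i = i'.
  apply: iU; rewrite -[_ - _](subrK (s j')); apply: subgrpD => //; exact: LH.
by rewrite -ii' in L' *; rewrite (jU _ L').
Qed.

(** An incongruent family of maximal length meets every coset, since a missed coset would supply one
    more element. A bound on such families thus becomes a finite index. *)
Lemma idx_bound G H B : subgrp G -> subgrp H ->
  (forall m (s : 'I_m -> V), (forall i, G (s i)) ->
     (forall i j, H (s i - s j) -> i = j) -> (m <= B)%N) ->
  exists2 n, (n <= B)%N & idx G H n.
Proof.
move=> gG gH bnd.
pose P m := `[< exists s : 'I_m -> V, (forall i, G (s i)) /\
     (forall i j, H (s i - s j) -> i = j) >].
have P0 : exists m, P m.
  by exists 0%N; apply/asboolP; exists (fun=> 0); split=> [] [].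
have PB m : P m -> (m <= B)%N by move=> /asboolP[s [Gs sH]]; exact: bnd Gs sH.
have [m /asboolP[s [Gs sH]] mmax] := ex_maxnP P0 PB.
exists m; first by apply: PB; apply/asboolP; exists s.
exists 'I_m, s; rewrite card_ord; split=> // v Gv.
have [[i Hi]|nex] := pselect (exists i, H (v - s i)).
  exists i; split=> // j Hj; apply: sH.
  have -> : s i - s j = (v - s j) - (v - s i) by rewrite opprB [RHS]addrC subrKA.
  exact: gH.2.
have /mmax : P m.+1.
  apply/asboolP; exists (fun i => if unlift ord0 i is Some j then s j else v).
  split=> [i|i j]; first by case: unliftP.
  case: unliftP => [i' ->|->]; case: unliftP => [j' ->|->] //.
  - by move/sH => ->.
  - by move/(subgrpC gH) => Hi; case: nex; exists i'.
  - by move=> Hi; case: nex; exists j'.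
by rewrite ltnn.
Qed.

Lemma idx_sub G H L n : subgrp G -> subgrp H -> subgrp L -> H `<=` G -> L `<=` H ->
  idx G L n -> exists a b, [/\ idx G H a, idx H L b & n = (a * b)%N].
Proof.
move=> gG gH gL HG LH I.
have [a _ Ia] : exists2 a, (a <= n)%N & idx G H a.
  apply: idx_bound => // m s Gs sH; rewrite -(card_ord m).
  by apply: (idx_le gL I Gs) => i j /LH /sH.
have [b _ Ib] : exists2 a, (a <= n)%N & idx H L a.
  apply: idx_bound => // m s Gs sH; rewrite -(card_ord m).
  by apply: (idx_le gL I _ sH) => i; exact: HG.
exists a, b; split=> //; apply: (idx_uniq gL I).
exact: (@idx_trans _ H).
Qed.

Lemma idx_gt0 G H n : G 0 -> idx G H n -> (0 < n)%N.
Proof.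
by move=> G0 [T [r [<- _ /(_ _ G0)[i _]]]]; apply/card_gt0P; exists i.
Qed.

(** The second isomorphism theorem for H + G. *)
Lemma idx_isom G H n : subgrp G -> subgrp H -> idx (sumset H G) H n <-> idx G (H `&` G) n.
Proof.
move=> gG gH; split=> [[T [r [<- Gr rP]]]|[T [r [<- Gr rP]]]].
  have /choice[g gP] : forall i : T, exists g, G g /\ H (r i - g).
    move=> i; have [h Hh Gh] := Gr i; exists (r i - h); split => //.
    by rewrite opprB addrC subrK.
  exists T, g; split=> // [i|v Gv]; first by have [] := gP i.
  have [i [Hi iU]] := rP v (sub_sumsetr gH Gv).
  exists i; split=> [|j [Hj _]].
    split; last by apply: gG.2 => //; have [] := gP i.
    have -> : v - g i = v - r i + (r i - g i) by rewrite subrKA.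
    by apply: subgrpD => //; have [] := gP i.
  apply: iU; have -> : v - r j = v - g j - (r j - g j) by rewrite opprB subrKA.
  by apply: gH.2 => //; have [] := gP j.
exists T, r; split=> // [i|v [h Hh Gv]]; first exact: sub_sumsetr.
have [i [[Hi Gi] iU]] := rP _ Gv; exists i; split=> [|j Hj].
  have -> : v - r i = (v - h - r i) + h by rewrite addrAC subrK.
  exact: subgrpD.
apply: iU; split; last exact: gG.2.
have -> : v - h - r j = (v - r j) - h by rewrite addrAC.
exact: gH.2.
Qed.

(** The sum of [H] and the intersection of [G] with [P] lies between [H] and [G]; both steps are
    identified by [idx_isom] and the modular law. With [P] the diagonal field F and [G], [H] two
    groups A(E), A(D), this is the exact sequence linking H^0 and H^1 of D and E. *)
Lemma idx_second G H P m : subgrp G -> subgrp H -> subgrp P -> H `<=` G -> idx G H m ->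
  exists a b, [/\ idx (G `&` P) (H `&` P) a, idx (sumset G P) (sumset H P) b
    & m = (a * b)%N].
Proof.
move=> gG gH gP HG I.
have gGP := subgrpI gG gP.
have gM := subgrp_sumset gH gGP.
have MG : sumset H (G `&` P) `<=` G.
  by move=> v [h /HG Gh [Gv _]]; rewrite -(subrK h v); exact: subgrpD.
have HM := @sub_sumsetl H _ gGP.
have [b [a [Ib Ia ->]]] := idx_sub gG gM gH MG HM I.
exists a, b; split; last exact: mulnC.
  have /(idx_isom _ gGP gH) := Ia.
  by rewrite setIA (_ : H `&` G = H) //; apply/setIidPl.
have E1 : sumset G P = sumset (sumset H P) G.
  apply/seteqP; split=> v.
    move=> [g Gg Pv]; exists (v - g); last by rewrite opprB addrCA subrr addr0.
    exact: sub_sumsetr.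
  move=> [u [h Hh Pu] Gv]; exists (v - u + h); first exact: subgrpD (HG _ Hh).
  by have -> : v - (v - u + h) = u - h by rewrite opprD opprB addrA addrCA subrr addr0.
rewrite E1; apply/idx_isom => //; first exact: subgrp_sumset.
suff -> : sumset H P `&` G = sumset H (G `&` P) by [].
apply/seteqP; split=> v.
  by move=> [[h Hh Pv] Gv]; exists h => //; split=> //; apply: gG.2 => //; exact: HG.
by move=> [h Hh [Gv Pv]]; split; [exists h|rewrite -(subrK h v); apply: subgrpD => //; exact: HG].
Qed.

Lemma idx1 G H : subgrp H -> idx G H 1 -> H `<=` G -> G `<=` H.
Proof.
move=> gH [T [r [T1 Gr rP]]] HG v Gv; have [i [Hi _]] := rP v Gv.
have [j [Hj _]] := rP _ (HG _ gH.1).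
have ij : i = j by apply: fintype_le1P; rewrite T1.
have -> : v = (v - r i) - (0 - r j) by rewrite ij sub0r opprK subrK.
exact: gH.2.
Qed.

Lemma idxxx G : subgrp G -> idx G G 1.
Proof.
move=> gG; exists unit, (fun=> 0); rewrite card_unit; split=> // [_|v Gv]; first exact: gG.1.
by exists tt; split=> [|[]//]; rewrite subr0.
Qed.

End Index.

Lemma idx_img (V W : zmodType) (f : V -> W) (G H : set V) n :
  (forall a b, f (a - b) = f a - f b) -> injective f -> idx G H n ->
  idx (f @` G) (f @` H) n.
Proof.
move=> fB fI [T [r [<- Gr rP]]]; exists T, (f \o r); split=> // [i|_ [v Gv <-]].
  by exists (r i).
have [i [Hi iU]] := rP v Gv; exists i; split=> [|j [h Hh /=]].
  by exists (v - r i) => //=; rewrite fB.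
by rewrite -fB => /fI hE; apply: iU; rewrite -hE.
Qed.

HB.instance Definition _ (k : finFieldType) (X : curve k) := gen_eqMixin (place X).
HB.instance Definition _ (k : finFieldType) (X : curve k) := gen_choiceMixin (place X).

(** * Places *)

Section DiscreteValuation.
Variables (K : fieldType) (v : K -> int).
Hypothesis vP : is_dval v.
Implicit Types (a b c : K) (m n : int).

Lemma dvalV a : a != 0 -> v a^-1 = - v a.
Proof.
move=> a0; have := dvalM vP a0 (invr_neq0 a0).
by rewrite divff // (dval1 vP) => /esym/eqP; rewrite addrC addr_eq0 => /eqP.
Qed.

Lemma dvalX a (n : nat) : a != 0 -> v (a ^+ n) = v a *+ n.
Proof.
move=> a0; elim: n => [|n IH]; first by rewrite expr0 (dval1 vP).
by rewrite exprS (dvalM vP) ?expf_neq0 // IH mulrS.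
Qed.

Lemma dvalXz a n : a != 0 -> v (a ^ n) = v a * n.
Proof.
move=> a0; case: n => n; first by rewrite -exprnP dvalX // pmulrn mulrzz.
rewrite (_ : a ^ Negz n = (a ^+ n.+1)^-1) // dvalV ?expf_neq0 // dvalX //.
by rewrite pmulrn mulrzz NegzE mulrN.
Qed.

Lemma vgeE n a : a != 0 -> vge v n a = (n <= v a).
Proof. by rewrite /vge => /negbTE ->. Qed.

Lemma vge_le m n a : m <= n -> vge v n a -> vge v m a.
Proof.
by rewrite /vge => mn; case: eqP => //= _; apply: le_trans.
Qed.

Lemma vge_sum n (I : Type) (r : seq I) (P : pred I) (F : I -> K) :
  (forall i, P i -> vge v n (F i)) -> vge v n (\sum_(i <- r | P i) F i).
Proof.
by move=> H; elim/big_rec: _ => [|i a Pi]; [exact: vge0|apply: (vgeD vP); exact: H].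
Qed.

Lemma vgeX (n : nat) a : vge v 0 a -> vge v 0 (a ^+ n).
Proof.
move=> va; elim: n => [|n IH]; first by rewrite expr0 (vge1 vP).
by rewrite exprS -[0 : int]addr0; apply: (vgeM vP).
Qed.

Lemma vgeM0 n a b : vge v 0 a -> vge v n b -> vge v n (a * b).
Proof. by move=> va vb; rewrite -[n]add0r; apply: (vgeM vP). Qed.

Lemma vge_mul n a c : c != 0 -> vge v (n + v c) (c * a) = vge v n a.
Proof.
move=> c0; rewrite /vge mulf_eq0 (negbTE c0) /=.
by have [//|a0/=] := eqVneq a 0; rewrite (dvalM vP) // [v c + _]addrC lerD2r.
Qed.

(** The term of smaller order dominates; the reverse inequality comes from a = (a + b) - b. *)
Lemma dval_dom a b : a != 0 -> vge v (v a + 1) b -> a + b != 0 /\ v (a + b) = v a.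
Proof.
move=> a0 vb; have [->|b0] := eqVneq b 0; first by rewrite addr0.
move: vb; rewrite vgeE // => vb.
have ab0 : a + b != 0.
  by apply: contraTneq vb => /eqP; rewrite addr_eq0 => /eqP ->; rewrite (dvalN vP); lia.
split=> //; apply/eqP; rewrite eq_le; apply/andP; split.
  have := @dvalD _ _ vP (a + b) (- b) ab0.
  rewrite oppr_eq0 addrK (dvalN vP) => /(_ b0 a0); lia.
have := @dvalD _ _ vP a b a0 b0 ab0; rewrite ge_min => /orP[//|vba].
by apply: le_trans vba; apply: le_trans vb; rewrite lerDl.
Qed.

Lemma dval_neg1D c (N : nat) : c != 0 -> v c < 0 -> (0 < N)%N ->
  1 + c ^+ N != 0 /\ v (1 + c ^+ N) = v c *+ N.
Proof.
move=> c0 vc N0; rewrite addrC -dvalX //; apply: dval_dom; first exact: expf_neq0.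
by rewrite vgeE ?oner_neq0 // (dval1 vP) dvalX //; lia.
Qed.

Lemma dval_pos1D c (N : nat) : c != 0 -> 0 < v c -> (0 < N)%N ->
  1 + c ^+ N != 0 /\ v (1 + c ^+ N) = 0.
Proof.
move=> c0 vc N0; rewrite -[RHS](dval1 vP); apply: dval_dom; first exact: oner_neq0.
by rewrite vgeE ?expf_neq0 // (dval1 vP) dvalX //; lia.
Qed.

End DiscreteValuation.

Section Places.
Variables (k : finFieldType) (X : curve k).
Implicit Types (x y z : place X) (a b c : X) (s : seq (place X)).

Lemma place_eq x y : (forall a, ord x a = ord y a) -> x = y.
Proof.
case: x y => [x x1 x2] [y y1 y2] /= xy; have {}xy : x = y by apply/funext.
by case: _ / xy y1 y2 => y1 y2; congr Place; exact: Prop_irrelevance.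
Qed.

(** A discrete valuation ring is a maximal proper subring. If O_x were contained in O_y, units at x
    would be units at y, so ord y would be a multiple of ord x; as both are normalized, they would
    agree. *)
Lemma place_incomp x y : x <> y ->
  exists a, [/\ a != 0, 0 <= ord x a & ord y a < 0].
Proof.
move=> xy; apply: contrapT => nex; apply: xy.
have sub a : a != 0 -> 0 <= ord x a -> 0 <= ord y a.
  by move=> a0 xa; rewrite leNgt; apply/negP => ya; apply: nex; exists a.
have [t t0 xt] := dval_unif (ord_dval x).
have key a : a != 0 -> ord y a = ord y t * ord x a.
  move=> a0; pose u := a * t ^ (- ord x a).
  have tz0 : t ^ (- ord x a) != 0 by apply: expfz_neq0.
  have u0 : u != 0 by rewrite mulf_neq0.
  have xu : ord x u = 0.
    by rewrite (dvalM (ord_dval x)) // (dvalXz (ord_dval x)) // xt mul1r subrr.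
  have := sub _ (invr_neq0 u0); have := sub _ u0.
  rewrite !(dvalV (ord_dval _)) // xu oppr0 => /(_ (lexx _)) yu /(_ (lexx _)) yu'.
  have : ord y u = 0 by lia.
  rewrite (dvalM (ord_dval y)) // (dvalXz (ord_dval y)) // mulrN => /eqP.
  by rewrite subr_eq0 => /eqP.
have [t' t'0 yt'] := dval_unif (ord_dval y).
have yt0 : 0 <= ord y t by apply: sub => //; rewrite xt.
have yt1 : ord y t = 1.
  have : ord y t * ord x t' = 1 by rewrite -key.
  move=> H; have : (`|ord y t| * `|ord x t'| = 1)%N by rewrite -abszM H.
  by move/eqP; rewrite muln_eq1 => /andP[/eqP + _]; lia.
apply: place_eq => a; have [->|a0] := eqVneq a 0.
  by rewrite (dval0 (ord_dval x)) (dval0 (ord_dval y)).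
by rewrite key // yt1 mul1r.
Qed.

Lemma place_sep x y : x <> y -> exists c, [/\ c != 0, ord x c < 0 & 0 < ord y c].
Proof.
move=> xy; have [a [a0 xa ya]] := place_incomp xy.
have [b [b0 yb xb]] := place_incomp (nesym xy).
exists (b / a); rewrite mulf_neq0 ?invr_neq0 //.
rewrite !(dvalM (ord_dval _)) ?invr_neq0 // !(dvalV (ord_dval _)) //; split=> //; lia.
Qed.

Lemma seq_bound (T : eqType) (f : T -> int) (s : seq T) :
  exists N : nat, forall z : T, z \in s -> `|f z| < N%:Z.
Proof.
elim: s => [|y s [N NP]]; first by exists 0%N.
exists (maxn N `|f y|.+1) => z; rewrite inE => /predU1P[->|/NP]; lia.
Qed.

(** Induction on the list, with [c] for the tail and [d] separating [x] from [y]. If ord y c = 0, a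
    high power of c times d works. If ord y c < 0, the factor c^M / (1 + c^M) is a unit at x and y
    and small on the tail, and d does the rest. If ord y c > 0, c itself works. *)
Lemma place_sep_seq x s : x \notin s ->
  exists c, [/\ c != 0, ord x c < 0 & forall y, y \in s -> 0 < ord y c].
Proof.
elim: s => [_|y s IH].
  have [t t0 xt] := dval_unif (ord_dval x).
  by exists t^-1; rewrite invr_neq0 // (dvalV (ord_dval x)) // xt.
rewrite inE negb_or => /andP[/eqP xy /IH[c [c0 xc sc]]].
have [d [d0 xd yd]] := place_sep xy.
have [N NP] := seq_bound (fun z => ord z d) s.
have [yc|yc|yc] := ltrgtP (ord y c) 0; last 1 first.
- exists (c ^+ N * d); rewrite mulf_neq0 ?expf_neq0 //; split=> // [|z].
    by rewrite (dvalM (ord_dval x)) ?expf_neq0 // (dvalX (ord_dval x)) //; lia.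
  rewrite (dvalM (ord_dval z)) ?expf_neq0 // (dvalX (ord_dval z)) // inE.
  case/predU1P => [->|zs]; first by rewrite yc mul0rn add0r.
  by have := sc _ zs; have := NP _ zs; nia.
- pose M := N.+1; have xcM := dval_neg1D (ord_dval x) c0 xc (ltn0Sn N).
  have ycM := dval_neg1D (ord_dval y) c0 yc (ltn0Sn N).
  exists (c ^+ M / (1 + c ^+ M) * d).
  have n0 := xcM.1.
  have E z : ord z (c ^+ M / (1 + c ^+ M) * d) = ord z c *+ M - ord z (1 + c ^+ M) + ord z d.
    rewrite !(dvalM (ord_dval z)) ?mulf_neq0 ?invr_neq0 ?expf_neq0 //.
    by rewrite (dvalX (ord_dval z)) // (dvalV (ord_dval z)).
  rewrite !mulf_neq0 ?invr_neq0 ?expf_neq0 //; split=> // [|z].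
    by rewrite E xcM.2; lia.
  rewrite inE E => /predU1P[->|zs]; first by rewrite ycM.2; lia.
  rewrite (dval_pos1D (ord_dval z) c0 (sc _ zs) (ltn0Sn N)).2.
  by have := sc _ zs; have := NP _ zs; nia.
by exists c; split=> // z; rewrite inE => /predU1P[->|/sc].
Qed.

(** The function c^(M+1) / (1 + c^(M+1)) is close to 1 where c has a pole and close to 0 where c has
    a zero. *)
Lemma approx_idem x s (M : nat) : x \notin s ->
  exists u, vge (ord x) M (u - 1) /\ forall y, y \in s -> vge (ord y) M u.
Proof.
move=> xs; have [c [c0 xc sc]] := place_sep_seq xs.
have [cM1 xM] := dval_neg1D (ord_dval x) c0 xc (ltn0Sn M).
exists (c ^+ M.+1 / (1 + c ^+ M.+1)); split=> [|y ys].
  have -> : c ^+ M.+1 / (1 + c ^+ M.+1) - 1 = - (1 + c ^+ M.+1)^-1 by field.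
  by rewrite (vgeN (ord_dval x)) (vgeE _ _ (invr_neq0 cM1)) (dvalV (ord_dval x)) // xM; nia.
have [_ yM] := dval_pos1D (ord_dval y) c0 (sc _ ys) (ltn0Sn M).
rewrite vgeE ?mulf_neq0 ?invr_neq0 ?expf_neq0 // (dvalM (ord_dval y)) ?invr_neq0 ?expf_neq0 //.
by rewrite (dvalX (ord_dval y)) // (dvalV (ord_dval y)) // yM; have := sc _ ys; nia.
Qed.

Lemma weak_approx s (b : place X -> X) (M : int) : uniq s ->
  exists a, forall x, x \in s -> vge (ord x) M (a - b x).
Proof.
move=> us.
have [N NP] : exists N : nat, forall z, z \in s -> forall x, x \in s -> `|ord x (b z)| < N%:Z.
  have /choice[f fP] z := seq_bound (fun x => ord x (b z)) s.
  have [N NP] := seq_bound (fun z => (f z)%:Z) s.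
  by exists N => z /NP zN x /(fP z) xN; lia.
(* The margin [N] compensates for the poles of the [b z] in the products b z * u z. *)
pose M' := (`|M| + N)%N.
have /choice[u uP] : forall z, exists u, z \in s ->
    vge (ord z) M' (u - 1) /\ forall y, y \in s -> y != z -> vge (ord y) M' u.
  move=> z; have zs : z \notin [seq y <- s | y != z] by rewrite mem_filter eqxx.
  have [u [u1 u2]] := approx_idem M' zs.
  by exists u => _; split=> // y ys yz; apply: u2; rewrite mem_filter yz.
exists (\sum_(z <- s) b z * u z) => x xs.
have term z c : z \in s -> vge (ord x) M' c -> vge (ord x) M (b z * c).
  move=> zs xc; have [->|bz0] := eqVneq (b z) 0; first by rewrite mul0r vge0.
  have := vgeM (ord_dval x) (m := - N%:Z) (a := b z) _ xc; rewrite vgeE // => H.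
  by apply: vge_le (H _); have := NP _ zs _ xs; rewrite /M'; lia.
rewrite (bigD1_seq x) //= addrAC; apply: (vgeD (ord_dval x)).
  by rewrite -[X in _ - X]mulr1 -mulrBr; apply: term => //; have [] := uP x xs.
rewrite big_seq_cond; apply: (vge_sum (ord_dval x)) => z /andP[zs zx].
by apply: term => //; have [_] := uP z zs; apply=> //; rewrite eq_sym.
Qed.

End Places.

(** Bernoulli's inequality: (1 + 1/a)^L >= 1 + L/a, which exceeds C at L = C a. *)
Lemma cvg_exp_contra (a C : nat) : (0 < a)%N ->
  (forall L, (a.+1 ^ L <= C * a ^ L)%N) -> False.
Proof.
move=> a0 H.
have B L : (a ^ L * (a + L) <= a.+1 ^ L * a)%N.
  elim: L => [|L IH]; first by rewrite !expn0 !mul1n addn0.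
  rewrite !expnS -(mulnA a.+1); apply: leq_trans (leq_mul (leqnn a.+1) IH).
  by move: (a ^ L)%N => A; have : (0 <= A * L)%N by []; nia.
have := H (C * a)%N; have := B (C * a)%N; set L := (C * a)%N => B1 H1.
have aL : (0 < a ^ L)%N by rewrite expn_gt0 a0.
have : (a ^ L * (a + L) <= a ^ L * L)%N.
  apply: leq_trans B1 _; apply: leq_trans (leq_mul H1 (leqnn a)) _.
  by rewrite mulnAC mulnC.
by rewrite leq_pmul2l //; lia.
Qed.

(** Stated through injective finite families, so that a bound makes sense before [A] is known to be
    finite. *)
Definition cbound (T : Type) (A : set T) (B : nat) :=
  forall (I : finType) (s : I -> T), (forall i, A (s i)) -> injective s -> (#|I| <= B)%N.

Lemma cbound_range (T : Type) (A : set T) (U : finType) (f : U -> T) :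
  (forall a, A a -> exists u, a = f u) -> cbound A #|U|.
Proof.
move=> Af I s As sI; have /choice[g gP] i : exists u, s i = f u by exact: Af.
by apply: (@leq_card _ _ g) => i j gij; apply: sI; rewrite !gP gij.
Qed.

Lemma finite_of_bound (T : eqType) (A : set T) (B : nat) :
  (forall s : seq T, uniq s -> (forall x, x \in s -> A x) -> (size s <= B)%N) -> finite_set A.
Proof.
move=> bnd.
pose P m := `[< exists s : seq T, [/\ uniq s, forall x, x \in s -> A x & size s = m] >].
have P0 : exists m, P m by exists 0%N; apply/asboolP; exists [::].
have PB m : P m -> (m <= B)%N by move=> /asboolP[s [us sA <-]]; exact: bnd.
have [m /asboolP[s [us sA sm]] mmax] := ex_maxnP P0 PB.
apply/finite_seqP; exists s; apply/seteqP; split=> [x Ax|x]; last exact: sA.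
apply: contrapT => /negP xs.
have /mmax : P m.+1.
  apply/asboolP; exists (x :: s); rewrite /= xs us sm; split=> // y.
  by rewrite inE => /predU1P[->|/sA].
by rewrite ltnn.
Qed.

(** * Counting polynomial combinations *)

Section Evaluation.
Variables (k : finFieldType) (X : curve k).
Implicit Types (p d : {poly k}).

Definition ev (a : X) p : X := (map_poly (const X) p).[a].

Fact ev_additive a : zmod_morphism (ev a).
Proof. by move=> p q; rewrite /ev rmorphB hornerD hornerN. Qed.
Fact ev_multiplicative a : monoid_morphism (ev a).
Proof.
by split=> [|p q]; [rewrite /ev rmorph1 hornerC|rewrite /ev rmorphM hornerM].
Qed.
HB.instance Definition _ a := GRing.isZmodMorphism.Build {poly k} X (ev a) (ev_additive a).
HB.instance Definition _ a := GRing.isMonoidMorphism.Build {poly k} X (ev a) (ev_multiplicative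
  a).

Lemma evX a : ev a 'X = a.
Proof. by rewrite /ev map_polyX hornerX. Qed.
Lemma evC a c : ev a c%:P = const X c.
Proof. by rewrite /ev map_polyC hornerC. Qed.

Lemma evE a p : ev a p = \sum_(i < size p) const X p`_i * a ^+ i.
Proof.
rewrite /ev horner_coef size_map_poly; apply: eq_bigr => i _.
by rewrite coef_map.
Qed.

Lemma vge_const (x : place X) (c : k) : vge (ord x) 0 (const X c).
Proof.
have [->|c0] := eqVneq c 0; first by rewrite rmorph0 vge0.
by rewrite vgeE ?fmorph_eq0 // ord_const.
Qed.

Lemma vge_ev (x : place X) a p : vge (ord x) 0 a -> vge (ord x) 0 (ev a p).
Proof.
move=> xa; rewrite evE; apply: (vge_sum (ord_dval x)) => i _.
by apply: (vgeM0 (ord_dval x)); [exact: vge_const|exact: (vgeX (ord_dval x))].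
Qed.

Definition transc (a : X) := forall p, p != 0 -> ev a p != 0.

Definition polyspan (a : X) m (y : 'I_m -> X) (J : nat) : set X :=
  [set z | exists2 p : 'I_m -> {poly k}, (forall i, (size (p i) <= J)%N) &
     z = \sum_i ev a (p i) * y i].

Lemma polyspanD a m (y : 'I_m -> X) J u v :
  polyspan a y J u -> polyspan a y J v -> polyspan a y J (u + v).
Proof.
move=> [p pJ ->] [q qJ ->]; exists (fun i => p i + q i).
  by move=> i; apply: leq_trans (size_polyD _ _) _; rewrite geq_max pJ qJ.
by rewrite -big_split; apply: eq_bigr => i _; rewrite rmorphD mulrDl.
Qed.

Lemma polyspan_le a m (y : 'I_m -> X) J K u : (J <= K)%N ->
  polyspan a y J u -> polyspan a y K u.
Proof. by move=> JK [p pJ ->]; exists p => // i; exact: leq_trans JK. Qed.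

Lemma polyspanZ a m (y : 'I_m -> X) J K (q : {poly k}) u : (size q <= K)%N ->
  polyspan a y J u -> polyspan a y (K + J) (ev a q * u).
Proof.
move=> qK [p pJ ->]; exists (fun i => q * p i) => [i|].
  apply: leq_trans (size_polyMleq _ _) _; rewrite -subn1 leq_subLR.
  by apply: leq_trans (leq_add qK (pJ i)) _; rewrite leq_addl.
by rewrite mulr_sumr; apply: eq_bigr => i _; rewrite rmorphM mulrA.
Qed.

Lemma polyspan_sum a m (y : 'I_m -> X) J (I : Type) (r : seq I) (F : I -> X) :
  (forall i, polyspan a y J (F i)) -> polyspan a y J (\sum_(i <- r) F i).
Proof.
move=> H; apply: (big_ind (polyspan a y J)) => //; last by move=> *; exact: polyspanD.
by exists (fun=> 0) => [i|]; rewrite ?size_poly0 // big1 // => i _; rewrite rmorph0 mul0r.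
Qed.

Lemma cbound_polyspan a m (y : 'I_m -> X) J : cbound (polyspan a y J) (#|k| ^ (m * J)).
Proof.
rewrite -card_mx; apply: (@cbound_range _ _ 'M[k]_(m, J)
  (fun c => \sum_i ev a (rVpoly (row i c)) * y i)) => z [p pJ ->].
exists (\matrix_i poly_rV (p i)); apply: eq_bigr => i _.
by rewrite rowK poly_rV_K.
Qed.

Definition spans (t : X) n (b : 'I_n -> X) :=
  forall z : X, exists (p : 'I_n -> {poly k}) d, d != 0 /\
    z = \sum_i ev t (p i) / ev t d * b i.

(** A generating family over k(t) of minimal length is free: a relation with q j <> 0 would allow b
    j to be eliminated. *)
Lemma basis_over : exists t n (b : 'I_n -> X), [/\ transc t, spans t b
  & forall p : 'I_n -> {poly k}, \sum_i ev t (p i) * b i = 0 -> forall i, p i = 0].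
Proof.
have [t [tt [n0 [b0 sp0]]]] := ffield_fin X.
have ex : exists n, `[< exists b : 'I_n -> X, spans t b >].
  by exists n0; apply/asboolP; exists b0.
have [n /asboolP[b sp] nmin] := ex_minnP ex.
exists t, n, b; split=> // q q0 j; apply: contrapT => /eqP qj.
case: n => [|n] in b sp nmin q q0 j qj *; first by case: j qj.
suff /nmin : `[< exists b : 'I_n -> X, spans t b >] by rewrite ltnn.
apply/asboolP; exists (b \o lift j) => z; have [p [d [d0 ->]]] := sp z.
have td := tt _ d0; have tq := tt _ qj.
exists (fun i => p (lift j i) * q j - p j * q (lift j i)), (d * q j).
rewrite mulf_neq0 //; split=> //.
have E : \sum_i ev t (p i * q j - p j * q i) / ev t (d * q j) * b i =
    \sum_i ev t (p i) / ev t d * b i.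
  transitivity (\sum_i ev t (p i) / ev t d * b i -
     ev t (p j) / (ev t d * ev t (q j)) * \sum_i ev t (q i) * b i).
    rewrite mulr_sumr -sumrB; apply: eq_bigr => i _; rewrite rmorphB !rmorphM /=.
    by field; rewrite td tq.
  by rewrite q0 mulr0 subr0.
rewrite -E (bigD1_ord j) //= (_ : p j * q j - p j * q j = 0) ?subrr //.
by rewrite rmorph0 !mul0r add0r.
Qed.

Section Growth.
Variables (t : X) (n : nat) (b : 'I_n -> X).
Hypotheses (tt : transc t) (sp : spans t b).
Let Q := (#|k| ^ n)%N.

Lemma common_denom m (y : 'I_m -> X) : exists d D, [/\ d != 0, (size d <= D)%N
  & forall i, polyspan t b D (ev t d * y i)].
Proof.
have /choice[p /choice[d dP]] i := sp (y i).
have d0 i : d i != 0 by have [] := dP i.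
exists (\prod_i d i).
pose P i l := (\prod_(j | j != i) d j) * p i l.
exists (size (\prod_i d i)%R + \sum_i \sum_l size (P i l))%N; split.
- by apply/prodf_neq0 => i _.
- exact: leq_addr.
move=> i; exists (P i) => [l|].
  by apply: leq_trans (leq_addl _ _); rewrite (bigD1 i) //= (bigD1 l) //= -addnA leq_addr.
have [_ ->] := dP i; rewrite mulr_sumr; apply: eq_bigr => l _.
rewrite (bigD1 i) //= !rmorphM /=; field; exact: tt.
Qed.

(** A form of [F : k(a)] <= n that mentions no vector space over k(a). It passes from t to 1/t,
    which covers the places where t has a pole. *)
Definition growth (a : X) := forall m (y : 'I_m -> X), exists C, forall J,
  cbound (polyspan a y J) (C * Q ^ J).

Lemma growth_t : growth t.
Proof.
move=> m y; have [d [D [d0 dD yD]]] := common_denom y.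
exists (Q ^ D)%N => J; rewrite -expnD addnC /Q -expnM mulnDr => I s sy sI.
rewrite -mulnDr; apply: (@cbound_polyspan t _ b (J + D) I (fun i => ev t d * s i)).
  move=> i; have [p pJ ->] := sy i.
  rewrite mulr_sumr; apply: polyspan_sum => l.
  by rewrite mulrCA; apply: polyspanZ.
by move=> i j /(mulfI (tt d0)) /sI.
Qed.

Lemma transc_neq0 a : transc a -> a != 0.
Proof. by move=> /(_ _ (monic_neq0 (monicX k))); rewrite evX. Qed.

Lemma ev_inv a p J : a != 0 -> (size p <= J)%N ->
  exists2 q : {poly k}, (size q <= J.+1)%N & a ^+ J * ev a^-1 p = ev a q.
Proof.
move=> a0 pJ; exists (\sum_(i < size p) (p`_i)%:P * 'X^(J - i)).
  apply: leq_trans (size_sum _ _ _) _; apply/bigmax_leqP => i _.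
  rewrite mul_polyC; apply: leq_trans (size_scale_leq _ _) _.
  by rewrite size_polyXn ltnS leq_subr.
rewrite evE mulr_sumr rmorph_sum; apply: eq_bigr => i _.
rewrite rmorphM /= evC rmorphXn /= evX mulrCA; congr (_ * _).
have iJ : (i <= J)%N by rewrite ltnW // (leq_trans _ pJ).
by rewrite exprVn -expfB_cond ?(negbTE a0).
Qed.

(** Multiplication by a^J turns a polynomial in 1/a of length J into one in a of length J + 1, at
    the cost of a factor [Q]. *)
Lemma growth_inv a : a != 0 -> growth a -> growth a^-1.
Proof.
move=> a0 ga m y; have [C CP] := ga m y; exists (C * Q)%N => J I s sy sI.
rewrite -mulnA -expnS; apply: (CP J.+1 I (fun i => a ^+ J * s i)).
  move=> i; have [p pJ ->] := sy i.
  have /choice[q qP] l : exists q :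
    {poly k}, (size q <= J.+1)%N /\ a ^+ J * ev a^-1 (p l) = ev a q.
    by have [q ? ?] := ev_inv a0 (pJ l); exists q.
  exists q => [l|]; first by have [] := qP l.
  by rewrite mulr_sumr; apply: eq_bigr => l _; rewrite mulrA; have [_ ->] := qP l.
by move=> i j /(mulfI (expf_neq0 J a0)) /sI.
Qed.

(** The fundamental inequality sum e_i f_i <= n in counting form. If the [m] elements were
    incongruent modulo p(a), expansions in base p(a) with these elements as digits (evaluated by
    Horner's rule in [hs]) would be distinct. There are m^L of them of length L, while their
    coefficients have degree at most e L, which contradicts the growth. *)
Lemma fund_ineq a p m (y : 'I_m -> X) : growth a -> ev a p != 0 ->
  (Q ^ (size p).-1 < m)%N -> exists i j, i <> j /\
  exists J z, polyspan a y J z /\ y i - y j = ev a p * z.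
Proof.
move=> ga p0 Qm; apply: contrapT => nex.
have sep i j J z : polyspan a y J z -> y i - y j = ev a p * z -> i = j.
  by move=> zJ yz; apply: contrapT => ij; apply: nex; exists i, j; split=> //; exists J, z.
pose hs := foldr (fun i u => y i + ev a p * u) 0.
set e := (size p).-1.
have span1 i : polyspan a y 1 (y i).
  exists (fun j => (i == j)%:R) => [j|]; first by case: eqP; rewrite ?size_poly1 ?size_poly0.
  rewrite (bigD1 i) //= eqxx rmorph1 mul1r big1 ?addr0 // => j /negbTE.
  by rewrite eq_sym => ->; rewrite rmorph0 mul0r.
have p0' : (0 < size p)%N.
  by rewrite lt0n size_poly_eq0; apply: contraNneq p0 => ->; rewrite rmorph0.
have spanN u J : polyspan a y J u -> polyspan a y J (- u).
  move=> [q qJ ->]; exists (fun i => - q i) => [i|]; first by rewrite size_polyN.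
  by rewrite -sumrN; apply: eq_bigr => i _; rewrite rmorphN mulNr.
have hsP r : polyspan a y (e * size r + 1) (hs r).
  elim: r => [|i r IH] /=.
    by exists (fun=> 0) => [i|]; rewrite ?size_poly0 // big1 // => i _; rewrite rmorph0 mul0r.
  apply: polyspanD; first by apply: polyspan_le (span1 i); lia.
  have [q qJ ->] := IH; exists (fun i => p * q i) => [l|].
    apply: leq_trans (size_polyMleq _ _) _; have := qJ l; rewrite /e; lia.
  by rewrite mulr_sumr; apply: eq_bigr => l _; rewrite rmorphM mulrA.
have hsI r r' : size r = size r' -> hs r = hs r' -> r = r'.
  elim: r r' => [|i r IH] [|i' r'] //= [sr] E.
  have ii' : i = i'.
    apply: (sep i i' (e * size r + 1)%N (hs r' - hs r)).
      by apply: polyspanD; [rewrite sr; exact: hsP|exact/spanN/hsP].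
    by rewrite mulrBr; apply/eqP; rewrite subr_eq addrAC eq_sym subr_eq eq_sym E addrC.
  rewrite -ii' in E *; congr (_ :: _); apply: IH => //.
  by move/addrI/(mulfI p0): E.
have [C CP] := ga m y.
(* Here m is at least Q^e + 1, and m^L expansions lie in a set of at most C Q (Q^e)^L elements. *)
apply: (@cvg_exp_contra (Q ^ e)%N (C * Q)).
  by rewrite !expn_gt0 orbC; apply/orP; right; rewrite ltnW // finNzRing_gt1.
move=> L; apply: (@leq_trans (m ^ L)); first by case: L => // L; rewrite leq_exp2r.
have := CP (e * L + 1)%N {: L.-tuple 'I_m} (fun r => hs r).
rewrite card_tuple card_ord => H.
rewrite -expnM -mulnA -expnS -addn1; apply: H => [r|r r' /hsI E].
  by have := hsP r; rewrite size_tuple.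
by apply: val_inj; apply: E; rewrite !size_tuple.
Qed.

(** Multiplication by z raises degrees in t by at most D, up to the denominator d. Polynomials in z
    of length J, applied to N independent elements, would have N J free coefficients but land in a
    span with n (D' + D J) coefficients. With N = n D + 1 this fails as soon as J > n D'. *)
Lemma fin_dep (z : X) : exists N, forall y : 'I_N -> X, exists q : 'I_N -> {poly k},
  (exists i, q i != 0) /\ \sum_i ev z (q i) * y i = 0.
Proof.
have [d [D [d0 dD bD]]] := common_denom (fun l => z * b l).
exists (n * D).+1 => y; apply: contrapT => nex.
have [d' [D' [d'0 d'D yD]]] := common_denom y.
have zS K u : polyspan t b K u -> polyspan t b (K + D) (ev t d * (z * u)).
  move=> [p pK ->]; rewrite !mulr_sumr; apply: polyspan_sum => l.
  have -> : ev t d * (z * (ev t (p l) * b l)) = ev t (p l) * (ev t d * (z * b l)) by ring.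
  exact: polyspanZ.
have evS J K u (p : {poly k}) : (size p <= J)%N -> polyspan t b K u ->
    polyspan t b (K + D * J) (ev t d ^+ J * (ev z p * u)).
  elim: J p => [|J IH] p.
    rewrite leqn0 size_poly_eq0 => /eqP -> uK.
    exists (fun=> 0) => [i|]; rewrite ?size_poly0 // rmorph0 mul0r mulr0 big1 // => i _.
    by rewrite rmorph0 mul0r.
  elim/poly_ind: p => [_ uK|p c _ sp' uK].
    exists (fun=> 0) => [i|]; rewrite ?size_poly0 // rmorph0 mul0r mulr0 big1 // => i _.
    by rewrite rmorph0 mul0r.
  have pJ : (size p <= J)%N.
    by move: sp'; rewrite size_MXaddC; case: eqP => [->|_]; rewrite ?size_poly0.
  rewrite rmorphD rmorphM /= evX evC mulrDl mulrDr; apply: polyspanD.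
    have -> : ev t d ^+ J.+1 * (ev z p * z * u) = ev t d * (z * (ev t d ^+ J * (ev z p * u))).
      by rewrite exprS; ring.
    by rewrite mulnS addnCA addnC; apply: zS; exact: IH.
  rewrite -(evC t c) -rmorphXn mulrA -rmorphM addnC; apply: polyspanZ => //.
  rewrite mulrC mul_polyC; apply: leq_trans (size_scale_leq _ _) _.
  apply: leq_trans (size_poly_exp_leq _ _) _.
  move: (size_poly_eq0 d); rewrite (negbTE d0) => /negbT; nia.
have q1 := finNzRing_gt1 k.
pose J := (n * D').+1.
have : (#|{: 'M[k]_((n * D).+1, J)}| <= #|k| ^ (n * (D' + D * J)))%N.
  apply: (@cbound_polyspan t _ b (D' + D * J) _
    (fun c => ev t d ^+ J * (ev t d' * \sum_i ev z (rVpoly (row i c)) * y i))).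
    move=> c; rewrite !mulr_sumr; apply: polyspan_sum => i.
    rewrite [X in _ * X]mulrCA; apply: evS => //; exact: size_poly.
  move=> c c' /(mulfI (expf_neq0 _ (tt d0)))/(mulfI (tt d'0))/eqP.
  rewrite -subr_eq0 -sumrB => /eqP E; apply/row_matrixP => i.
  apply/eqP; rewrite -subr_eq0; apply/eqP/(can_inj (@rVpolyK _ _)); rewrite linearB linear0.
  apply: contrapT => /eqP ne; apply: nex.
  exists (fun i => rVpoly (row i c) - rVpoly (row i c')); split; first by exists i.
  by rewrite -[RHS]E; apply: eq_bigr => l _; rewrite rmorphB mulrBl.
rewrite card_mx leq_exp2l //; rewrite /J; nia.
Qed.

End Growth.

End Evaluation.

Lemma poly_const_X (K : nzRingType) (p : {poly K}) :
  exists w : {poly K}, p = (p`_0)%:P + 'X * w.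
Proof.
elim/poly_ind: p => [|p c _]; first by exists 0; rewrite coef0 mulr0 addr0.
by exists p; rewrite coefD coefMX coefC /= add0r addrC commr_polyX.
Qed.

(** * Valuation rings and the field of constants *)

Section ValuationRing.
Variables (k : finFieldType) (X : curve k).

(* A maximal subring of F containing k and z but not z^-1 is a valuation ring;
   [fin_dep] bounds the chains in its value group, so that it is discrete. *)
Section Domination.
Variables (z : X).
Hypotheses (z0 : z != 0) (zV : forall p, ev z p != z^-1).

Record goodring (A : set X) : Prop := Goodring {
  goodc : forall c, A (const X c);
  goodz : A z;
  goodB : forall a b, A a -> A b -> A (a - b);
  goodM : forall a b, A a -> A b -> A (a * b);
  goodV : ~ A z^-1 }.

Lemma goodN A a : goodring A -> A a -> A (- a).
Proof. by move=> gA Aa; rewrite -sub0r -(rmorph0 (const X)); apply: goodB => //;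
  exact: goodc. Qed.

Lemma goodD A a b : goodring A -> A a -> A b -> A (a + b).
Proof. by move=> gA Aa Ab; rewrite -[b]opprK; apply: goodB => //; exact: goodN. Qed.

Lemma good0 A : goodring A -> A 0.
Proof. by move=> gA; rewrite -(rmorph0 (const X)); exact: goodc. Qed.

Lemma good1 A : goodring A -> A 1.
Proof. by move=> gA; rewrite -(rmorph1 (const X)); exact: goodc. Qed.

Lemma good_sum A (I : Type) (r : seq I) (P : pred I) (F : I -> X) : goodring A ->
  (forall i, P i -> A (F i)) -> A (\sum_(i <- r | P i) F i).
Proof.
move=> gA H; apply: (big_ind A) => //; first exact: good0.
by move=> a b; exact: goodD.
Qed.

Lemma goodX A a n : goodring A -> A a -> A (a ^+ n).
Proof.
move=> gA Aa; elim: n => [|n IH]; first by rewrite expr0; exact: good1.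
by rewrite exprS; exact: goodM.
Qed.

Lemma good_ev A a p : goodring A -> A a -> A (ev a p).
Proof.
move=> gA Aa; rewrite evE; apply: good_sum => // i _.
by apply: goodM => //; [exact: goodc|exact: goodX].
Qed.

Lemma ex_maxring : exists2 A, goodring A & forall B, A `<` B -> ~ goodring B.
Proof.
pose P := [set A : set X | (exists a, A a) -> goodring A].
have [F FP tot|A [PA maxA]] := @Zorn_bigcup X P.
  move=> [a [A0 FA0 A0a]].
  have gd A : F A -> (exists a, A a) -> goodring A by move=> /FP.
  have g0 : goodring A0 by apply: gd => //; exists a.
  have two u v : (\bigcup_(A in F) A) u -> (\bigcup_(A in F) A) v ->
      exists A, [/\ F A, goodring A, A u & A v].
    move=> [A FA Au] [B FB Bv]; have [AB|BA] := tot _ _ FA FB.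
      by exists B; split=> //; [apply: gd => //; exists v|exact: AB].
    by exists A; split=> //; [apply: gd => //; exists u|exact: BA].
  split.
  - by move=> c; exists A0 => //; exact: goodc.
  - by exists A0 => //; exact: goodz.
  - by move=> u v uF vF; have [A [FA gA Au Av]] := two u v uF vF; exists A => //; exact: goodB.
  - by move=> u v uF vF; have [A [FA gA Au Av]] := two u v uF vF; exists A => //; exact: goodM.
  by move=> [A FA Az]; apply: (goodV (gd _ FA _)) => //; exists z^-1.
(* The ring k[z] is good; hence a maximal element of [P] is not the empty set. *)
have gR : goodring [set a | exists p, a = ev z p].
  split.
  - by move=> c; exists c%:P; rewrite evC.
  - by exists 'X; rewrite evX.
  - by move=> _ _ [p ->] [q ->]; exists (p - q); rewrite rmorphB.
  - by move=> _ _ [p ->] [q ->]; exists (p * q); rewrite rmorphM.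
  by move=> [p /eqP]; rewrite eq_sym; apply/negP; exact: zV.
have [neA|eA] := pselect (exists a, A a).
  exists A; first exact: PA.
  by move=> B AB gB; apply: (maxA _ AB).
exfalso; apply: (maxA [set a | exists p, a = ev z p]) => //; split.
  by move=> a Aa; case: eA; exists a.
by move=> H; apply: eA; exists z; apply: H; exact: goodz.
Qed.

Section MaxRing.
Variable A : set X.
Hypotheses (gA : goodring A) (maxA : forall B, A `<` B -> ~ goodring B).

Let rel1 (u : X) (n : nat) := exists f : nat -> X,
  (forall i, exists2 a, A a & f i = z * a) /\ \sum_(i < n.+1) f i * u ^+ i = 1.

(** The ring A[u] is larger than A, so it contains 1/z. Multiplying such an expression by z writes 1
    as a polynomial in u with coefficients in z A. *)
Lemma maxring_rel u : ~ A u -> exists n, rel1 u n.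
Proof.
move=> Au; pose B := [set a | exists2 r : {poly X}, (forall i, A r`_i) & a = r.[u]].
have AB : A `<=` B.
  move=> a Aa; exists a%:P; last by rewrite hornerC.
  by move=> i; rewrite coefC; case: eqP => // _; exact: good0.
have Bu : B u.
  exists 'X; last by rewrite hornerX.
  by move=> i; rewrite coefX; case: eqP => _; [exact: good1|exact: good0].
have [r rA zr] : B z^-1.
  apply: contrapT => nB; apply: (@maxA B); first by split=> // /(_ _ Bu).
  split.
  - by move=> c; apply: AB; exact: goodc.
  - by apply: AB; exact: goodz.
  - move=> _ _ [r rA ->] [s sA ->]; exists (r - s); last by rewrite hornerD hornerN.
    by move=> i; rewrite coefB; exact: goodB.
  - move=> _ _ [r rA ->] [s sA ->]; exists (r * s); last by rewrite hornerM.
    by move=> i; rewrite coefM; apply: good_sum => // j _; exact: goodM.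
  exact: nB.
exists (size r), (fun i => z * r`_i); split; first by move=> i; exists r`_i.
rewrite -(divff z0) zr (horner_coef_wide _ (leqnSn _)) mulr_sumr.
by apply: eq_bigr => i _; rewrite mulrA.
Qed.

(** If neither u nor 1/u were in A, both would satisfy relations as in [maxring_rel]. Of two
    relations of minimal degree, the one of smaller degree serves to lower the degree of the
    other. *)
Lemma maxring_val u : u != 0 -> A u \/ A u^-1.
Proof.
move=> u0; apply: contrapT => /not_orP[Au AuV].
have step v n m : v != 0 -> (m <= n)%N -> rel1 v n -> rel1 v^-1 m ->
    (0 < n)%N /\ rel1 v n.-1.
  move=> v0 mn [f [fI f1]] [g0 [gI0 g01]].
  case: n => [|n] in mn f1 *.
    exfalso; have [a Aa fa] := fI 0%N; move: f1; rewrite big_ord1 expr0 mulr1 fa => za.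
    by apply: (goodV gA); rewrite -(mulr1 z^-1) -za mulKf.
  split=> //=.
  pose g i := if (i <= m)%N then g0 i else 0.
  have gI i : exists2 a, A a & g i = z * a.
    by rewrite /g; case: ifP => // _; exists 0; rewrite ?mulr0 //; exact: good0.
  have g1 : \sum_(i < n.+2) g i * v^-1 ^+ i = 1.
    rewrite -g01 (big_ord_widen n.+2 (fun i => g0 i * v^-1 ^+ i)) // [RHS]big_mkcond /=.
    by apply: eq_bigr => i _; rewrite /g ltnS; case: ifP; rewrite ?mul0r.
  have [a0 Aa0 ga0] := gI 0%N; have [b0 Ab0 fb0] := fI n.+1.
  pose c := 1 - g 0%N.
  have Ac : A c by apply: goodB => //; [exact: good1|rewrite ga0; apply: goodM => //;
    exact: goodz].
  (* The relation for 1/v expresses (1 - g 0) v^(n+1) through lower powers of v. Substituting this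
     into the relation for v, multiplied by 1 - g 0, removes its leading term; adding g 0 restores
     the value 1. *)
  exists (fun i => c * f i + f n.+1 * g (n.+1 - i)%N + (if i == 0%N then g 0%N else 0)); split.
    move=> i; have [a Aa ->] := fI i; have [b Ab ->] := gI (n.+1 - i)%N; rewrite fb0.
    exists (c * a + z * b0 * b + (if i == 0%N then a0 else 0)).
      apply: goodD => //; last by case: ifP => // _; exact: good0.
      apply: goodD => //; first exact: goodM.
      by apply: goodM => //; apply: goodM => //; exact: goodz.
    by case: ifP => _; [rewrite ga0; ring|ring].
  have f1' : \sum_(i < n.+1) f i * v ^+ i = 1 - f n.+1 * v ^+ n.+1.
    by rewrite -f1 [in RHS]big_ord_recr addrK.
  have g1' : \sum_(i < n.+1) g (n.+1 - i)%N * v ^+ i = v ^+ n.+1 * c.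
    have -> : c = \sum_(i < n.+1) g i.+1 * v^-1 ^+ i.+1.
      by rewrite /c -g1 big_ord_recl expr0 mulr1 addrAC subrr add0r.
    rewrite mulr_sumr.
    rewrite (reindex_inj rev_ord_inj) /=; apply: eq_bigr => i _.
    have iS : (i < n.+1)%N by [].
    rewrite subSS (_ : n.+1 - (n - i) = i.+1)%N; last by lia.
    rewrite mulrCA; congr (_ * _).
    by rewrite exprVn -expfB_cond ?(negbTE v0) //= ?subSS.
  under eq_bigr do rewrite !mulrDl -!mulrA.
  rewrite !big_split /= -!mulr_sumr f1' g1' big_ord_recl big1 ?addr0; last first.
    by move=> i _; rewrite mul0r.
  by rewrite eqxx expr0 mulr1 /c; ring.
have ex v : ~ A v -> exists n, `[< rel1 v n >].
  by move=> /maxring_rel[n ?]; exists n; apply/asboolP.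
have [n /asboolP rn nmin] := ex_minnP (ex _ Au).
have [m /asboolP rm mmin] := ex_minnP (ex _ AuV).
have [mn|nm] := leqP m n.
  have [n0 /asboolP/nmin] := step _ _ _ u0 mn rn rm; lia.
rewrite -[u]invrK in rn.
have [m0 /asboolP/mmin] := step _ _ _ (invr_neq0 u0) (ltnW nm) rm rn; lia.
Qed.

(** The non-units of A, which form its maximal ideal by [maxring_val]. *)
Let mm a := A a /\ (a != 0 -> ~ A a^-1).

Lemma mmM a b : A a -> mm b -> mm (a * b).
Proof.
move=> Aa [Ab bV]; split; first exact: goodM.
rewrite mulf_eq0 negb_or => /andP[a0 b0] abV; apply: (bV b0).
have -> : b^-1 = (a * b)^-1 * a by field; rewrite a0 b0.
exact: goodM.
Qed.

Lemma mmD a b : mm a -> mm b -> mm (a + b).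
Proof.
have main u v : u != 0 -> v != 0 -> A (u / v) -> mm u -> mm v -> mm (u + v).
  move=> u0 v0 uv mu mv; have -> : u + v = (u / v + 1) * v by field.
  by apply: mmM => //; apply: goodD => //; exact: good1.
have [->|a0] := eqVneq a 0; first by rewrite add0r.
have [->|b0] := eqVneq b 0; first by rewrite addr0.
move=> ma mb; have ab0 : a / b != 0 by rewrite mulf_neq0 ?invr_neq0.
case: (maxring_val ab0).
  by move=> ab; exact: main.
by rewrite invf_div => ba; rewrite addrC; exact: main.
Qed.

Lemma mm_sum (I : Type) (r : seq I) (P : pred I) (F : I -> X) :
  (forall i, P i -> mm (F i)) -> mm (\sum_(i <- r | P i) F i).
Proof.
move=> H; apply: (big_ind mm) => //; last by move=> a b; exact: mmD.
by split; [exact: good0|rewrite eqxx].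
Qed.

Lemma mmz : mm z.
Proof. by split; [exact: goodz|move=> _; exact: goodV]. Qed.

(** In terms of the valuation of A: 0 < v(y) < v(x). A path is a strictly decreasing chain of
    positive values. *)
Let e (x y : X) := `[< [/\ y != 0, mm y & mm (x / y)] >].

(** Any N elements satisfy a relation with coefficients in k[a]. In a relation of minimal total size
    some coefficient has a nonzero constant term, since otherwise a could be cancelled. The last
    such term has value v(x_j), strictly below the values of all others: earlier x_i have larger
    value, and later coefficients are divisible by a, with v(a) >= v(x_j). Such a sum cannot be
    zero. *)
Lemma chain_bound a : mm a -> a != 0 -> exists N, forall s, path e a s -> (size s < N)%N.
Proof.
move=> ma a0; have [t [n [b [tt sp _]]]] := basis_over X.
have [N NP] := fin_dep tt sp a; exists N => s es; rewrite ltnNge; apply/negP => Ns.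
pose x i := nth a (a :: s) i.
have e_trans : transitive e.
  move=> v u w /asboolP[v0 mv muv] /asboolP[w0 mw mvw]; apply/asboolP; split=> //.
  have -> : u / w = u / v * (v / w) by field; rewrite v0 w0.
  by apply: mmM => //; case: muv.
have xlt i j : (i < j)%N -> (j <= size s)%N -> [/\ x j != 0, mm (x j) & mm (x i / x j)].
  move=> ij js; apply/asboolP.
  by apply: (@sorted_ltn_nth _ e e_trans a (a :: s) es i j) => //;
    rewrite inE /= ltnS // (leq_trans (ltnW ij)).
have x0 i : (i <= size s)%N -> x i != 0 /\ mm (x i).
  by case: i => [//|i] iS; have [] := xlt 0%N i.+1 isT iS.
pose P m := `[< exists q : 'I_N -> {poly k}, [/\ exists i, q i != 0,
   \sum_i ev a (q i) * x i = 0 & (\sum_i size (q i) = m)%N] >].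
have [q0 [ne0 q00]] := NP (fun i => x i).
have exP : exists m, P m by exists (\sum_i size (q0 i))%N; apply/asboolP; exists q0.
have [m /asboolP[q [[i1 qi1] qs qm]] mmin] := ex_minnP exP.
have [j0 qj0] : exists i, (q i)`_0 != 0.
  apply: contrapT => nex.
  have qX i : q i = (q i %/ 'X) * 'X.
    rewrite divpK // -['X]subr0 -[0]/(0%:P) dvdp_XsubCl /root horner_coef0.
    by apply/negP => /negP qi; apply: nex; exists i.
  have : P (\sum_i size (q i %/ 'X)%R)%N.
    apply/asboolP; exists (fun i => q i %/ 'X); split=> //.
      by exists i1; apply: contraNneq qi1 => q1; rewrite qX q1 mul0r.
    apply: (mulfI a0); rewrite mulr0 -[RHS]qs mulr_sumr; apply: eq_bigr => i _.
    by rewrite [in RHS](qX i) rmorphM /= evX; ring.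
  move/mmin; rewrite -qm leqNgt => /negP; apply.
  have sz i : (size (q i %/ 'X)%R <= size (q i))%N by rewrite leq_divp.
  rewrite (bigD1 i1) //= [X in (_ < X)%N](bigD1 i1) //= -addSn leq_add //; last first.
    by apply: leq_sum => i _.
  rewrite (qX i1) mulpK ?polyX_eq0 // size_mulX // -?lt0n; last first.
    by apply: contraNneq qi1 => q1; rewrite qX q1 mul0r.
have [j qj jmax] : exists2 j : 'I_N, (q j)`_0 != 0 & forall i : 'I_N, (j < i)%N -> (q i)`_0 = 0.
  case: (@arg_maxnP _ j0 (fun i => (q i)`_0 != 0) (@nat_of_ord _) qj0) => j qj jm.
  exists j => // i ji; apply: contraTeq ji => /jm; lia.
have jS (i : 'I_N) : (i <= size s)%N by rewrite ltnW // (leq_trans _ Ns).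
have dec i : exists2 w, A w & ev a (q i) = const X (q i)`_0 + a * w.
  have [w wE] : exists w : {poly k}, q i = ((q i)`_0)%:P + 'X * w.
    exact: poly_const_X.
  exists (ev a w); first by apply: good_ev => //; case: ma.
  by rewrite {1}wE rmorphD rmorphM /= evX evC.
have key i : i != j -> mm (ev a (q i) * x i / x j).
  move=> ij; have [xj0 mxj] := x0 _ (jS j).
  have [ltij|] := ltnP i j.
    rewrite -mulrA; apply: mmM; first by apply: good_ev => //; case: ma.
    by have [] := xlt i j ltij (jS j).
  rewrite leq_eqVlt => /predU1P[/val_inj ji|ji]; first by rewrite ji eqxx in ij.
  have [w Aw ->] := dec i; rewrite (jmax _ ji) rmorph0 add0r.
  have -> : a * w * x i / x j = (w * (a / x j)) * x i by ring.
  apply: mmM; last by have [] := x0 _ (jS i).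
  apply: goodM => //; case jE : (nat_of_ord j) => [|j']; first by rewrite divff //; exact: good1.
  have jS' := jS j; rewrite jE in jS'.
  by have [_ _ []] := xlt 0%N j'.+1 isT jS'.
have [xj0 mxj] := x0 _ (jS j).
have : mm (- \sum_(i | i != j) ev a (q i) * x i / x j).
  by rewrite -mulN1r; apply: mmM; [apply: goodN => //; exact: good1|exact: mm_sum].
have -> : - \sum_(i | i != j) ev a (q i) * x i / x j = ev a (q j).
  move: qs; rewrite (bigD1 j) //= => /eqP; rewrite addr_eq0 => /eqP E.
  by rewrite -mulr_suml -mulNr -E mulfK.
have [w Aw ->] := dec j => mq.
have : mm (const X (q j)`_0).
  have -> : const X (q j)`_0 = const X (q j)`_0 + a * w + (- w) * a by ring.
  by apply: mmD => //; apply: mmM => //; exact: goodN.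
by case=> _; rewrite fmorph_eq0 => /(_ qj); rewrite -fmorphV; apply; exact: goodc.
Qed.

Let unit a := A a /\ A a^-1.

Lemma mm_unit a : A a -> a != 0 -> ~ mm a -> unit a.
Proof. by move=> Aa a0 nm; split=> //; apply: contrapT => nV; apply: nm; split. Qed.

(** The last element of a chain of maximal length starting at z generates the maximal ideal, since
    an element of the ideal that it does not divide would extend the chain. *)
Lemma mm_gen : exists w, [/\ w != 0, mm w & forall y, mm y -> A (y / w)].
Proof.
have [N NP] := chain_bound mmz z0.
pose P m := `[< exists2 s, path e z s & size s = m >].
have P0 : exists m, P m by exists 0%N; apply/asboolP; exists [::].
have PB m : P m -> (m <= N)%N by move=> /asboolP[s es <-]; exact/ltnW/NP.
have [m /asboolP[s es sm] mmax] := ex_maxnP P0 PB.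
have [w0 mw] : last z s != 0 /\ mm (last z s).
  case/lastP: s es {sm} => [_|s y]; first by split; [|exact: mmz].
  by rewrite rcons_path last_rcons => /andP[_ /asboolP[]].
exists (last z s); split=> // y my.
have [->|y0] := eqVneq y 0; first by rewrite mul0r; exact: good0.
apply: contrapT => nA.
have wy0 : last z s / y != 0 by rewrite mulf_neq0 ?invr_neq0.
have : P m.+1.
  apply/asboolP; exists (rcons s y); last by rewrite size_rcons sm.
  rewrite rcons_path es; apply/asboolP; split=> //.
  split; last by rewrite invf_div.
  by case: (maxring_val wy0); rewrite // invf_div.
by move/mmax; rewrite ltnn.
Qed.

(** Otherwise a, w^n, ..., w would be a chain for every n, against [chain_bound]. *)
Lemma mm_pow w a : w != 0 -> mm w -> A a -> a != 0 -> exists n, ~ A (a / w ^+ n).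
Proof.
move=> w0 mw Aa a0; apply: contrapT => nex.
have all n : A (a / w ^+ n) by apply: contrapT => H; apply: nex; exists n.
have ma n : mm (a / w ^+ n).
  have -> : a / w ^+ n = (a / w ^+ n.+1) * w by rewrite exprS; field; rewrite w0 expf_neq0.
  exact: mmM.
pose s := fix s n := if n is n'.+1 then w ^+ n :: s n' else [::].
have mX n : mm (w ^+ n.+1) by rewrite exprSr; apply: mmM => //; apply: goodX => //; case: mw.
have sP n b : mm (b / w ^+ n) -> path e b (s n).
  elim: n b => [//|n IH] b mb /=; apply/andP; split.
    by apply/asboolP; split=> //; exact: expf_neq0.
  by apply: IH; rewrite exprS mulfK ?expf_neq0.
have [N NP] : exists N, forall s, path e a s -> (size s < N)%N.
  by apply: chain_bound => //; have := ma 0%N; rewrite expr0 divr1.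
have := NP (s N) (sP _ _ (ma N)).
have -> : size (s N) = N by elim: N {NP} => //= n ->.
by rewrite ltnn.
Qed.

(** Every nonzero element is a unit of A times a power of the generator w of the maximal ideal; the
    exponent is the order. *)
Lemma maxring_place : exists x : place X, 0 < ord x z.
Proof.
have [w [w0 mw wgen]] := mm_gen.
have unitM a b : unit a -> unit b -> unit (a * b).
  by move=> [Aa aV] [Ab bV]; split; [|rewrite invfM]; exact: goodM.
have unitV a : unit a -> unit a^-1 by move=> [? ?]; split=> //; rewrite invrK.
have exA a : A a -> a != 0 -> exists n : int, unit (a / w ^ n).
  move=> Aa a0; have ex : exists n, `[< ~ A (a / w ^+ n) >].
    by have [n nP] := mm_pow w0 mw Aa a0; exists n; apply/asboolP.
  have [n /asboolP nA nmin] := ex_minnP ex.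
  case: n => [|n] in nA nmin *; first by rewrite expr0 divr1 in nA.
  have An : A (a / w ^+ n).
    apply: contrapT => H; have : `[< ~ A (a / w ^+ n) >] by apply/asboolP.
    by move/nmin; rewrite ltnn.
  exists n; apply: mm_unit => //; first by rewrite mulf_neq0 ?invr_neq0 ?expf_neq0.
  by move/wgen => H; apply: nA; rewrite exprSr invfM mulrA.
have ex a : exists n : int, a != 0 -> unit (a / w ^ n).
  have [->|a0] := eqVneq a 0; first by exists 0.
  case: (maxring_val a0) => [Aa|Aa]; first by have [n] := exA _ Aa a0; exists n.
  have [n /unitV un] := exA _ Aa (invr_neq0 a0); exists (- n) => _.
  by move: un; rewrite invf_div invrK mulrC -invr_expz invrK.
have powA (n : int) u : u != 0 -> unit u -> A (u * w ^ n) -> 0 <= n.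
  move=> u0 [_ uV]; case: n => // n AnV; exfalso; case: (mw) => Aw /(_ w0); apply.
  have -> : w^-1 = u^-1 * (u * w ^ Negz n) * w ^+ n.
    rewrite NegzE -invr_expz -exprnP exprS.
    by field; rewrite u0 w0 expf_neq0.
  by apply: goodM => //; [exact: goodM|exact: goodX].
(* The value at 0 is the default that [is_dval] prescribes. *)
pose f a := if a == 0 then 0 else sval (cid (ex a)).
have fP a : a != 0 -> unit (a / w ^ f a).
  by move=> a0; rewrite /f; case: cid => n /= nP; rewrite (negbTE a0); exact: nP.
have wn0 n : w ^ n != 0 by apply: expfz_neq0.
have aw0 a n : a != 0 -> a / w ^ n != 0 by move=> a0; rewrite mulf_neq0 ?invr_neq0.
have fge a n : a != 0 -> A (a / w ^ n) -> n <= f a.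
  move=> a0 An; rewrite -subr_ge0; apply: (powA _ _ (aw0 _ _ a0) (fP _ a0)).
  rewrite expfzDr // -invr_expz mulrA divfK //.
have f_uniq a n : a != 0 -> unit (a / w ^ n) -> f a = n.
  move=> a0 un; apply/eqP; rewrite eq_le; apply/andP; split; last by apply: fge => //; case: un.
  rewrite -subr_ge0; apply: (powA _ _ (aw0 _ _ a0) un).
  by rewrite expfzDr // -invr_expz mulrA divfK //; case: (fP _ a0).
have unitc c : c != 0 -> unit (const X c).
  by move=> c0; split; [|rewrite -fmorphV]; exact: goodc.
have fD : is_dval f.
  split.
  - by rewrite /f; case: cid => n /= _; rewrite eqxx.
  - move=> a b a0 b0; apply: f_uniq; first exact: mulf_neq0.
    have -> : a * b / w ^ (f a + f b) = (a / w ^ f a) * (b / w ^ f b).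
      by rewrite expfzDr //; field; rewrite !wn0.
    by apply: unitM; exact: fP.
  - move=> a b a0 b0 ab0; apply: fge => //; rewrite mulrDl.
    have le c n : c != 0 -> n <= f c -> A (c / w ^ n).
      move=> c0; rewrite -subr_ge0; case fE: (f c - n) => [m|//] _.
      have -> : c / w ^ n = (c / w ^ f c) * w ^+ m.
        by rewrite -[f c](subrK n) fE expfzDr // -exprnP; field; rewrite wn0 expf_neq0.
      by apply: goodM => //; [case: (fP _ c0)|apply: goodX => //; case: mw].
    by apply: goodD => //; apply: le => //; rewrite ge_min lexx ?orbT.
  exists w => //; apply: f_uniq => //; rewrite expr1z divff //.
  by split; rewrite ?invr1; exact: good1.
have fc (c : k) : c != 0 -> f (const X c) = 0.
  by move=> c0; apply: f_uniq; rewrite ?fmorph_eq0 // expr0z divr1; exact: unitc.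
exists (Place fD fc) => /=; rewrite ltNge; apply/negP => fz.
apply: (goodV gA); have [_] := fP _ z0; rewrite invf_div => zA.
case fE : (f z) fz zA => [[|n]|n] //= _; first by rewrite expr0z div1r.
move=> zA; have -> : z^-1 = w ^+ n.+1 * (w ^ Negz n / z).
  by rewrite NegzE -invr_expz -exprnP; field; rewrite z0 expf_neq0.
by apply: goodM => //; apply: goodX => //; case: mw.
Qed.

End MaxRing.
End Domination.

Lemma ex_zero (z : X) : z != 0 -> (forall p, ev z p != z^-1) ->
  exists x : place X, 0 < ord x z.
Proof.
move=> z0 zV; have [A gA maxA] := ex_maxring zV.
by apply: maxring_place gA maxA.
Qed.

(** If a is transcendental, 1/a has a zero by [ex_zero], and this is a pole of a. If a is algebraic
    over k, its minimal polynomial stays irreducible over F by [geom_irr] but has the root a in F,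
    so it is linear. *)
Lemma regular_const (a : X) : (forall x : place X, vge (ord x) 0 a) ->
  exists c, a = const X c.
Proof.
move=> areg; have [ta|] := pselect (transc a).
  exfalso; have a0 := transc_neq0 ta.
  have [p|x] := ex_zero (invr_neq0 a0); last first.
    by have := areg x; rewrite vgeE // (dvalV (ord_dval x)) //; lia.
  rewrite invrK; apply/negP => /eqP pa.
  have [q sq qE] := ev_inv a0 (leqnn (size p)).
  have : 'X^((size p).+1) - q != 0.
    rewrite -size_poly_eq0 size_polyDl ?size_polyXn // size_polyN.
    by rewrite ltnS.
  by move/ta; rewrite rmorphB rmorphXn /= evX -qE pa exprSr subrr eqxx.
move=> /existsNP[p0 /not_implyP[p00 /negP/negPn p0a]].
pose P m := `[< exists p : {poly k}, [/\ p != 0, ev a p == 0 & size p = m] >].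
have exP : exists m, P m by exists (size p0); apply/asboolP; exists p0.
have [m /asboolP[p [pn0 /eqP pa sp]] mmin] := ex_minnP exP.
have pmin q : q != 0 -> ev a q = 0 -> (size p <= size q)%N.
  by move=> q0 qa; rewrite sp; apply: mmin; apply/asboolP; exists q; split=> //; apply/eqP.
have p_irr : irreducible_poly p.
  split.
    rewrite ltnNge; apply/negP => /size1_polyC pC; move: pn0 pa.
    by rewrite pC evC polyC_eq0 => c0 /eqP; rewrite fmorph_eq0 (negbTE c0).
  move=> q q1 qp; have pE := esym (divpK qp); set r := (p %/ q)%R in pE.
  have /andP[r0 q0] : (r != 0) && (q != 0) by rewrite -negb_or -mulf_eq0 -pE.
  have := pa; rewrite {1}pE rmorphM /= => /eqP.
  rewrite mulf_eq0 => /orP[/eqP ra|/eqP qa].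
    have := pmin _ r0 ra; rewrite pE size_mul //.
    have sq : (0 < size q)%N by rewrite lt0n size_poly_eq0.
    have sr : (0 < size r)%N by rewrite lt0n size_poly_eq0.
    have q1' : (size q != 1)%N := q1.
    move: sq q1'; case: (size q) => [|[|m']] //= _ _.
    by rewrite !addnS /= ltnNge leq_addr.
  by rewrite -dvdp_size_eqp // eqn_leq pmin // dvdp_leq.
have [_ /(_ ('X - a%:P))] := geom_irr X p_irr.
rewrite size_XsubC dvdp_XsubCl /root => /(_ isT);
  rewrite -/(ev a p) pa eqxx => /(_ isT) /eqp_size.
rewrite size_XsubC size_map_poly => /esym sp2.
have p1 : p`_1 != 0 by have := lead_coef_eq0 p; rewrite lead_coefE sp2 /= => ->.
exists (- p`_0 / p`_1).
move: pa; rewrite evE sp2 !big_ord_recl big_ord0 /= expr0 mulr1 addr0 expr1 => /eqP.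
rewrite addrC addr_eq0 => /eqP E; rewrite fmorph_div rmorphN -E mulrC mulKf //.
by rewrite fmorph_eq0.
Qed.
End ValuationRing.

(** * Finiteness of zeros and of residue fields *)

Section FiniteZeros.
Variables (k : finFieldType) (X : curve k).
Implicit Types (x : place X).

Section Param.
Variables (t : X) (n : nat) (b : 'I_n -> X).
Hypotheses (tt : transc t) (sp : spans t b).
Let Q := (#|k| ^ n)%N.

(** Divide an equation sum q_i(t) a^i = 0 by the lowest power of a that occurs: its coefficient
    q_i(t) vanishes wherever a vanishes and t is regular. *)
Lemma alg_zero (a : X) : a != 0 -> exists2 p : {poly k}, p != 0 &
  forall x, vge (ord x) 0 t -> vge (ord x) 1 a -> vge (ord x) 1 (ev t p).
Proof.
move=> a0; have [N NP] := fin_dep tt sp t.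
have [q [[i1 qi1] qs]] := NP (fun i => a ^+ i).
case: (@arg_minnP _ i1 (fun i => q i != 0) (@nat_of_ord _) qi1) => i qi imin.
exists (q i) => // x xt xa.
pose w := \sum_(j | j != i) ev t (q j) * a ^+ (j - i.+1).
have wx : vge (ord x) 0 w.
  apply: (vge_sum (ord_dval x)) => j _; apply: (vgeM0 (ord_dval x)); first exact: vge_ev.
  by apply: (vgeX (ord_dval x)); exact: vge_le xa.
suff -> : ev t (q i) = - (w * a).
  by rewrite (vgeN (ord_dval x)); exact: (vgeM0 (ord_dval x)).
apply: (mulIf (expf_neq0 i a0)); apply/eqP; rewrite mulNr -addr_eq0 -[X in _ == X]qs.
rewrite [X in _ == X](bigD1 i) //=; apply/eqP; congr (_ + _).
rewrite -mulrA -exprS mulr_suml; apply: eq_bigr => j ji; rewrite -mulrA -exprD.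
have [qj|qj] := eqVneq (q j) 0; first by rewrite qj rmorph0 !mul0r.
have ij := imin _ qj; rewrite subnK // ltn_neqAle ij andbT.
by apply: contraNneq ji => ji; apply/eqP/val_inj.
Qed.

(** A place where t is regular is a zero of some polynomial in t, by [alg_zero] for a uniformizer;
    any other place is a zero of 1/t. Both t and 1/t satisfy [growth]. *)
Lemma zero_witness x : exists a p, [/\ growth n a, vge (ord x) 0 a, ev a p != 0
  & vge (ord x) 1 (ev a p)].
Proof.
have t0 := transc_neq0 tt; have gt := growth_t tt sp.
have [xt|xt] := boolP (vge (ord x) 0 t).
  have [u u0 xu] := dval_unif (ord_dval x); have [p p0 pP] := alg_zero u0.
  exists t, p; split=> //; first exact: tt.
  by apply: pP => //; rewrite vgeE // xu.
exists t^-1, 'X; rewrite evX; split; first exact: (growth_inv t0 gt).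
- by move: xt; rewrite !vgeE ?invr_neq0 // (dvalV (ord_dval x)) //; lia.
- by rewrite invr_neq0.
by move: xt; rewrite !vgeE ?invr_neq0 // (dvalV (ord_dval x)) //; lia.
Qed.

(** By [fund_ineq], among more elements there would be two whose difference is p(a) times a
    combination that is regular on S. *)
Lemma incongruent_bound (S : seq (place X)) (a : X) p (T : finType) (y : T -> X) :
  growth n a -> ev a p != 0 -> {in S, forall x, vge (ord x) 0 a} ->
  (forall i, {in S, forall x, vge (ord x) 0 (y i)}) ->
  (forall i j, {in S, forall x, vge (ord x) (ord x (ev a p)) (y i - y j)} -> i = j) ->
  (#|T| <= Q ^ (size p).-1)%N.
Proof.
move=> ga p0 Sa Sy sep; rewrite leqNgt; apply/negP => lt.
have [i [j [ij [J [z [[q _ ->] yij]]]]]] := fund_ineq (y \o enum_val) ga p0 lt.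
apply/ij/enum_val_inj/sep => x xS; move: yij => /= ->.
rewrite -[ord x _ as X in vge _ X]add0r (vge_mul (ord_dval x)) //.
apply: (vge_sum (ord_dval x)) => l _.
by apply: (vgeM0 (ord_dval x)); [apply: vge_ev; exact: Sa|exact: Sy].
Qed.

Lemma vge1F x : vge (ord x) 1 1 = false.
Proof. by rewrite vgeE ?oner_neq0 // (dval1 (ord_dval x)). Qed.

(** Approximate idempotents, one for each zero in a list, are pairwise incongruent, so
    [incongruent_bound] limits the length of the list. *)
Lemma finite_zeros (a : X) p : growth n a -> ev a p != 0 ->
  finite_set [set x | vge (ord x) 0 a /\ vge (ord x) 1 (ev a p)].
Proof.
move=> ga p0; apply: (@finite_of_bound _ _ (Q ^ (size p).-1)) => s us sP.
have xi (i : 'I_(size s)) : tnth (in_tuple s) i \in s by exact: mem_tnth.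
pose rs (i : 'I_(size s)) := [seq y <- s | y != tnth (in_tuple s) i].
have /choice[u uP] : forall i : 'I_(size s), exists u,
    vge (ord (tnth (in_tuple s) i)) 1 (u - 1) /\
    forall y, y \in rs i -> vge (ord y) 1 u.
  by move=> i; apply: (@approx_idem _ _ _ (rs i) 1); rewrite mem_filter eqxx.
have u1 i j : i != j -> vge (ord (tnth (in_tuple s) j)) 1 (u i).
  move=> ij; have [_] := uP i; apply; rewrite mem_filter xi andbT.
  by apply: contraNneq ij => ji; apply/eqP/(tuple_uniqP (in_tuple s)).
rewrite -[size s](card_ord (size s)).
apply: (@incongruent_bound s a p _ u) => // [x /sP[]//|i x xs|i j ijP].
  have [j ->] := tnthP (in_tuple s) x xs.
  have [<-|ij] := eqVneq i j; last by exact: vge_le (u1 _ _ ij).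
  have [u11 _] := uP i; have -> : u i = (u i - 1) + 1 by ring.
  apply: (vgeD (ord_dval _)); [exact: vge_le u11|exact: (vge1 (ord_dval _))].
apply: contrapT => /eqP ij; pose x := tnth (in_tuple s) i.
have xs : x \in s by exact: xi.
have := ijP x xs; have [_] := sP _ xs; rewrite vgeE // => p1 /(vge_le p1) uij.
have uj : vge (ord x) 1 (u j) by apply: u1; rewrite eq_sym.
have [ui _] := uP i; suff: vge (ord x) 1 1 by rewrite vge1F.
have -> : (1 : X) = (u i - u j) + u j - (u i - 1) by ring.
by apply: (vgeB (ord_dval x)) => //; exact: (vgeD (ord_dval x)).
Qed.

End Param.

Lemma vge_sub x m : subgrp [set a : X | vge (ord x) m a].
Proof. by split=> [|a c]; [exact: vge0|exact: (vgeB (ord_dval x))]. Qed.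

Lemma residue_fin x : exists N,
  idx [set a : X | vge (ord x) 0 a] [set a : X | vge (ord x) 1 a] N.
Proof.
have [t [n [b [tt sp _]]]] := basis_over X.
have [a [p [ga xa p0 p1]]] := zero_witness tt sp x.
have [|||N _ NP] := @idx_bound _ [set a : X | vge (ord x) 0 a]
  [set a : X | vge (ord x) 1 a] ((#|k| ^ n) ^ (size p).-1); last by exists N.
- exact: vge_sub.
- exact: vge_sub.
move=> m s sx sep; rewrite -(card_ord m).
apply: (@incongruent_bound n [:: x] a p _ s) => // [y|i y|i j H].
- by rewrite inE => /eqP ->.
- by rewrite inE => /eqP ->; exact: sx.
apply: sep => /=; have := H x; rewrite inE eqxx => /(_ isT); apply: vge_le.
by rewrite vgeE in p1.
Qed.

(* the number of elements of the residue field *)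
Definition resN x : nat := sval (cid (residue_fin x)).

Lemma resNP x : idx [set a : X | vge (ord x) 0 a] [set a : X | vge (ord x) 1 a] (resN x).
Proof. by rewrite /resN; case: cid. Qed.

Lemma resN_gt1 x : (1 < resN x)%N.
Proof.
have N0 : (0 < resN x)%N by apply: idx_gt0 (resNP x); exact: vge0.
rewrite ltn_neqAle N0 andbT; apply/eqP => N1; have := resNP x.
rewrite -N1 => /(idx1 (@vge_sub x 1)) H.
have : [set a : X | vge (ord x) 1 a] 1.
  by apply: H => [a /=|]; [exact: vge_le|exact: (vge1 (ord_dval x))].
by rewrite /= vge1F.
Qed.

Lemma finite_pos (a : X) : a != 0 -> finite_set [set x | 0 < ord x a].
Proof.
move=> a0; have [t [n [b [tt sp _]]]] := basis_over X.
have t0 := transc_neq0 tt; have gt := growth_t tt sp.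
have [p p0 pP] := alg_zero tt sp a0.
have F1 := finite_zeros gt (tt _ p0).
have F2 : finite_set [set x | vge (ord x) 0 t^-1 /\ vge (ord x) 1 (ev t^-1 'X)].
  by apply: finite_zeros; [exact: (growth_inv t0 gt)|rewrite evX invr_neq0].
apply: sub_finite_set (_ : _ `<=` _ `|` _) _; last first.
  by rewrite finite_setU; split; [exact: F1|exact: F2].
move=> x /= xa; have [xt|xt] := boolP (vge (ord x) 0 t); [left|right].
  by split=> //; apply: pP => //; rewrite vgeE //; lia.
by move: xt; rewrite evX !vgeE ?invr_neq0 // (dvalV (ord_dval x)) // => xt; split; lia.
Qed.

Lemma finite_ord (a : X) : a != 0 -> finite_set [set x | ord x a != 0].
Proof.
move=> a0; apply: sub_finite_set (_ :
  _ `<=` [set x | 0 < ord x a] `|` [set x | 0 < ord x a^-1]) _.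
  by move=> x /=; rewrite (dvalV (ord_dval x)) // oppr_gt0 neq_lt => /orP[]; [right|left].
by rewrite finite_setU; split; apply: finite_pos; rewrite ?invr_neq0.
Qed.

(** In a residue field with at most B elements two of the powers 1, t, ..., t^B coincide. Hence x is
    a pole of t or a zero of one of finitely many functions t^i - t^j. *)
Lemma finite_resN (B : nat) : finite_set [set x | (resN x <= B)%N].
Proof.
have [t [n [b [tt sp _]]]] := basis_over X.
have t0 := transc_neq0 tt; have gt := growth_t tt sp.
have F2 : finite_set [set x | 0 < ord x t^-1] by apply: finite_pos; rewrite invr_neq0.
pose f (p : nat * nat) : set (place X) :=
  if (p.1 < p.2)%N then [set x | vge (ord x) 0 t /\ vge (ord x) 1 (ev t ('X^(p.1) - 'X^(p.2)))]
  else set0.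
have F1 : finite_set (\bigcup_(p in `I_B.+1 `*` `I_B.+1) f p).
  apply: bigcup_finite => [|[i j] _]; first by apply: finite_setX; exact: finite_II.
  rewrite /f /=; case: ifP => // ij; apply: finite_zeros gt (tt _ _).
  rewrite subr_eq0; apply: contraTneq ij => /(congr1 (fun p : {poly k} => size p)).
  by rewrite !size_polyXn => -[->]; rewrite ltnn.
apply: sub_finite_set (_ : _ `<=` _ `|` _) _; last first.
  by rewrite finite_setU; split; [exact: F1|exact: F2].
move=> x /= NB; have [xt|xt] := boolP (vge (ord x) 0 t); last first.
  by right; move: xt; rewrite /= vgeE // (dvalV (ord_dval x)) //; lia.
left; have : exists i j : 'I_(B.+1), i <> j /\ vge (ord x) 1 (t ^+ i - t ^+ j).
  apply: contrapT => nex.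
  have := @idx_le _ _ _ _ 'I_B.+1 (fun i => t ^+ i) (@vge_sub x 1) (resNP x).
  rewrite card_ord => H; have : (B.+1 <= resN x)%N.
    apply: H => [i|i j ij]; first exact: (vgeX (ord_dval x)).
    by apply: contrapT => ij'; apply: nex; exists i, j.
  by rewrite ltnNge NB.
have main (i j : 'I_B.+1) : (i < j)%N -> vge (ord x) 1 (t ^+ i - t ^+ j) ->
    (\bigcup_(p in `I_B.+1 `*` `I_B.+1) f p) x.
  move=> ij xij; exists ((i : nat), (j : nat)); first by split=> /=.
  by rewrite /f /= ij; split=> //; rewrite rmorphB !rmorphXn /= evX.
move=> [i [j [ij xij]]]; have [||/val_inj//] := ltngtP i j; first by move/main; apply.
by move/main; apply; rewrite -opprB (vgeN (ord_dval x)).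
Qed.

End FiniteZeros.

(** * Riemann-Roch *)

Section Norm.
Variables (k : finFieldType) (X : curve k).
Implicit Types (x : place X) (D E : place X -> int).

Definition fsup D := finite_set [set x | D x != 0].

(* q^(deg D) *)
Definition nrm D : rat := \prod_(x <- enum_fset (fset_set [set x | D x != 0])) (resN x)%:R ^ D x.

Lemma fsup_seq D : fsup D -> exists2 s, uniq s & forall x, x \notin s -> D x = 0.
Proof.
move=> fD; exists (enum_fset (fset_set [set x | D x != 0])); first exact: fset_uniq.
move=> x; rewrite (_ : (x \notin enum_fset _) = (x \notin fset_set [set x | D x != 0])) //.
by rewrite in_fset_set // notin_setE /= => /negP/negPn/eqP.
Qed.

Lemma fsup_of (s : seq (place X)) D : (forall x, x \notin s -> D x = 0) -> fsup D.
Proof.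
move=> sD; apply: sub_finite_set (_ : _ `<=` [set` s]) _; last exact: finite_seq.
by move=> x /=; apply: contra_neqT => /sD ->.
Qed.

Lemma fsup_seq2 D E : fsup D -> fsup E ->
  exists s, [/\ uniq s, forall x, x \notin s -> D x = 0 & forall x, x \notin s -> E x = 0].
Proof.
move=> /fsup_seq[s _ sD] /fsup_seq[r _ rE]; exists (undup (s ++ r)).
split; first exact: undup_uniq.
  by move=> x; rewrite mem_undup mem_cat negb_or => /andP[/sD].
by move=> x; rewrite mem_undup mem_cat negb_or => /andP[_ /rE].
Qed.

Lemma fsup2 (f : int -> int -> int) D E : f 0 0 = 0 -> fsup D -> fsup E ->
  fsup (fun x => f (D x) (E x)).
Proof.
move=> f0 fD fE; have [s [_ sD sE]] := fsup_seq2 fD fE.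
by apply: (fsup_of (s := s)) => x xs; rewrite sD // sE.
Qed.

Lemma fsup1 (f : int -> int) D : f 0 = 0 -> fsup D -> fsup (fun x => f (D x)).
Proof. by move=> f0 fD; exact: (@fsup2 (fun d _ => f d) D D). Qed.

Lemma fsupD D E : fsup D -> fsup E -> fsup (fun x => D x + E x).
Proof. exact: (@fsup2 +%R). Qed.

Lemma fsupN D : fsup D -> fsup (fun x => - D x).
Proof. exact: (@fsup1 -%R). Qed.

Lemma fsupB D E : fsup D -> fsup E -> fsup (fun x => D x - E x).
Proof. by move=> fD fE; apply: fsupD => //; exact: fsupN. Qed.

Lemma fsupZ (m : int) D : fsup D -> fsup (fun x => m * D x).
Proof. by apply: (@fsup1 ( *%R m)); rewrite mulr0. Qed.

Lemma fsup_max0 D : fsup D -> fsup (fun x => Num.max (D x) 0).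
Proof. by apply: (@fsup1 (Num.max^~ 0)). Qed.

Lemma fsup_ord (a : X) : a != 0 -> fsup (fun x => ord x a).
Proof. exact: finite_ord. Qed.

Lemma fsup0 : fsup (fun=> 0).
Proof. by apply: (fsup_of (s := [::])). Qed.

Lemma fsup_sum (I : Type) (r : seq I) (F : I -> place X -> int) :
  (forall i, fsup (F i)) -> fsup (fun x => \sum_(i <- r) F i x).
Proof.
move=> fF; elim: r => [|i r IH].
  by apply: (fsup_of (s := [::])) => x _; rewrite big_nil.
have [s [_ s1 s2]] := fsup_seq2 (fF i) IH.
by apply: (fsup_of (s := s)) => x xs; rewrite big_cons s1 // s2.
Qed.

Lemma resN_rat x : 1 < (resN x)%:R :> rat.
Proof. by rewrite ltr1n resN_gt1. Qed.

Lemma resN_rat_neq0 x : (resN x)%:R != 0 :> rat.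
Proof. by rewrite pnatr_eq0 -lt0n ltnW // resN_gt1. Qed.

Lemma nrmE (s : seq (place X)) D : uniq s -> (forall x, x \notin s -> D x = 0) ->
  nrm D = \prod_(x <- s) (resN x)%:R ^ D x.
Proof.
move=> us sD; have fD := fsup_of sD.
rewrite (bigID (fun x => D x != 0)) /= [X in _ * X]big1 ?mulr1; last first.
  by move=> x /negPn/eqP ->; rewrite expr0z.
rewrite -big_filter /nrm; apply: perm_big; apply: uniq_perm.
- exact: fset_uniq.
- exact: filter_uniq.
move=> x; rewrite mem_filter in_fset_set //; apply/idP/idP.
  by rewrite in_setE /= => Dx; rewrite Dx; apply: contraT => /sD Dx0; rewrite Dx0 eqxx in Dx.
by rewrite in_setE => /andP[].
Qed.

Lemma nrmD D E : fsup D -> fsup E -> nrm (fun x => D x + E x) = nrm D * nrm E.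
Proof.
move=> fD fE; have [s [us sD sE]] := fsup_seq2 fD fE.
rewrite (nrmE us sD) (nrmE us sE) (@nrmE s) //; last by move=> x xs; rewrite sD ?sE.
by rewrite -big_split /=; apply: eq_bigr => x _; rewrite expfzDr // resN_rat_neq0.
Qed.

Lemma nrm0 : nrm (fun=> 0) = 1.
Proof. by rewrite (@nrmE [::]) // big_nil. Qed.

Lemma nrm_gt0 D : 0 < nrm D.
Proof. by apply: prodr_gt0 => x _; apply: exprz_gt0; apply: lt_trans (resN_rat x). Qed.

Lemma nrm_neq0 D : nrm D != 0. Proof. by rewrite gt_eqF // nrm_gt0. Qed.

Lemma nrmN D : fsup D -> nrm (fun x => - D x) = (nrm D)^-1.
Proof.
move=> fD; have fN : fsup (fun x => - D x) by exact: fsup1 fD.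
apply: (mulfI (nrm_neq0 D)); rewrite -nrmD // divff ?nrm_neq0 //.
by rewrite -[RHS]nrm0; congr nrm; apply/funext => x; rewrite subrr.
Qed.

Lemma nrmB D E : fsup D -> fsup E -> nrm (fun x => D x - E x) = nrm D / nrm E.
Proof. by move=> fD fE; rewrite nrmD ?nrmN //; exact: fsup1 fE. Qed.

Lemma nrmMn D (m : nat) : fsup D -> nrm (fun x => m%:R * D x) = nrm D ^+ m.
Proof.
move=> fD; elim: m => [|m IH].
  by rewrite expr0 -[RHS]nrm0; congr nrm; apply/funext => x; rewrite mul0r.
rewrite exprS -IH -nrmD //; last by apply: fsup1 fD; rewrite mulr0.
by congr nrm; apply/funext => x; rewrite mulrS mulrDl mul1r.
Qed.

Lemma le_nrm D E : fsup D -> fsup E -> (forall x, D x <= E x) -> nrm D <= nrm E.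
Proof.
move=> fD fE DE; have [s [us sD sE]] := fsup_seq2 fD fE.
rewrite (nrmE us sD) (nrmE us sE); apply: ler_prod => x _.
by rewrite exprz_ge0 //= ler_weXz2l // ltW // resN_rat.
Qed.

Lemma nrm_ge1 D : fsup D -> (forall x, 0 <= D x) -> 1 <= nrm D.
Proof. by move=> fD D0; rewrite -nrm0; apply: le_nrm => //; exact: fsup0. Qed.

Lemma nrm_single x (n : int) : nrm (fun y => if y == x then n else 0) = (resN x)%:R ^ n.
Proof.
rewrite (@nrmE [:: x]) //; first by rewrite big_seq1 eqxx.
by move=> y; rewrite inE => /negbTE ->.
Qed.

Lemma fsup_single x (n : int) : fsup (fun y => if y == x then n else 0).
Proof. by apply: (fsup_of (s := [:: x])) => y; rewrite inE => /negbTE ->. Qed.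

Lemma nrm_point D x : fsup D -> (forall x, 0 <= D x) -> (resN x)%:R ^ D x <= nrm D.
Proof.
move=> fD D0; rewrite -nrm_single; apply: le_nrm => //; first exact: fsup_single.
by move=> y; case: eqP => [->|].
Qed.

Lemma nrm_eq0 D : fsup D -> (forall x, 0 <= D x) -> nrm D <= 1 -> forall x, D x = 0.
Proof.
move=> fD D0 D1 x; apply/eqP; apply: contraTT D1 => Dx; rewrite -ltNge.
apply: lt_le_trans (nrm_point x fD D0).
by have := D0 x; case DE : (D x) Dx => [[|m]|m] // _ _; rewrite -exprnP exprn_egt1 // resN_rat.
Qed.

(** Only the finitely many places with at most B residue classes can occur, each with multiplicity
    at most B because m < N^m for N > 1. *)
Lemma finite_effective (B : nat) :
  finite_set [set D | [/\ fsup D, forall x, 0 <= D x & nrm D <= B%:R]].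
Proof.
have [s us sP] : exists2 s, uniq s & forall x, (resN x <= B)%N -> x \in s.
  have /finite_seqP[s sE] := finite_resN X B; exists (undup s); first exact: undup_uniq.
  by move=> x xB; rewrite mem_undup; have : [set` s] x by rewrite -sE.
pose f (g : {ffun seq_sub s -> 'I_B.+1}) : place X -> int :=
  fun x => if insub x is Some u then (g u : nat)%:Z else 0.
apply: sub_finite_set (_ : _ `<=` range f) _; last by apply: finite_image; exact: finite_finset.
move=> D [fD D0 DB].
have Dx x : D x != 0 -> x \in s /\ (`|D x| < B.+1)%N.
  move=> Dx; have Dpos : 0 < D x by rewrite lt_neqAle eq_sym Dx D0.
  have := le_trans (nrm_point x fD D0) DB.
  case DE : (D x) Dpos => [[//|m]|//] _; rewrite -exprnP -natrX ler_nat => le.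
  split.
    apply: sP; apply: leq_trans le; rewrite -[X in (X <= _)%N]expn1 leq_exp2l //.
    exact: resN_gt1.
  rewrite /= ltnS (leq_trans _ le) // ltnW // (ltn_expl) // resN_gt1 //.
exists [ffun u => inord `|D (val u)|] => //; apply/funext => x; rewrite /f.
case: insubP => [u xs <-|xs].
  rewrite ffunE inordK ?gez0_abs //.
  by have [->|/Dx[]] := eqVneq (D (val u)) 0.
by have [//|/Dx[]] := eqVneq (D x) 0; rewrite (negbTE xs).
Qed.

End Norm.

(** * The groups A(D) and their indices *)

Section AdeleIndex.
Variables (k : finFieldType) (X : curve k).
Variable C : forall x : place X, completion x.
Implicit Types (x : place X) (D E : place X -> int) (a b : adele C).

Lemma vge_emb x n (a : X) : vge (@cval _ _ _ (C x)) n (emb (C x) a) = vge (ord x) n a.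
Proof. by rewrite /vge fmorph_eq0 cval_emb. Qed.

Fact famA_int (c : place X -> X) : finite_set [set x | ~~ vge (ord x) 0 (c x)] ->
  finite_set [set x | ~~ vge (@cval _ _ _ (C x)) 0 (emb (C x) (c x))].
Proof. by apply: sub_finite_set => x /=; rewrite vge_emb. Qed.

Definition famA (c : place X -> X) (h : finite_set [set x | ~~ vge (ord x) 0 (c x)]) :
  adele C := Adele (famA_int h).

Fact diag_fin (a : X) : finite_set [set x | ~~ vge (ord x) 0 a].
Proof.
have [->|a0] := eqVneq a 0.
  by apply: sub_finite_set (_ : _ `<=` set0) _ => // x /=; rewrite vge0.
apply: sub_finite_set (_ : _ `<=` [set x | ord x a != 0]) (finite_ord a0) => x /=.
by apply: contraNneq => H; rewrite vgeE // H.
Qed.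

Definition dia (a : X) : adele C := famA (diag_fin a).

Fact dia_additive : zmod_morphism dia.
Proof. by move=> a b; apply: adeleP => x /=; rewrite rmorphB. Qed.
HB.instance Definition _ := GRing.isZmodMorphism.Build X (adele C) dia dia_additive.
Fact dia_multiplicative : monoid_morphism dia.
Proof. by split=> [|a b]; apply: adeleP => x /=; rewrite ?rmorph1 ?rmorphM. Qed.
HB.instance Definition _ := GRing.isMonoidMorphism.Build X (adele C) dia dia_multiplicative.

Definition AD D : set (adele C) := [set a | forall x, vge (@cval _ _ _ (C x)) (- D x) (a x)].

Lemma AD_sub D : subgrp (AD D).
Proof.
split=> [x|a b aD bD x]; first exact: vge0.
exact: (vgeB (cval_dval (C x))).
Qed.

Lemma AD_le D E : (forall x, D x <= E x) -> AD D `<=` AD E.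
Proof. by move=> DE a aD x; apply: vge_le (aD x); rewrite lerN2. Qed.

(** The quotient is the residue field at x: the component at x is approximated by an element of F
    and scaled by a power of a uniformizer. *)
Lemma idx_AD_step D E x : (forall y, y != x -> E y = D y) -> E x = D x + 1 ->
  idx (AD E) (AD D) (resN x).
Proof.
move=> ED Ex; have [T [r [cT r0 rP]]] := resNP x.
have [u u0 xu] := dval_unif (ord_dval x).
have uz0 n : u ^ n != 0 by apply: expfz_neq0.
have xuz n : ord x (u ^ n) = n by rewrite (dvalXz (ord_dval x)) // xu mul1r.
pose c i := u ^ (- E x) * r i.
have cE i n : vge (ord x) (n - E x) (c i) = vge (ord x) n (r i).
  by rewrite -[X in n - X]opprK opprK -{1}(xuz (- E x)) (vge_mul (ord_dval x)).
have hR i : finite_set [set y | ~~ vge (ord y) 0 (if y == x then c i else 0)].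
  apply: sub_finite_set (_ : _ `<=` [set x]) _; last exact: finite_set1.
  by move=> y /=; case: eqP => // _; rewrite vge0.
exists T, (fun i => famA (hR i)); split=> // [i y|v vE].
  rewrite /= vge_emb; case: eqP => [->|_]; last exact: vge0.
  by rewrite -[- E x]add0r cE; exact: r0.
have DEx : - D x = 1 - E x by rewrite Ex; ring.
have [a aP] := emb_dense (v x) (- D x).
have xa : vge (ord x) (- E x) a.
  rewrite -vge_emb.
  have -> : emb (C x) a = v x - (v x - emb (C x) a) by ring.
  apply: (vgeB (cval_dval (C x))) (vE x) _; apply: vge_le aP; lia.
pose b := u ^ E x * a.
have b0 : vge (ord x) 0 b.
  by rewrite /b -[0](subrr (E x)) -[X in X - _]xuz addrC (vge_mul (ord_dval x)).
have key i : vge (ord x) 1 (b - r i) = vge (@cval _ _ _ (C x)) (- D x) (v x - emb (C x) (c i)).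
  rewrite -(vge_mul (ord_dval x) 1 _ (uz0 (- E x))) xuz -DEx mulrBr mulrA -expfzDr //.
  rewrite addNr expr0z mul1r -/(c i) -vge_emb rmorphB.
  apply/idP/idP => H.
    have -> : v x - emb (C x) (c i) = (v x - emb (C x) a) + (emb (C x) a - emb (C x) (c i)) by
      ring.
    exact: (vgeD (cval_dval (C x))).
  have -> : emb (C x) a - emb (C x) (c i) = (v x - emb (C x) (c i)) - (v x - emb (C x) a) by ring.
  exact: (vgeB (cval_dval (C x))).
have [i [ri iU]] := rP b b0; exists i; split=> [y|j jP].
  rewrite /=; case: eqP => [->|/eqP yx]; first by rewrite -key.
  by rewrite rmorph0 oppr0 addr0 -ED.
by apply: iU; rewrite /= key; have := jP x; rewrite /= eqxx.
Qed.

Lemma idx_AD D E : fsup D -> fsup E -> (forall x, D x <= E x) ->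
  exists2 n, idx (AD E) (AD D) n & n%:R = nrm (fun x => E x - D x).
Proof.
move=> fD fE DE; have [s [us sD sE]] := fsup_seq2 fD fE.
have [m mE] := ubnP (\sum_(x <- s) `|(E x - D x)%R|)%N.
elim: m => // m IH in E fE DE sE mE *.
have [ED|nED] := pselect (forall x, E x = D x).
  exists 1%N; last first.
    by rewrite -(nrm0 X); congr nrm; apply/funext => x; rewrite ED subrr.
  have -> : E = D by apply/funext.
  exact/idxxx/AD_sub.
have [x Ex] : exists x, D x < E x.
  apply: contrapT => H; apply: nED => x; apply/eqP; rewrite eq_le DE andbT leNgt.
  by apply/negP => xED; apply: H; exists x.
have xs : x \in s by apply: contraT => xs; rewrite sD // sE // ltxx in Ex.
pose E' y := if y == x then E x - 1 else E y.
have sE' y : y \notin s -> E' y = 0.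
  by move=> ys; rewrite /E'; case: eqP => [yx|_]; [rewrite yx xs in ys|exact: sE].
have fE' := fsup_of sE'.
have DE' y : D y <= E' y by rewrite /E'; case: eqP => [->|_]; [lia|exact: DE].
have mE' : (\sum_(x <- s) `|(E' x - D x)%R| < m)%N.
  move: mE; rewrite !(bigD1_seq x) //= (_ : E' x = E x - 1); last by rewrite /E' eqxx.
  rewrite [X in ((_ + X)%N < m.+1)%N](eq_bigr (fun i => `|(E' i - D i)%R|%N)).
    by move: (\sum_(i <- s | i != x) _)%N => S; lia.
  by move=> i /negbTE ix; rewrite /E' ix.
have [n In nn] := IH E' fE' DE' sE' mE'.
exists (resN x * n)%N.
  apply: (@idx_trans _ (AD E) (AD E') (AD D)) In; try exact: AD_sub.
  - by apply: AD_le => y; rewrite /E'; case: eqP => [->|//]; lia.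
  - by apply: AD_le => y; rewrite /E'; case: eqP => [->|//]; lia.
  by apply: idx_AD_step => [y /negbTE yx|]; rewrite /E' ?yx // eqxx subrK.
rewrite natrM nn -[(resN x)%:R]expr1z -nrm_single -nrmD.
- by congr nrm; apply/funext => y; rewrite /E'; case: eqP => [->|_]; ring.
- exact: fsup_single.
exact: fsupB.
Qed.

End AdeleIndex.

(** * Riemann's inequality, vanishing of H^1 and the product formula *)

Section Riemann.
Variables (k : finFieldType) (X : curve k).
Variable C : forall x : place X, completion x.
Implicit Types (x : place X) (D E : place X -> int).

Definition GF : set (adele C) := range (dia C).

Lemma GF_sub : subgrp GF.
Proof.
split; first by exists 0; rewrite ?raddf0.
by move=> _ _ [a _ <-] [b _ <-]; exists (a - b); rewrite ?raddfB.
Qed.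

Definition H0 D := AD (C := C) D `&` GF.

Lemma H0_sub D : subgrp (H0 D).
Proof. exact: subgrpI (AD_sub _ _) GF_sub. Qed.

Lemma AD_dia D (a : X) : AD D (dia C a) <-> forall x, vge (ord x) (- D x) a.
Proof. by split=> aD x; have := aD x; rewrite /= vge_emb. Qed.

Lemma AD_inhabited (x0 : place X) : injective (dia C).
Proof. by move=> a b /(congr1 (fun c : adele C => c x0)) /= /fmorph_inj. Qed.

Lemma ex_place : exists x0 : place X, True.
Proof.
have [t [n [b [tt sp _]]]] := basis_over X.
apply: contrapT => nex; have [|c tc] := regular_const (a := t).
  by move=> x; case: nex; exists x.
have : 'X - c%:P != 0 :> {poly k} by rewrite polyXsubC_eq0.
by move/tt; rewrite rmorphB /= evX evC tc subrr eqxx.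
Qed.

Lemma dia_inj : injective (dia C).
Proof. by have [x0 _] := ex_place; exact: AD_inhabited x0. Qed.

Lemma sub0_subgrp (V : zmodType) : subgrp [set (0 : V)].
Proof. by split=> // a b -> ->; rewrite subrr. Qed.

Lemma idx_H0_0 : idx (H0 (fun=> 0)) [set 0] #|k|.
Proof.
exists k, (dia C \o const X); split=> // [c|v [vD [a _ aE]]].
  split; last by exists (const X c).
  by apply/AD_dia => x; rewrite oppr0; exact: vge_const.
move: vD; rewrite -aE => /AD_dia aD; have [x|c ->] := regular_const (a := a).
  by rewrite -[0]oppr0; exact: aD.
exists c; split=> [|d] /=; first by rewrite subrr.
by move/eqP; rewrite subr_eq0 => /eqP/dia_inj/fmorph_inj.
Qed.

(** For E = max(D, 0), the quotient of H^0(E) by H^0(0) = k embeds in the finite group A(E)/A(0). *)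
Lemma ex_h0 D : fsup D -> exists n, idx (H0 D) [set 0] n.
Proof.
move=> fD; pose E x := Num.max (D x) 0.
have fE : fsup E by exact: fsup_max0.
have DE x : D x <= E x by rewrite /E le_max lexx.
have E0 x : 0 <= E x by rewrite /E le_max lexx orbT.
have [m Im _] := idx_AD C (fsup0 X) fE E0.
have [a [b [Ia Ib _]]] := idx_second (AD_sub _ _) (AD_sub _ _) GF_sub (AD_le E0) Im.
have sub0 F : [set 0] `<=` H0 F by move=> _ ->; exact: (H0_sub F).1.
have H0E F : (forall x, F x <= E x) -> H0 F `<=` H0 E.
  by move=> FE v [vD vG]; split=> //; exact: AD_le vD.
have I := idx_trans (H0_sub E) (H0_sub _) (@sub0_subgrp _) (H0E _ E0) (sub0 _) Ia idx_H0_0.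
have [c [d [_ Id _]]] := idx_sub (H0_sub E) (H0_sub D) (@sub0_subgrp _) (H0E _ DE) (sub0 _) I.
by exists d.
Qed.

(* q^(dim H^0(X, O(D))) *)
Definition h0 D : nat := xget 0%N [set n | idx (H0 D) [set 0] n].

Lemma h0P D : fsup D -> idx (H0 D) [set 0] (h0 D).
Proof. by move/ex_h0 => [n In]; exact: (xgetI 0%N In). Qed.

Lemma h0_uniq D n : idx (H0 D) [set 0] n -> h0 D = n.
Proof.
move=> In; have := xgetI 0%N In : idx _ _ (h0 D).
by move=> I; exact: (idx_uniq (@sub0_subgrp _) I In).
Qed.

Lemma h0_gt0 D : fsup D -> (0 < h0 D)%N.
Proof. by move=> /h0P; apply: idx_gt0; exact: (H0_sub D).1. Qed.

Lemma h0_neq0 D : fsup D -> (h0 D)%:R != 0 :> rat.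
Proof. by move=> /h0_gt0; rewrite pnatr_eq0 -lt0n. Qed.

(** This is q^(deg D - dim H^0(D)). It increases with D, and Riemann's inequality is its
    boundedness. *)
Definition rr D : rat := nrm D / (h0 D)%:R.

Lemma rr_gt0 D : fsup D -> 0 < rr D.
Proof. by move=> fD; rewrite divr_gt0 ?nrm_gt0 // ltr0n h0_gt0. Qed.

Lemma rr_step D E : fsup D -> fsup E -> (forall x, D x <= E x) ->
  exists2 b, idx (sumset (AD E) GF) (sumset (AD D) GF) b & rr E = rr D * b%:R.
Proof.
move=> fD fE DE; have [m Im mE] := idx_AD C fD fE DE.
have [a [b [Ia Ib mab]]] := idx_second (AD_sub _ _) (AD_sub _ _) GF_sub (AD_le DE) Im.
exists b => //.
have hE : h0 E = (a * h0 D)%N.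
  apply: h0_uniq; apply: (idx_trans (H0_sub E) (H0_sub D)) Ia (h0P fD).
  - exact: sub0_subgrp.
  - by move=> v [vD vG]; split=> //; exact: AD_le vD.
  by move=> _ ->; exact: (H0_sub D).1.
have a0 : a%:R != 0 :> rat.
  by rewrite pnatr_eq0 -lt0n; have := h0_gt0 fE; rewrite hE muln_gt0 => /andP[].
have nE : nrm E = nrm D * (a * b)%N%:R.
  by rewrite -mab mE nrmB // mulrCA divff ?mulr1 // nrm_neq0.
by rewrite /rr nE hE !natrM; field; rewrite a0 h0_neq0.
Qed.

Lemma rr_le D E : fsup D -> fsup E -> (forall x, D x <= E x) -> rr D <= rr E.
Proof.
move=> fD fE DE; have [b Ib ->] := rr_step fD fE DE.
rewrite ler_peMr ?(ltW (rr_gt0 fD)) // ler1n; apply: idx_gt0 Ib.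
exact: (subgrp_sumset (AD_sub _ _) GF_sub).1.
Qed.

(** Multiplication by 1/f maps H^0(D) onto H^0(D + div f). *)
Lemma h0_mul (f : X) D : f != 0 -> fsup D -> h0 (fun x => D x + ord x f) = h0 D.
Proof.
move=> f0 fD; apply: h0_uniq; pose m (a : adele C) := dia C f^-1 * a.
have mI : injective m.
  move=> a b /(congr1 (fun c => dia C f * c)).
  by rewrite /m !mulrA -rmorphM divff // rmorph1 !mul1r.
have mB a b : m (a - b) = m a - m b by rewrite /m mulrBr.
have := idx_img mB mI (h0P fD); rewrite image_set1 /m mulr0.
congr (idx _ _ _); apply/seteqP; split.
  move=> _ [_ [/[swap] [[a _ <-]] /AD_dia aD] <-]; rewrite -rmorphM.
  split; last by exists (f^-1 * a).
  apply/AD_dia => x; rewrite opprD -(dvalV (ord_dval x)) // (vge_mul (ord_dval x)) ?invr_neq0 //.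
move=> _ [/[swap] [[a _ <-]] /AD_dia aD]; exists (dia C (f * a)); last first.
  by rewrite -rmorphM mulKf.
split; last by exists (f * a).
by apply/AD_dia => x; rewrite -(vge_mul (ord_dval x) _ _ (invr_neq0 f0)) mulKf // (dvalV
  (ord_dval x)) // -opprD.
Qed.

(** The norm of Z is the index of A(-Z) in A(0). By weak approximation its representatives are
    replaced by elements of F, which [incongruent_bound] counts. This is the upper bound [F : k(a)]
    deg p for the degree of the zeros of p(a). *)
Lemma zero_divisor_bound n (a : X) p (Z : place X -> int) : growth n a -> ev a p != 0 ->
  fsup Z -> (forall x, 0 <= Z x) ->
  (forall x, 0 < Z x -> vge (ord x) 0 a /\ Z x <= ord x (ev a p)) ->
  nrm Z <= ((#|k| ^ n) ^ (size p).-1)%N%:R.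
Proof.
move=> ga p0 fZ Z0 Zp.
have fN : fsup (fun x => - Z x) by exact: fsup1 fZ.
have [x|m [T [r [cT r0 rP]]] mE] := idx_AD C fN (fsup0 X); first by rewrite oppr_le0.
have -> : nrm Z = m%:R by rewrite mE; congr nrm; apply/funext => x; rewrite sub0r opprK.
rewrite ler_nat -cT.
have [s us sZ] := fsup_seq fZ; have [N NP] := seq_bound Z s.
have /choice[y yP] : forall i, exists y, forall x, x \in s ->
    vge (@cval _ _ _ (C x)) (Z x) (r i x - emb (C x) y).
  move=> i; have /choice[c cP] x := emb_dense (r i x) (Z x).
  have [y yP] := weak_approx c N us; exists y => x xs.
  have -> : r i x - emb (C x) y = (r i x - emb (C x) (c x)) - emb (C x) (y - c x).
    by rewrite rmorphB; ring.
  apply: (vgeB (cval_dval (C x))); first exact: cP.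
  by rewrite vge_emb; apply: vge_le (yP x xs); have := NP x xs; lia.
apply: (@incongruent_bound _ _ n [seq x <- s | 0 < Z x] a p T y) => //.
- by move=> x; rewrite mem_filter => /andP[/Zp[]].
- move=> i x; rewrite mem_filter => /andP[_ xs]; rewrite -(vge_emb C).
  have -> : emb (C x) (y i) = r i x - (r i x - emb (C x) (y i)) by ring.
  apply: (vgeB (cval_dval (C x))); first by have := r0 i x; rewrite oppr0.
  by apply: vge_le (yP i x xs).
move=> i j ij; apply: (idx_sep (AD_sub C (fun x => - Z x)) r0 rP) => x; rewrite opprK.
have [Zx|] := ltP 0 (Z x); last first.
  move=> Zx; apply: vge_le Zx _; have := (AD_sub C (fun=> 0)).2 _ _ (r0 i) (r0 j) x.
  by rewrite oppr0.
have xs : x \in s by apply: contraTT Zx => /sZ ->; rewrite ltxx.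
have -> : (r i - r j) x = (r i x - emb (C x) (y i)) - (r j x - emb (C x) (y j)) + emb (C x) (y
  i - y j).
  by rewrite rmorphB /=; ring.
apply: (vgeD (cval_dval (C x))).
  by apply: (vgeB (cval_dval (C x))); exact: yP.
rewrite vge_emb; have [_ Zle] := Zp x Zx; apply: vge_le Zle _; apply: ij.
by rewrite mem_filter Zx.
Qed.

Section Bound.
Variables (t : X) (n : nat) (b : 'I_n -> X).
Hypotheses (tt : transc t) (sp : spans t b).
Hypothesis b_free : forall p : 'I_n -> {poly k},
  \sum_i ev t (p i) * b i = 0 -> forall i, p i = 0.
Let Q := (#|k| ^ n)%N.
Let t0 := transc_neq0 tt.

Definition polar (a : X) x := Num.max (- ord x a) 0.

Lemma polar_ge0 a x : 0 <= polar a x.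
Proof. by rewrite /polar le_max lexx orbT. Qed.

Lemma fsup_polar (a : X) : fsup (polar a).
Proof.
apply: fsup_max0; have [->|a0] := eqVneq a 0.
  by apply: (fsup_of (s := [::])) => x _; rewrite (dval0 (ord_dval x)) oppr0.
by apply: fsupN; exact: fsup_ord.
Qed.

Lemma ord_ev_pole x (p : {poly k}) : ord x t < 0 -> p != 0 ->
  ord x (ev t p) = ord x t *+ (size p).-1.
Proof.
move=> xt; elim/poly_ind: p => [|p c IH]; first by rewrite eqxx.
rewrite rmorphD rmorphM /= evX evC size_MXaddC; have [->|p0] := eqVneq p 0.
  rewrite rmorph0 mul0r !add0r polyC_eq0 => c0; rewrite (negbTE c0) size_poly0 /=.
  by rewrite mulr0n mul0r add0r ord_const.
move=> _ /=; have ptn0 : ev t p * t != 0 by rewrite mulf_neq0 // tt.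
have E : ord x (ev t p * t) = ord x t *+ size p.
  rewrite (dvalM (ord_dval x)) ?tt // IH // -mulrSr prednK //.
  by rewrite lt0n size_poly_eq0.
have sp0 : (0 < size p)%N by rewrite lt0n size_poly_eq0.
rewrite (dval_dom (ord_dval x) ptn0 _).2 ?E //.
by apply: vge_le (vge_const x c); rewrite -mulr_natl; nia.
Qed.

Lemma ev_pole_bound x (p : {poly k}) (m : nat) : (size p <= m.+1)%N ->
  vge (ord x) (- (m%:R * polar t x)) (ev t p).
Proof.
have [->|p0] := eqVneq p 0; first by rewrite rmorph0 vge0.
move=> pm; have [xt|xt] := ltP (ord x t) 0; last first.
  apply: vge_le (vge_ev p _); last by rewrite vgeE.
  by rewrite oppr_le0 mulr_ge0 ?polar_ge0.
rewrite vgeE ?tt // ord_ev_pole // /polar (_ : Num.max _ _ = - ord x t); last first.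
  by rewrite max_l // oppr_ge0 ltW.
by rewrite mulrN opprK -mulr_natl !natz; nia.
Qed.

Let Cd x := \sum_i polar (b i) x.

Let fCd : fsup Cd. Proof. by apply: fsup_sum => i; exact: fsup_polar. Qed.

Let Cd_ge0 x : 0 <= Cd x. Proof. by apply: sumr_ge0 => i _; exact: polar_ge0. Qed.

(** Combinations of the free family [b] with coefficients of degree at most m in t are distinct
    sections; [Cd] accounts for the poles of the [b i]. *)
Lemma h0_lower (m : nat) : (Q ^ m.+1 <= h0 (fun x => m%:R * polar t x + Cd x)%R)%N.
Proof.
have fE : fsup (fun x => m%:R * polar t x + Cd x).
  by apply: fsupD => //; apply: fsupZ; exact: fsup_polar.
rewrite /Q -expnM -card_mx.
apply: (@idx_le _ _ _ _ 'M[k]_(n, m.+1)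
  (fun c => dia C (\sum_i ev t (rVpoly (row i c)) * b i)) (@sub0_subgrp _) (h0P fE)).
  move=> c; split; last by eexists.
  apply/AD_dia => x; apply: (vge_sum (ord_dval x)) => i _.
  rewrite opprD; apply: (vgeM (ord_dval x)); first by apply: ev_pole_bound; exact: size_poly.
  have [->|b0] := eqVneq (b i) 0; first exact: vge0.
  rewrite vgeE // lerNl; apply: (@le_trans _ _ (polar (b i) x)).
    by rewrite /polar le_max lexx.
  by rewrite /Cd (bigD1 i) //= lerDl; apply: sumr_ge0 => j _; exact: polar_ge0.
move=> c c' /eqP; rewrite subr_eq0 => /eqP/dia_inj/eqP; rewrite -subr_eq0 -sumrB => /eqP E.
have cc i : rVpoly (row i c) - rVpoly (row i c') = 0.
  apply: (b_free (p := fun i => rVpoly (row i c) - rVpoly (row i c'))).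
  by rewrite -[RHS]E; apply: eq_bigr => j _; rewrite rmorphB mulrBl.
apply/row_matrixP => i; apply/(can_inj (@rVpolyK _ _))/eqP.
by rewrite -subr_eq0; apply/eqP.
Qed.

(** Every D lies below M B + div p(t), for B the polar divisor of t and suitable M and p. As rr is
    monotone and h0 ignores principal divisors, the sections of M B found in [h0_lower] suffice. *)
Lemma rr_bounded : exists rho, forall D, fsup D -> rr D <= rho.
Proof.
have fB := fsup_polar t; have Q0 : (0 < Q%:R :> rat).
  by rewrite ltr0n expn_gt0 orbC; apply/orP; right; rewrite ltnW // finNzRing_gt1.
exists (nrm Cd / Q%:R) => D0 fD0.
pose D x := Num.max (D0 x) 0; have fD : fsup D by exact: fsup_max0.
apply: (@le_trans _ _ (rr D)).
  by apply: rr_le => // x; rewrite /D le_max lexx.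
(* Adding [Cd] multiplies the number of sections by at most its norm, because rr is monotone. *)
have h0B (M : nat) : Q%:R ^+ M.+1 <= nrm Cd * (h0 (fun x => M%:R * polar t x))%:R :> rat.
  have fM : fsup (fun x => M%:R * polar t x) by apply: fsupZ.
  have := h0_lower M; rewrite -(ler_nat rat) natrX => /le_trans; apply.
  have := @rr_le _ _ fM (fsupD fM fCd) (fun x => _); rewrite /rr nrmD //.
  move=> /(_ _)/Wrap[x|]; first by rewrite lerDl.
  rewrite ler_pdivrMr ?ltr0n ?h0_gt0 //.
  rewrite -[X in X <= _]mulr1 -!mulrA ler_pM2l ?nrm_gt0 // mulrCA mulrC -mulrA.
  by rewrite mulrA ler_pdivlMr ?ltr0n ?h0_gt0 ?mul1r //; exact: fsupD.
have [s us sD] := fsup_seq fD.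
have /choice[px pxP] : forall x, exists p : {poly k}, p != 0 /\
    (vge (ord x) 0 t -> vge (ord x) 1 (ev t p)).
  move=> x; have [u u0 xu] := dval_unif (ord_dval x).
  have [p p0 pP] := alg_zero tt sp u0; exists p; split=> // xt; apply: pP => //.
  by rewrite vgeE // xu.
(* At places of D where t is regular, p(t) vanishes to order at least D x; [m] takes care of the
   places where t has a pole. *)
pose p := \prod_(x <- s) px x ^+ `|D x|; pose m := (\sum_(x <- s) `|D x|)%N.
have p0 : p != 0.
  by rewrite prodf_seq_neq0; apply/allP => x _; rewrite expf_neq0 //; case: (pxP x).
have P0 : ev t p != 0 by exact: tt.
pose e := (size p).-1; pose M := (m + e)%N.
(* The divisor of zeros of p(t): the poles of p(t) are [e] times those of t. *)
pose Z x := e%:R * polar t x + ord x (ev t p).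
have fP := fsup_ord P0.
have feB : fsup (fun x => e%:R * polar t x) by apply: fsupZ.
have fmB : fsup (fun x => m%:R * polar t x) by apply: fsupZ.
have fZ : fsup Z by exact: fsupD.
have Zpole x : ord x t < 0 -> Z x = 0.
  move=> xt; rewrite /Z ord_ev_pole // /polar max_l; last by rewrite oppr_ge0 ltW.
  by rewrite mulrN mulr_natl addNr.
have Znp x : 0 <= ord x t -> Z x = ord x (ev t p).
  by move=> xt; rewrite /Z /polar max_r ?mulr0 ?add0r // oppr_le0.
have Pnp x : 0 <= ord x t -> 0 <= ord x (ev t p).
  by move=> xt; rewrite -vgeE //; apply: vge_ev; rewrite vgeE.
have Z0 x : 0 <= Z x.
  by have [xt|xt] := ltP (ord x t) 0; [rewrite Zpole|rewrite Znp // Pnp].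
have DZ x : D x <= m%:R * polar t x + Z x.
  have [xs|/sD ->] := boolP (x \in s); last first.
    by rewrite addr_ge0 // mulr_ge0 ?polar_ge0.
  have [xt|xt] := ltP (ord x t) 0.
    rewrite Zpole // addr0; have : (`|D x|%N <= m)%N by rewrite /m (bigD1_seq x) //= leq_addr.
    rewrite /polar max_l; last by rewrite oppr_ge0 ltW.
    by move: xt; move: (D x) (ord x t) (m : nat) => d o m1; rewrite natz; nia.
  rewrite Znp //; apply: (@le_trans _ _ (ord x (ev t p))); last first.
    by rewrite lerDr mulr_ge0 ?polar_ge0.
  have xt' : vge (ord x) 0 t by rewrite vgeE.
  rewrite -vgeE // /p (bigD1_seq x) //= rmorphM rmorphXn /= mulrC.
  apply: (vgeM0 (ord_dval x)); first exact: vge_ev.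
  have [q0 /(_ xt') q1] := pxP x; move: q1; rewrite !vgeE ?expf_neq0 ?tt //.
  by rewrite (dvalX (ord_dval x)) // ?tt // -mulr_natl natz; nia.
have nZ : nrm Z <= Q%:R ^+ e.
  rewrite -natrX; apply: (zero_divisor_bound (growth_t tt sp) P0) => // x Zx.
  have xt : 0 <= ord x t by rewrite leNgt; apply: contraTN Zx => /Zpole ->; rewrite ltxx.
  by rewrite vgeE // xt Znp.
have nB : nrm (polar t) <= Q%:R.
  have -> : Q%:R = ((#|k| ^ n) ^ (size ('X : {poly k})).-1)%N%:R :> rat.
    by rewrite size_polyX expn1.
  apply: (@zero_divisor_bound n t^-1 'X); rewrite ?evX ?invr_neq0 //.
  - by apply: growth_inv => //; exact: growth_t.
  - exact: polar_ge0.
  move=> x; rewrite /polar vgeE ?invr_neq0 // (dvalV (ord_dval x)) //.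
  by rewrite lt_max ltxx orbF => xt; have xt' := ltW xt; rewrite max_l.
pose Dv x := M%:R * polar t x + ord x (ev t p).
have DvE x : Dv x = m%:R * polar t x + Z x.
  by rewrite /Dv /Z /M natrD mulrDl addrA.
have fDv : fsup Dv by apply: fsupD => //; exact: fsupZ.
apply: (@le_trans _ _ (rr Dv)); first by apply: rr_le => // x; rewrite DvE.
rewrite /rr {2}/Dv h0_mul //; last exact: fsupZ.
have hM0 : 0 < (h0 (fun x => M%:R * polar t x))%:R :> rat.
  by rewrite ltr0n h0_gt0 //; exact: fsupZ.
rewrite ler_pdivrMr // mulrAC ler_pdivlMr //.
apply: le_trans (h0B M); rewrite exprSr ler_pM2r //.
have -> : nrm Dv = nrm (polar t) ^+ m * nrm Z.
  by rewrite -nrmMn // -nrmD //; congr nrm; apply/funext => x; rewrite DvE.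
rewrite exprD ler_pM //; first by rewrite exprn_ge0 // ltW // nrm_gt0.
- by rewrite ltW // nrm_gt0.
by rewrite lerXn2r // ?nnegrE ltW ?nrm_gt0.
Qed.

End Bound.

(** By [rr_bounded] the index of A(0) + F in A(D) + F is bounded. Once it is maximal, enlarging D no
    longer changes A(D) + F, and every adele lies in some larger A(E). *)
Lemma strong_approx : exists D0, [/\ fsup D0, forall x, 0 <= D0 x
  & forall D, fsup D -> (forall x, D0 x <= D x) -> sumset (AD (C := C) D) GF = setT].
Proof.
have [t [n [b [tt sp bf]]]] := basis_over X.
have [rho rhoP] := rr_bounded tt sp bf.
have r0 := rr_gt0 (fsup0 X).
have gS D := subgrp_sumset (AD_sub C D) GF_sub.
pose P m := `[< exists D, [/\ fsup D, forall x, 0 <= D x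
  & idx (sumset (AD (C := C) D) GF) (sumset (AD (C := C) (fun=> 0)) GF) m] >].
have exP : exists m, P m.
  exists 1%N; apply/asboolP; exists (fun=> 0); split=> //; first exact: fsup0.
  exact: idxxx.
have rho0 : 0 <= rho / rr (fun=> 0).
  by rewrite divr_ge0 ?(ltW r0) //; apply: le_trans (rhoP _ (fsup0 X)); exact: ltW.
have PB m : P m -> (m <= Num.bound (rho / rr (fun=> 0)))%N.
  move=> /asboolP[D [fD D0 Im]]; have [m' Im' E] := rr_step (fsup0 X) fD D0.
  have := rhoP D fD; rewrite E -(idx_uniq (gS _) Im Im') mulrC -ler_pdivlMr // => H.
  by rewrite ltnW // -(ltr_nat rat); apply: le_lt_trans H (archi_boundP rho0).
have [m /asboolP[D0 [fD0 D00 Im]] mmax] := ex_maxnP exP PB.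
have m0 : (0 < m)%N by apply: idx_gt0 Im; exact: (gS _).1.
have sub D E : (forall x, D x <= E x) ->
    sumset (AD (C := C) D) GF `<=` sumset (AD (C := C) E) GF.
  by move=> DE v [a aD aG]; exists a => //; exact: AD_le aD.
have stab D : fsup D -> (forall x, D0 x <= D x) ->
    sumset (AD (C := C) D) GF `<=` sumset (AD (C := C) D0) GF.
  move=> fD DD; have [b' Ib _] := rr_step fD0 fD DD.
  have : P (b' * m)%N.
    apply/asboolP; exists D; split=> // [x|]; first exact: le_trans (DD x).
    by apply: idx_trans Ib Im => //; exact: sub.
  move/mmax => le; have b1 : (b' <= 1)%N by nia.
  have b'0 : (0 < b')%N by apply: idx_gt0 Ib; exact: (gS _).1.
  have b'1 : b' = 1%N by lia.
  by apply: (idx1 (gS _)); [rewrite -b'1|exact: sub].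
exists D0; split=> // D fD DD; apply/seteqP; split=> // a _.
apply: (sub _ _ DD).
pose E x := Num.max (D0 x) (Num.max (- @cval _ _ _ (C x) (a x)) 0 ).
have D0E x : D0 x <= E x by rewrite /E le_max lexx.
have fE : fsup E.
  apply: sub_finite_set (_ : _ `<=` [set x | D0 x != 0] `|`
    [set x | ~~ vge (@cval _ _ _ (C x)) 0 (a x)]) _; last first.
    by rewrite finite_setU; split; [exact: fD0|exact: acomp_int].
  move=> x /=; have [Dx|] := eqVneq (D0 x) 0; last by left.
  rewrite /E Dx => Ex; right; apply: contraNN Ex; rewrite /vge => /orP[/eqP ->|ax].
    by rewrite (dval0 (cval_dval (C x))) oppr0 !maxxx.
  by rewrite !max_r // ?oppr_le0 // le_max lexx orbT.
apply: (stab E fE D0E); apply: sub_sumsetl; first exact: GF_sub.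
move=> x; rewrite /vge /E; apply/orP; right; rewrite lerNl !le_max lexx.
by rewrite orbT.
Qed.

(* h1 D = #|H^1(X, O(D))| *)
Lemma riemann_roch : exists kap : rat, 0 < kap /\ forall D, fsup D ->
  exists2 h1, idx setT (sumset (AD (C := C) D) GF) h1 & nrm D * h1%:R = kap * (h0 D)%:R.
Proof.
have [D0 [fD0 D00 DT]] := strong_approx.
(* The constant is the value of rr beyond D0, where H^1 is trivial: q^(g-1) in terms of the genus.
   Both D and D0 are compared with their maximum E. *)
exists (rr D0); split=> [|D fD]; first exact: rr_gt0.
pose E x := Num.max (D0 x) (D x).
have fE : fsup E by apply: (@fsup2 _ _ Num.max); rewrite ?maxxx.
have D0E x : D0 x <= E x by rewrite /E le_max lexx.
have DE x : D x <= E x by rewrite /E le_max lexx orbT.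
have [b Ib rb] := rr_step fD fE DE; have [b' Ib' rb'] := rr_step fD0 fE D0E.
exists b; first by rewrite -(DT E).
have b1 : b' = 1%N.
  have gS := subgrp_sumset (AD_sub C D0) GF_sub.
  apply: (idx_uniq gS Ib').
  by rewrite (DT E) // (DT D0) //; apply: idxxx; split.
have : rr D * b%:R = rr D0 by rewrite -rb rb' b1 mulr1.
by move=> <-; rewrite /rr mulrAC divfK // h0_neq0.
Qed.

(** Choose E with E and E + div f both above D0. There rr is constant, and h0 agrees by [h0_mul], so
    the norms agree. *)
Lemma nrm_principal (f : X) : f != 0 -> nrm (fun x => ord x f) = 1.
Proof.
move=> f0; have ff := fsup_ord f0; have [D0 [fD0 D00 DT]] := strong_approx.
pose E x := Num.max (D0 x) (D0 x - ord x f).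
have fE : fsup E by apply: (@fsup2 _ _ (fun a b => Num.max a (a - b))).
have D0E x : D0 x <= E x by rewrite /E le_max lexx.
have fE' : fsup (fun x => E x + ord x f) by exact: fsupD.
have D0E' x : D0 x <= E x + ord x f by rewrite -lerBlDr /E le_max lexx orbT.
have const F : fsup F -> (forall x, D0 x <= F x) -> rr F = rr D0.
  move=> fF DF; have [b Ib ->] := rr_step fD0 fF DF.
  have gS := subgrp_sumset (AD_sub C D0) GF_sub.
  have -> : b = 1%N; last by rewrite mulr1.
  apply: (idx_uniq gS Ib).
  by rewrite (DT F) // (DT D0) //; apply: idxxx; split.
have := const _ fE' D0E'; rewrite -(const _ fE D0E) /rr h0_mul // nrmD //.
move/(mulIf (invr_neq0 (h0_neq0 fE))) => H; apply: (mulfI (nrm_neq0 E)).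
by rewrite mulr1.
Qed.

(** Since h1 is at least 1, Riemann-Roch gives h0 D > 1 as soon as nrm D exceeds kappa. *)
Lemma large_effective : exists B : rat, 0 < B /\ forall D, fsup D -> B < nrm D ->
  exists2 f : X, f != 0 & forall x, 0 <= D x + ord x f.
Proof.
have [kap [kap0 kapP]] := riemann_roch; exists kap; split=> // D fD lt.
have [h1 Ih1 E] := kapP D fD.
have h1_gt0 : (0 < h1)%N by apply: idx_gt0 Ih1.
have h2 : (1 < h0 D)%N.
  rewrite -(ltr_nat rat) -(ltr_pM2l kap0) -E mulr1; apply: lt_le_trans lt _.
  by rewrite ler_peMr ?ler1n // ltW // nrm_gt0.
have [T [r [cT rD rP]]] := h0P fD.
have [i ri] : exists i, r i <> 0.
  apply: contrapT => nex; move: h2; rewrite -cT => /card_gt1P[i [j [_ _ /eqP ij]]].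
  have z l : r l = 0 by apply: contrapT => rl; apply: nex; exists l.
  apply: ij; apply: (idx_sep (@sub0_subgrp _) rD rP).
  by rewrite !z subrr.
have [aD [f _ fE]] := rD i; have f0 : f != 0.
  by apply/eqP => f0; apply: ri; rewrite -fE f0 rmorph0.
exists f => // x; move: aD; rewrite -fE => /AD_dia/(_ x); rewrite vgeE //; lia.
Qed.

(** If D - D0 has large degree, then D + div f >= D0 for some f, and multiplication by f carries A(D
    + div f) + F = A to A(D) + F. *)
Lemma large_approx : exists B : rat, 0 < B /\ forall D, fsup D -> B < nrm D ->
  sumset (AD (C := C) D) GF = setT.
Proof.
have [D0 [fD0 D00 DT]] := strong_approx; have [B [B0 BP]] := large_effective.
exists (B * nrm D0); split=> [|D fD lt]; first by rewrite mulr_gt0 // nrm_gt0.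
have fDD : fsup (fun x => D x - D0 x) by exact: fsupB.
have [|f f0 fP] := BP _ fDD; first by rewrite nrmB // ltr_pdivlMr // nrm_gt0.
have ff := fsup_ord f0.
have DF : sumset (AD (C := C) (fun x => D x + ord x f)) GF = setT.
  by apply: DT => [|x]; [exact: fsupD|have := fP x; lia].
apply/seteqP; split=> // a _.
have : setT (dia C f^-1 * a) by [].
rewrite -DF => -[c cD [g _ gE]]; exists (dia C f * c); last first.
  exists (f * g) => //; by rewrite rmorphM /= gE mulrBr mulrA -rmorphM divff // rmorph1 mul1r.
move=> x; have -> : - D x = - (D x + ord x f) + @cval _ _ _ (C x) (emb (C x) f).
  by rewrite cval_emb; ring.
by rewrite /= (vge_mul (cval_dval (C x))) ?fmorph_eq0.
Qed.

End Riemann.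

Lemma ord2P (i : 'I_2) : i = 0 \/ i = 1.
Proof.
case: i => [[|[|//]] iP]; first by left; apply: val_inj.
by right; apply: val_inj.
Qed.

Lemma forall_ord2 (P : 'I_2 -> Prop) : P 0 -> P 1 -> forall i, P i.
Proof. by move=> P0 P1 i; case: (ord2P i) => ->. Qed.

Lemma sum2 (V : nmodType) (F : 'I_2 -> V) : \sum_i F i = F 0 + F 1.
Proof.
by rewrite big_ord_recl big_ord_recl big_ord0 addr0; congr (F _ + F _); apply: val_inj.
Qed.

(** * Double cosets of PGL_2 *)

Section Matrix2.
Variable R : comPzRingType.
Implicit Types a b c d : R.

Definition mx2 a b c d : 'M[R]_2 :=
  \matrix_(i, j) if i == 0 then (if j == 0 then a else b) else (if j == 0 then c else d).

Lemma mx2E (A : 'M[R]_2) : A = mx2 (A 0 0) (A 0 1) (A 1 0) (A 1 1).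
Proof.
by apply/matrixP; apply: forall_ord2; apply: forall_ord2; rewrite mxE.
Qed.

Lemma mx2M a b c d a' b' c' d' : mx2 a b c d *m mx2 a' b' c' d' =
  mx2 (a * a' + b * c') (a * b' + b * d') (c * a' + d * c') (c * b' + d * d').
Proof.
by apply/matrixP; apply: forall_ord2; apply: forall_ord2; rewrite !mxE sum2 !mxE.
Qed.

Lemma mx2_1 a : a%:M = mx2 a 0 0 a.
Proof. by apply/matrixP; apply: forall_ord2; apply: forall_ord2; rewrite !mxE. Qed.

Lemma det2 (A : 'M[R]_2) : \det A = A 0 0 * A 1 1 - A 0 1 * A 1 0.
Proof.
rewrite (expand_det_row _ 0) sum2 /cofactor !det_mx11 !mxE /=.
rewrite expr0 expr1 mul1r mulN1r mulrN.
by congr (_ * A _ _ - _ * A _ _); apply: val_inj.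
Qed.

Lemma mx2_col (A : 'M[R]_2) (v : 'cV[R]_2) i : (A *m v) i 0 = A i 0 * v 0 0 + A i 1 * v 1 0.
Proof. by rewrite mxE sum2. Qed.

Section Upper.
Variables (a a' b d d' : R).
Hypotheses (aa : a * a' = 1) (dd : d * d' = 1).

Fact upperK : mx2 a b 0 d *m mx2 a' (- (a' * b * d')) 0 d' = 1%:M.
Proof. by rewrite mx2M mx2_1 !mul0r !mulr0 !addr0 !add0r aa dd mulrN !mulrA aa mul1r addNr. Qed.
Fact upperK' : mx2 a' (- (a' * b * d')) 0 d' *m mx2 a b 0 d = 1%:M.
Proof.
rewrite mx2M mx2_1 !mul0r !mulr0 !addr0 !add0r [a' * a]mulrC aa [d' * d]mulrC dd.
by rewrite mulNr -(mulrA (a' * b)) (mulrC d') dd mulr1 subrr.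
Qed.
Definition upper : GL2 R := MkGL2 upperK upperK'.
End Upper.

End Matrix2.

(** * Ideles, integral matrices and sections in rank 2 *)

Section Adelic.
Variables (k : finFieldType) (X : curve k).
Variable C : forall x : place X, completion x.
Local Notation A := (adele C).
Local Notation vx x := (cval_dval (C x)).
Local Notation cv x := (@cval _ _ _ (C x)).
Implicit Types (x : place X) (D E : place X -> int) (a b c d : A) (g h w : GL2 A).

Lemma aintP a : adele_int a <-> AD (fun=> 0) a.
Proof. by split=> aD x; have := aD x; rewrite oppr0. Qed.

Lemma aint_sub : subgrp (@adele_int _ _ C).
Proof.
have -> : @adele_int _ _ C = AD (fun=> 0) by apply/seteqP; split=> a /aintP.
exact: AD_sub.
Qed.

Lemma aint0 : adele_int (0 : A). Proof. exact: aint_sub.1. Qed.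
Lemma aint1 : adele_int (1 : A). Proof. by move=> x; exact: (vge1 (vx x)). Qed.
Lemma aintD a b : adele_int a -> adele_int b -> adele_int (a + b).
Proof. exact: subgrpD aint_sub. Qed.
Lemma aintB a b : adele_int a -> adele_int b -> adele_int (a - b).
Proof. exact: aint_sub.2. Qed.
Lemma aintM a b : adele_int a -> adele_int b -> adele_int (a * b).
Proof. by move=> ai bi x; apply: (vgeM0 (vx x)). Qed.

Definition iord a x : int := cv x (a x).

Lemma unit_neq0 a b x : a * b = 1 -> a x != 0.
Proof.
move=> /(congr1 (fun c : A => c x)) /= abx; apply/eqP => a0; move: abx.
by rewrite a0 mul0r => /esym/eqP; rewrite oner_eq0.
Qed.

Lemma unit_neq0' a b x : a * b = 1 -> b x != 0.
Proof. by rewrite mulrC; exact: unit_neq0. Qed.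

Lemma iordM a a' b b' x : a * a' = 1 -> b * b' = 1 ->
  iord (a * b) x = iord a x + iord b x.
Proof. by move=> aa bb; rewrite /iord /= (dvalM (vx x)) ?(unit_neq0 _ aa) ?(unit_neq0 _ bb). Qed.

Lemma iord1 x : iord 1 x = 0. Proof. exact: (dval1 (vx x)). Qed.

Lemma iordV a b x : a * b = 1 -> iord b x = - iord a x.
Proof.
move=> ab; have := iordM x ab (_ : b * a = 1); rewrite ab iord1 mulrC => /(_ ab).
by move/eqP; rewrite eq_sym addrC addr_eq0 => /eqP.
Qed.

Lemma fsup_iord a b : a * b = 1 -> fsup (iord a).
Proof.
move=> ab; apply: sub_finite_set (_ : _ `<=` [set x | ~~ vge (cv x) 0 (a x)] `|`
  [set x | ~~ vge (cv x) 0 (b x)]) _; last first.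
  by rewrite finite_setU; split; exact: acomp_int.
move=> x /=; have bE := iordV x ab; move: bE; rewrite /iord => bE.
rewrite !vgeE ?(unit_neq0 _ ab) ?(unit_neq0' _ ab) // bE => a0.
by move: a0; rewrite neq_lt => /orP[]; [left|right]; lia.
Qed.

Lemma AD_iord D a b c : a * b = 1 -> AD D (a * c) <-> AD (fun x => D x + iord a x) c.
Proof.
move=> ab; split=> cD x; have := cD x.
  by rewrite /= -[in X in X -> _](subrK (iord a x) (- D x)) (vge_mul (vx x)) ?(unit_neq0 _ ab)
    // -opprD.
by rewrite -(vge_mul (vx x) _ _ (unit_neq0 x ab)) opprD subrK.
Qed.

Lemma unit_int a b : a * b = 1 -> (forall x, iord a x = 0) -> adele_int a /\ adele_int b.
Proof.
move=> ab a0; split=> x; rewrite vgeE ?(unit_neq0 _ ab) ?(unit_neq0' _ ab) //.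
  by have := a0 x; rewrite /iord => ->.
by have := iordV x ab; rewrite a0 oppr0 /iord => ->.
Qed.

Section MkInt.
Variable f : forall x, C x.
Hypothesis f_int : forall x, vge (cv x) 0 (f x).
Fact mkint_fin : finite_set [set x | ~~ vge (cv x) 0 (f x)].
Proof. by apply: sub_finite_set (_ : _ `<=` set0) _ => // x /=; rewrite f_int. Qed.
Definition mkint : A := Adele mkint_fin.
End MkInt.

Fact ex_unif x : exists u : X, u != 0 /\ ord x u = 1.
Proof. by have [u u0 xu] := dval_unif (ord_dval x); exists u. Qed.
Definition unif x : X := sval (cid (ex_unif x)).
Lemma unif_neq0 x : unif x != 0. Proof. by rewrite /unif; case: cid => u []. Qed.
Lemma ord_unif x : ord x (unif x) = 1. Proof. by rewrite /unif; case: cid => u []. Qed.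

Fact pow_fin D : fsup D -> finite_set [set x | ~~ vge (ord x) 0 (unif x ^ D x)].
Proof.
move=> fD; apply: sub_finite_set (_ : _ `<=` [set x | D x != 0]) fD => x /=.
by apply: contraNneq => ->; rewrite expr0z (vge1 (ord_dval x)).
Qed.

(** An idele with divisor D. The default value 1 makes [powV] true for every D, so that it can serve
    as an argument in the construction of invertible matrices. *)
Definition pow D : A :=
  if pselect (fsup D) is left fD then famA C (pow_fin fD) else 1.

Lemma powE D x : fsup D -> pow D x = emb (C x) (unif x ^ D x).
Proof. by rewrite /pow; case: pselect. Qed.

Lemma powV D : pow D * pow (fun x => - D x) = 1.
Proof.
have [fD|nD] := pselect (fsup D); last first.
  rewrite /pow; case: pselect => // _; case: pselect => [fN|_]; last exact: mulr1.
  by case: nD; have := fsupN fN; under eq_fun do rewrite opprK.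
apply: adeleP => x /=; rewrite !powE //; last exact: fsupN.
by rewrite -rmorphM -expfzDr ?unif_neq0 // subrr expr0z rmorph1.
Qed.

Lemma iord_pow D x : fsup D -> iord (pow D) x = D x.
Proof.
move=> fD; rewrite /iord powE // cval_emb (dvalXz (ord_dval x)) ?unif_neq0 //.
by rewrite ord_unif mul1r.
Qed.

Lemma iord_dia (f : X) x : iord (dia C f) x = ord x f.
Proof. exact: cval_emb. Qed.

Lemma diaV (f : X) : f != 0 -> dia C f * dia C f^-1 = 1.
Proof. by move=> f0; rewrite -rmorphM divff // rmorph1. Qed.

Definition kO : set (GL2 A) :=
  [set g : GL2 A | forall i j, adele_int (g i j) /\ adele_int (ginv g i j)].

Lemma kO1 : kO 1%g.
Proof.
by move=> i j; rewrite /= !mxE; split; case: (i == j); (exact: aint1 || exact: aint0).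
Qed.

Lemma kOM g h : kO g -> kO h -> kO (g * h)%g.
Proof.
move=> gK hK i j; rewrite /= !mxE !sum2.
by split; apply: aintD; apply: aintM; (exact: (gK _ _).1 || exact: (hK _ _).1 ||
  exact: (gK _ _).2 || exact: (hK _ _).2).
Qed.

Lemma kOV g : kO g -> kO g^-1%g.
Proof. by move=> gK i j; have [] := gK i j. Qed.

Lemma det_gmxK g : \det g * \det (ginv g) = 1.
Proof. by rewrite -det_mulmx gmxK det1. Qed.

Definition dord g := iord (\det g).

Lemma dordM g h x : dord (g * h)%g x = dord g x + dord h x.
Proof. by rewrite /dord /= det_mulmx (iordM x (det_gmxK g) (det_gmxK h)). Qed.

Lemma fsup_dord g : fsup (dord g). Proof. exact: fsup_iord (det_gmxK g). Qed.

Lemma dord_inv g x : dord g^-1%g x = - dord g x.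
Proof. exact: iordV (det_gmxK g). Qed.

Definition mxint (m : 'M[A]_2) := forall i j, adele_int (m i j).

Lemma integralM (m n : 'M[A]_2) : mxint m -> mxint n -> mxint (m *m n).
Proof. by move=> mi ni i j; rewrite mxE sum2; apply: aintD; exact: aintM. Qed.

Lemma integral_det (m : 'M[A]_2) : mxint m -> adele_int (\det m).
Proof. by move=> mi; rewrite det2; apply: aintB; exact: aintM. Qed.

Lemma dord_ge0 g x : mxint g -> 0 <= dord g x.
Proof.
by move=> /integral_det/(_ x); rewrite vgeE // (unit_neq0 _ (det_gmxK g)).
Qed.

Lemma kO_dord g x : kO g -> dord g x = 0.
Proof.
move=> gK; apply/eqP; rewrite eq_le; apply/andP; split; last first.
  by apply: dord_ge0 => i j; have [] := gK i j.
by rewrite -oppr_ge0 -dord_inv; apply: dord_ge0 => i j; have [] := kOV gK i j.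
Qed.

Definition mint x m n (M : 'M[A]_(m, n)) := forall i j, vge (cv x) 0 (M i j x).

(** Cramer's rule: the adjugate is integral and the determinant is a unit at x. *)
Lemma mint_ginv x g : mint x g -> dord g x = 0 -> mint x (ginv g).
Proof.
move=> gi g0.
have di : vge (cv x) 0 (\det (ginv g) x).
  have := iordV x (det_gmxK g); rewrite -[iord (\det g) x]/(dord g x) g0 oppr0 /vge /iord => ->.
  by rewrite lexx orbT.
have gV : ginv g = \det (ginv g) *: \adj g.
  rewrite -[\adj g]mul1mx -(ginvK g) -mulmxA mul_mx_adj mul_mx_scalar scalerA.
  by rewrite mulrC det_gmxK scale1r.
move=> i j; rewrite gV mxE; apply: (vgeM0 (vx x)) => //; rewrite mxE /cofactor.
apply: (vgeM0 (vx x)); last by rewrite det_mx11 !mxE; exact: gi.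
by case: (ord2P i) => ->; case: (ord2P j) => -> /=;
  rewrite ?expr0 ?expr1 ?expr2 ?mulN1r ?opprK ?(vgeN (vx x)); exact: (vge1 (vx x)).
Qed.

Lemma integral_kO g : mxint g -> (forall x, dord g x = 0) -> kO g.
Proof.
move=> gi g0 i j; split; first exact: gi.
by move=> x; apply: mint_ginv => // r l; exact: gi.
Qed.

(** At each place the entry in the corner of the lower row (u, v) is cleared by an integral column
    operation, with multiplier u/v or v/u, whichever is integral; in the second case the columns are
    exchanged too. *)
Lemma iwasawa g : exists2 q, kO q & (g * q)%g 1 0 = 0.
Proof.
pose u := g 1 0; pose v := g 1 1.
have uv x : (u x == 0) && (v x == 0) = false.
  apply/negP => /andP[/eqP u0 /eqP v0].
  have /matrixP/(_ 1 1) := gmxK g; rewrite !mxE sum2 => /(congr1 (fun c : A => c x)) /=.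
  by rewrite -/u -/v u0 v0 !mul0r addr0 => /esym/eqP; rewrite oner_eq0.
pose P x := (v x != 0) && vge (cv x) 0 (u x / v x).
pose c x : C x := if P x then u x / v x else v x / u x.
have ci x : vge (cv x) 0 (c x).
  rewrite /c; case: ifP => [/andP[]//|].
  rewrite /P; have [-> _|v0 /= uvx] := eqVneq (v x) 0; first by rewrite mul0r vge0.
  have u0 : u x != 0 by apply: contraFneq uvx => ->; rewrite mul0r vge0.
  move: uvx; rewrite !vgeE ?mulf_neq0 ?invr_neq0 // !(dvalM (vx x)) ?invr_neq0 //.
  rewrite !(dvalV (vx x)) //; lia.
have i1 x : vge (cv x) 0 (1 : C x) by exact: (vge1 (vx x)).
have i0 x : vge (cv x) 0 (0 : C x) by exact: vge0.
have mk (f1 f2 : forall x, C x) : (forall x, vge (cv x) 0 (f1 x)) ->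
    (forall x, vge (cv x) 0 (f2 x)) -> forall x, vge (cv x) 0 (if P x then f1 x else f2 x).
  by move=> h1 h2 x; case: ifP.
have ciN x : vge (cv x) 0 (- c x) by rewrite (vgeN (vx x)).
pose a00 := mkint (mk _ _ i1 ciN); pose a01 := mkint (mk _ _ i0 i1).
pose a10 := mkint (mk _ _ ciN i1); pose a11 := mkint (mk _ _ i1 i0).
pose b00 := mkint (mk _ _ i1 i0); pose b01 := mkint (mk _ _ i0 i1).
pose b10 := mkint (mk _ _ ci i1); pose b11 := mkint (mk _ _ i1 ci).
have E1 : mx2 a00 a01 a10 a11 *m mx2 b00 b01 b10 b11 = 1%:M.
  by rewrite mx2M mx2_1; congr mx2; apply: adeleP => x /=; case: (P x); ring.
have E2 : mx2 b00 b01 b10 b11 *m mx2 a00 a01 a10 a11 = 1%:M.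
  by rewrite mx2M mx2_1; congr mx2; apply: adeleP => x /=; case: (P x); ring.
exists (MkGL2 E1 E2).
  by apply: forall_ord2; apply: forall_ord2; rewrite !mxE; split=> x /=; case: (P x).
rewrite /= mxE sum2 !mxE; apply: adeleP => x /=; rewrite -/u -/v /c.
case PE: (P x); first by case/andP: PE => v0 _; field.
have u0 : u x != 0.
  by apply: contraFneq PE => u0; rewrite /P u0 mul0r vge0 andbT; have := uv x;
    rewrite u0 eqxx /= => ->.
by field.
Qed.

Lemma upper_form g : g 1 0 = 0 -> exists a a' b d d' (aa : a * a' = 1) (dd : d * d' = 1),
  g = upper b aa dd.
Proof.
move=> g0.
have /matrixP/(_ 1 1) := gmxK g; rewrite !mxE sum2 g0 mul0r add0r => dd.
have /matrixP/(_ 0 0) := ginvK g; rewrite !mxE sum2 g0 mulr0 addr0 mulrC => aa.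
exists (g 0 0), (ginv g 0 0), (g 0 1), (g 1 1), (ginv g 1 1), aa, dd.
by apply: GL2P; rewrite /= [LHS]mx2E g0.
Qed.

Lemma dord_upper a a' b d d' (aa : a * a' = 1) (dd : d * d' = 1) x :
  dord (upper b aa dd) x = iord a x + iord d x.
Proof.
rewrite /dord det2 !mxE /= mulr0 subr0; exact: (iordM x aa dd).
Qed.

Definition diaG (m : 'M[X]_2) (mu : m \in unitmx) : GL2 A.
Proof.
exists (map_mx (dia C) m) (map_mx (dia C) (invmx m)); rewrite -map_mxM.
  by rewrite mulmxV // map_mx1.
by rewrite mulVmx // map_mx1.
Defined.

Lemma dord_diaG (m : 'M[X]_2) (mu : m \in unitmx) x :
  dord (diaG mu) x = ord x (\det m).
Proof. by rewrite /dord /= det_map_mx iord_dia. Qed.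

Lemma flag (v : 'cV[X]_2) : v != 0 -> exists2 m : 'M[X]_2, m \in unitmx & col 0 m = v.
Proof.
move=> v0; have [v00|v00] := eqVneq (v 0 0) 0.
  exists (mx2 0 1 (v 1 0) 0).
    rewrite unitmxE unitfE det2 !mxE /= mul0r sub0r mul1r oppr_eq0.
    apply: contraNneq v0 => v10; apply/eqP/matrixP => i j; rewrite ord1 mxE.
    by case: (ord2P i) => ->.
  apply/matrixP => i j; rewrite ord1 !mxE /=.
  by case: (ord2P i) => -> /=; rewrite ?v00.
exists (mx2 (v 0 0) 0 (v 1 0) 1).
  by rewrite unitmxE unitfE det2 !mxE /= mulr1 mul0r subr0.
by apply/matrixP => i j; rewrite ord1 !mxE /=; case: (ord2P i) => ->.
Qed.

(** The norm of det g is q to minus the degree of the bundle of g, which its triangular form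
    presents as an extension of O(Dd) by O(Da). If O(Da) has no nonzero section, H^1(Da) has kappa /
    nrm Da elements. This is less than the number of sections of O(Dd) when nrm Da nrm Dd > kappa^2,
    so the connecting map takes the same value on two of them, and their difference lifts. *)
Lemma rank2_section : exists B : rat, 0 < B /\ forall g, nrm (dord g) < B ->
  exists2 v : 'cV[X]_2, v != 0 &
    forall i, adele_int ((ginv g *m map_mx (dia C) v) i 0).
Proof.
have [kap [kap0 kapP]] := riemann_roch C.
exists (kap ^- 2); split=> [|g gB]; first by rewrite invr_gt0 exprn_gt0.
have [q qK gq0] := iwasawa g.
have [a [a' [b [d [d' [aa [dd gqE]]]]]]] := upper_form gq0.
suff [f1 [f2 [f12 f2D f1D]]] : exists f1 f2 : X, [/\ (f1 != 0) || (f2 != 0),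
    adele_int (d' * dia C f2) & adele_int (a' * (dia C f1 - b * d' * dia C f2))].
  exists (\col_i if i == 0 then f1 else f2).
    apply: contraTneq f12 => /matrixP v0; have := v0 0 0; have := v0 1 0.
    by rewrite !mxE /= => -> ->; rewrite eqxx.
  have -> : ginv g = q *m ginv (g * q)%g by rewrite /= mulmxA gmxK mul1mx.
  rewrite gqE -mulmxA => i; rewrite mx2_col !mx2_col !mxE /=.
  have -> : a' * dia C f1 + - (a' * b * d') * dia C f2 =
     a' * (dia C f1 - b * d' * dia C f2) by ring.
  rewrite mul0r add0r.
  by apply: aintD; apply: aintM => //; have [] := qK i 0; have [] := qK i 1.
have fa := fsup_iord aa; have fd := fsup_iord dd.
pose Da x := - iord a x; pose Dd x := - iord d x.
have fDa : fsup Da by exact: fsupN.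
have fDd : fsup Dd by exact: fsupN.
have [h1 Ih1 h1E] := kapP Da fDa.
have inA c : AD Da c -> adele_int (a' * c).
  move=> cD; apply/aintP/(@AD_iord _ a' a); first by rewrite mulrC.
  by move=> x; have := cD x; rewrite /Da (iordV x aa) add0r.
have inD c : AD Dd c -> adele_int (d' * c).
  move=> cD; apply/aintP/(@AD_iord _ d' d); first by rewrite mulrC.
  by move=> x; have := cD x; rewrite /Dd (iordV x dd) add0r.
have [h0a1|h0a1] := ltnP 1 (h0 C Da).
  have [T [r [cT rD rP]]] := h0P C fDa.
  move: h0a1; rewrite -cT => /card_gt1P[i [j [_ _ ij]]].
  have [aD [f _ fE]] := (H0_sub C Da).2 _ _ (rD i) (rD j).
  exists f, 0; split.
  - rewrite orbC eqxx /=; apply: contraNneq ij => f0; apply/eqP.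
    by apply: (idx_sep (@sub0_subgrp _) rD rP); rewrite /= -fE f0 rmorph0.
  - by rewrite rmorph0 mulr0; exact: aint0.
  by rewrite rmorph0 mulr0 subr0; apply: inA; rewrite fE.
have h0a : (h0 C Da)%:R = 1 :> rat.
  by apply/eqP; rewrite pnatr_eq1 eqn_leq h0a1 h0_gt0.
rewrite h0a mulr1 in h1E.
have [hd Ihd hdE] := kapP Dd fDd.
have hd0 : (0 < hd)%N by apply: idx_gt0 Ihd.
have lt : (h1 < h0 C Dd)%N.
  rewrite -(ltr_nat rat) -(ltr_pM2l kap0) -hdE.
  apply: lt_le_trans (_ : nrm Dd * 1 <= _); last first.
    by rewrite ler_wpM2l ?ler1n // ltW ?nrm_gt0.
  rewrite mulr1 -(ltr_pM2l (nrm_gt0 Da)) mulrCA h1E.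
  have -> : nrm Da * nrm Dd = (nrm (dord g))^-1.
    rewrite -nrmD // -nrmN; last exact: fsup_dord.
    congr nrm; apply/funext => x; rewrite /Da /Dd -opprD -(dord_upper b aa dd).
    by rewrite -gqE dordM (kO_dord _ qK) addr0.
  by rewrite -expr2 -[X in X < _]invrK ltf_pV2 // posrE ?nrm_gt0 // invr_gt0 exprn_gt0.
have [T [r [cT rD rP]]] := h0P C fDd.
have [i [j [ij ijD]]] : exists i j : T, i != j /\
    sumset (AD (C := C) Da) (GF (C := C)) (b * d' * (r i - r j)).
  apply: contrapT => nex; move: lt; rewrite -cT ltnNge => /negP; apply.
  apply: (@idx_le _ setT (sumset (AD (C := C) Da) (GF (C :=
    C))) _ T (fun i => b * d' * r i)) => //.
    exact: subgrp_sumset (AD_sub _ _) (GF_sub C).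
  move=> i j; rewrite -mulrBr => H; apply: contrapT => /eqP ij; apply: nex.
  by exists i, j.
have [rDij [f2 _ f2E]] := (H0_sub C Dd).2 _ _ (rD i) (rD j).
have [c cD [f1 _ f1E]] := ijD.
exists f1, f2; split.
- apply/orP; right; apply: contraNneq ij => f0; apply/eqP.
  by apply: (idx_sep (@sub0_subgrp _) rD rP); rewrite /= -f2E f0 rmorph0.
- by apply: inD; rewrite f2E.
apply: inA; rewrite f1E f2E addrAC subrr sub0r.
exact: subgrpN (AD_sub _ _) cD.
Qed.

End Adelic.

(** Scaling by an idele supported at one place with N residue classes multiplies the norm of the
    determinant by powers of M = N^2; this brings it between B / M and B. *)
Lemma normalize_power (q B : rat) (M : nat) : (1 < M)%N -> 0 < q -> 0 < B ->
  exists m : int, B / M%:R <= q * M%:R ^ m /\ q * M%:R ^ m < B.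
Proof.
move=> M1 q0 B0; have M0 : 0 < M%:R :> rat by rewrite ltr0n ltnW.
have big (x : rat) : 0 <= x -> exists n : nat, x < M%:R ^+ n.
  move=> x0; exists (Num.bound x); apply: lt_trans (archi_boundP x0) _.
  by rewrite -natrX ltr_nat ltn_expl.
have [n0 n0P] := big (q / B) (ltW (divr_gt0 q0 B0)).
have [n1 n1P] := big (B / q * M%:R ^+ n0) (mulr_ge0 (ltW (divr_gt0 B0 q0)) (exprn_ge0 _ (ltW
  M0))).
have ex : exists n : nat, B <= q * M%:R ^ (n%:Z - n0%:Z).
  exists n1; rewrite expfzDr ?gt_eqF // -exprnP -exprnN mulrA ler_pdivlMr ?exprn_gt0 //.
  by rewrite -ler_pdivrMl // mulrA (mulrC q^-1) ltW.
have [n nP nmin] := ex_minnP ex; case: n => [|n] in nP nmin *.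
  exfalso; move: nP; rewrite sub0r -exprnN leNgt => /negP; apply.
  by rewrite ltr_pdivrMr ?exprn_gt0 // -ltr_pdivrMl // mulrC.
exists (n%:Z - n0%:Z); split; last first.
  by rewrite ltNge; apply/negP => /nmin; rewrite ltnn.
rewrite ler_pdivrMr // -mulrA -[X in _ <= q * (_ * X)]expr1z -expfzDr ?gt_eqF //.
by rewrite (_ : n%:Z - n0%:Z + 1 = n.+1%:Z - n0%:Z); last by lia.
Qed.

(** * Normal forms for double cosets *)

Section ProjectiveGroup.
Variables (k : finFieldType) (X : curve k).
Variable C : forall x : place X, completion x.
Local Notation A := (adele C).
Implicit Types (g h w q : GL2 A) (p : PGL2A C).

Lemma pglMg g h : pgl (g * h)%g = (pgl g * pgl h)%g :> PGL2A C.
Proof. by rewrite -pglM. Qed.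

Lemma pgl1 : pgl 1%g = 1%g :> PGL2A C. Proof. by []. Qed.

Lemma pglVg g : pgl g^-1%g = (pgl g)^-1%g :> PGL2A C.
Proof.
apply: (@mulgI _ (pgl g)); rewrite -pglMg !mulgV; exact: pgl1.
Qed.

Lemma pgl_surj p : exists g, p = pgl g.
Proof. by exists (repr p); rewrite /pgl reprK. Qed.

Fact scal_mul (a b : A) : a * b = 1 -> a%:M *m b%:M = 1%:M :> 'M[A]_2.
Proof. by move=> ab; rewrite -scalar_mxM ab. Qed.

Definition scal (a a' : A) (aa : a * a' = 1) : GL2 A :=
  MkGL2 (scal_mul aa) (scal_mul (etrans (mulrC _ _) aa)).

Lemma pgl_scal (a a' : A) (aa : a * a' = 1) g : pgl (scal aa * g)%g = pgl g.
Proof. by apply/esym/pgl_eqP; exists (scal aa) => //; exists a. Qed.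

Lemma dord_scal (a a' : A) (aa : a * a' = 1) x : dord (scal aa) x = iord a x + iord a x.
Proof. by rewrite /dord /= det_scalar expr2 (iordM x aa aa). Qed.

Lemma PGL2FP p : PGL2F C p <-> exists (m : 'M[X]_2) (mu : m \in unitmx), p = pgl (diaG C mu).
Proof.
split=> [[g [m mu gm] <-]|[m [mu ->]]]; last first.
  by exists (diaG C mu) => //; exists m => // x i j; rewrite /= !mxE.
exists m, mu; congr pgl; apply: GL2P; apply/matrixP => i j; apply: adeleP => x.
by rewrite gm /= mxE.
Qed.

Lemma PGL2OP p : PGL2O C p <-> exists2 q, kO q & p = pgl q.
Proof. by split=> [[q qK <-]|[q qK ->]]; exists q. Qed.

Lemma diaGM (m n : 'M[X]_2) (mu : m \in unitmx) (nu : n \in unitmx)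
  (mnu : m *m n \in unitmx) : diaG C mnu = (diaG C mu * diaG C nu)%g.
Proof. by apply: GL2P; rewrite /= map_mxM. Qed.

Lemma PGL2F1 : PGL2F C 1%g.
Proof.
apply/PGL2FP; exists 1%:M, (unitmx1 _ _); rewrite -pgl1; congr pgl.
by apply: GL2P; rewrite /= map_mx1.
Qed.

Lemma PGL2FM p p' : PGL2F C p -> PGL2F C p' -> PGL2F C (p * p')%g.
Proof.
move=> /PGL2FP[m [mu ->]] /PGL2FP[n [nu ->]]; apply/PGL2FP.
have mnu : m *m n \in unitmx by rewrite unitmx_mul mu.
by exists (m *m n), mnu; rewrite (diaGM mu nu) pglMg.
Qed.

Lemma PGL2FV p : PGL2F C p -> PGL2F C p^-1%g.
Proof.
move=> /PGL2FP[m [mu ->]]; apply/PGL2FP.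
have mV : invmx m \in unitmx by rewrite unitmx_inv.
by exists (invmx m), mV; rewrite -pglVg; congr pgl; apply: GL2P.
Qed.

Lemma PGL2O1 : PGL2O C 1%g.
Proof. by apply/PGL2OP; exists 1%g; [exact: kO1|rewrite pgl1]. Qed.

Lemma PGL2OM p p' : PGL2O C p -> PGL2O C p' -> PGL2O C (p * p')%g.
Proof.
move=> /PGL2OP[q qK ->] /PGL2OP[r rK ->]; apply/PGL2OP.
by exists (q * r)%g; [exact: kOM|rewrite pglMg].
Qed.

Lemma PGL2OV p : PGL2O C p -> PGL2O C p^-1%g.
Proof.
move=> /PGL2OP[q qK ->]; apply/PGL2OP.
by exists q^-1%g; [exact: kOV|rewrite pglVg].
Qed.

(* same double coset in PGL_2(F) \ PGL_2(A) / K *)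
Definition deq p p' := exists c a, [/\ PGL2F C c, PGL2O C a & p = (c * p' * a)%g].

Lemma deq_refl p : deq p p.
Proof. by exists 1%g, 1%g; split; [exact: PGL2F1|exact: PGL2O1|rewrite mulg1 mul1g]. Qed.

Lemma deq_sym p p' : deq p p' -> deq p' p.
Proof.
move=> [c [a [cF aO ->]]]; exists c^-1%g, a^-1%g; split; [exact: PGL2FV|exact: PGL2OV|].
by rewrite -!mulgA mulgV mulg1 mulKg.
Qed.

Lemma deq_trans p2 p1 p3 : deq p1 p2 -> deq p2 p3 -> deq p1 p3.
Proof.
move=> [c [a [cF aO ->]]] [c' [a' [cF' aO' ->]]].
exists (c * c')%g, (a' * a)%g; split; [exact: PGL2FM|exact: PGL2OM|].
by rewrite !mulgA.
Qed.

Lemma deq_mx g h q (m : 'M[X]_2) (z z' : A) : m \in unitmx -> z * z' = 1 -> kO q ->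
  z%:M *m g = map_mx (dia C) m *m h *m q -> deq (pgl g) (pgl h).
Proof.
move=> mu zz qK E; exists (pgl (diaG C mu)), (pgl q); split.
- by apply/PGL2FP; exists m, mu.
- by apply/PGL2OP; exists q.
by rewrite -!pglMg -(pgl_scal zz); congr pgl; apply: GL2P; rewrite /= E.
Qed.

Lemma map_mx2 (a b c d : X) :
  map_mx (dia C) (mx2 a b c d) = mx2 (dia C a) (dia C b) (dia C c) (dia C d).
Proof. by apply/matrixP; apply: forall_ord2; apply: forall_ord2; rewrite !mxE. Qed.

Lemma kO_upper (a a' b d d' : A) (aa : a * a' = 1) (dd : d * d' = 1) :
  adele_int a -> adele_int b -> adele_int d -> (forall x, iord a x = 0) ->
  (forall x, iord d x = 0) -> kO (upper b aa dd).
Proof.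
move=> ai bi di a0 d0; apply: integral_kO => [|x]; last by rewrite dord_upper a0 d0.
by apply: forall_ord2; apply: forall_ord2; rewrite !mxE //=; exact: aint0.
Qed.

Lemma unitmx2 (a b d : X) : a != 0 -> d != 0 -> mx2 a b 0 d \in unitmx.
Proof. by move=> a0 d0; rewrite unitmxE unitfE det2 !mxE /= mulr0 subr0 mulf_neq0. Qed.

Lemma mul1mx2 g : (1 : A)%:M *m g = g. Proof. exact: mul1mx. Qed.

(** The corner entry matters only modulo d F + a O_A, through unipotent matrices over F on the left
    and over O_A on the right. *)
Lemma deq_translate (a a' b d d' : A) (aa : a * a' = 1) (dd : d * d' = 1) (f : X) (o b1 : A) :
  adele_int o -> b = b1 + d * dia C f + a * o ->
  deq (pgl (upper b aa dd)) (pgl (upper b1 aa dd)).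
Proof.
move=> oi bE; apply: (@deq_mx _ _ (upper o (mulr1 1) (mulr1 1)) (mx2 1 f 0 1) 1 1).
- by apply: unitmx2; exact: oner_neq0.
- exact: mulr1.
- by apply: kO_upper => // [||x|x]; (exact: aint1 || exact: iord1).
rewrite mul1mx2 /= map_mx2 !mx2M bE !rmorph0 !rmorph1.
by congr mx2; ring.
Qed.

Lemma deq_left (a a' b d d' : A) (aa : a * a' = 1) (dd : d * d' = 1)
    (e e' : A) (ee : e * e' = 1) (f : X) : f != 0 -> e = dia C f * d ->
  deq (pgl (upper b aa dd)) (pgl (upper b aa ee)).
Proof.
move=> f0 eE; apply: (@deq_mx _ _ 1%g (mx2 1 0 0 f^-1) 1 1).
- by apply: unitmx2; rewrite ?oner_neq0 ?invr_neq0.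
- exact: mulr1.
- exact: kO1.
rewrite mul1mx2 /= map_mx2 mulmx1 mx2M eE !rmorph0 !rmorph1 !mulrA.
have ff : dia C f^-1 * dia C f = 1 by rewrite mulrC diaV.
by rewrite ff; congr mx2; ring.
Qed.

(** Diagonal matrices of units on the right allow the diagonal ideles to be replaced by any others
    with the same divisors. *)
Lemma deq_units (a a' b d d' : A) (aa : a * a' = 1) (dd : d * d' = 1)
    (e e' f f' : A) (ee : e * e' = 1) (ff : f * f' = 1) :
  (forall x, iord e x = iord a x) -> (forall x, iord f x = iord d x) ->
  deq (pgl (upper b aa dd)) (pgl (upper (b * d' * f) ee ff)).
Proof.
move=> ea fd.
have uu : (e' * a) * (e * a') = 1 by rewrite mulrACA [e' * e]mulrC ee aa mulr1.
have vv : (f' * d) * (f * d') = 1 by rewrite mulrACA [f' * f]mulrC ff dd mulr1.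
have u0 x : iord (e' * a) x = 0.
  by rewrite (iordM x (etrans (mulrC _ _) ee) aa) (iordV x ee) ea addNr.
have v0 x : iord (f' * d) x = 0.
  by rewrite (iordM x (etrans (mulrC _ _) ff) dd) (iordV x ff) fd addNr.
have [ui _] := unit_int uu u0; have [vi _] := unit_int vv v0.
apply: (@deq_mx _ _ (upper 0 uu vv) 1%:M 1 1) => //.
- exact: unitmx1.
- exact: mulr1.
- by apply: kO_upper => //; exact: aint0.
rewrite mul1mx2 map_mx1 mul1mx /= mx2M !mul0r !mulr0 !addr0 add0r.
congr mx2.
- by rewrite mulrA ee mul1r.
- by rewrite -(mulrA (b * d')) [f * _]mulrA ff mul1r -mulrA [d' * d]mulrC dd mulr1.
by rewrite mulrA ff mul1r add0r.
Qed.

Lemma deq_diag (e e' e1 e1' : A) (ee : e * e' = 1) (ee1 : e1 * e1' = 1) (f : X) :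
  f != 0 -> (forall x, iord e1 x = iord e x - ord x f) ->
  deq (pgl (upper 0 ee (mulr1 (1 : A)))) (pgl (upper 0 ee1 (mulr1 (1 : A)))).
Proof.
move=> f0 e1E; have ff := diaV C f0; have ff' : dia C f^-1 * dia C f = 1 by rewrite mulrC.
have u1 : (e * e1') * (e1 * e') = 1.
  have -> : e * e1' * (e1 * e') = (e * e') * (e1 * e1') by ring.
  by rewrite ee ee1 mulr1.
have uu : (dia C f^-1 * (e * e1')) * (dia C f * (e1 * e')) = 1 by rewrite mulrACA ff' u1 mulr1.
have u0 x : iord (dia C f^-1 * (e * e1')) x = 0.
  rewrite (iordM x ff' u1) (iordM x ee (etrans (mulrC _ _) ee1)) (iordV x ee1) e1E iord_dia.
  by rewrite (dvalV (ord_dval x)) //; ring.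
have [ui _] := unit_int uu u0.
apply: (@deq_mx _ _ (upper 0 uu (mulr1 1)) (mx2 f 0 0 1) 1 1).
- by apply: unitmx2; rewrite ?oner_neq0.
- exact: mulr1.
- by apply: kO_upper => // [||x]; (exact: aint0 || exact: aint1 || exact: iord1).
rewrite mul1mx2 map_mx2 /= !mx2M !rmorph0 !rmorph1 !mul0r !mulr0 !addr0 !add0r !mulr1.
congr mx2; last by rewrite mul0r.
have -> : dia C f * e1 * (dia C f^-1 * (e * e1')) = (dia C f * dia C f^-1) * (e1 * e1') * e by
  ring.
by rewrite ff ee1 !mul1r.
Qed.

(* the double coset corresponding to c_D *)
Definition cpt (D : divisor X) : GL2 A :=
  upper 0 (powV C (fun x => - D x)) (mulr1 (1 : A)).

(** The right hand side is an integral matrix when D is effective, which is the form needed for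
    comparing degrees. *)
Lemma scal_cpt (D : divisor X) :
  (scal (powV C D) * cpt D)%g = upper 0 (mulr1 (1 : A)) (powV C D).
Proof. by apply: GL2P; rewrite /= mx2_1 mx2M !mul0r !mulr0 !addr0 !add0r powV mulr1. Qed.

Lemma mxint_upper_pow (D : divisor X) : effective D ->
  mxint (upper 0 (mulr1 (1 : A)) (powV C D)).
Proof.
move=> D0; have fD : fsup D by exact: dmult_fin.
apply: forall_ord2; apply: forall_ord2; rewrite mxE /=.
- exact: aint1.
- exact: aint0.
- exact: aint0.
move=> x; rewrite vgeE ?(unit_neq0 _ (powV C D)) //.
by have := iord_pow C x fD; rewrite /iord => ->; exact: D0.
Qed.

(** With v as first vector of a basis of F^2, the entry a generates the line subbundle through v;
    that v is a section means that 1/a is integral. *)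
Lemma flag_form g (v : 'cV[X]_2) : v != 0 ->
  (forall i, adele_int ((ginv g *m map_mx (dia C) v) i 0)) ->
  exists (m : 'M[X]_2) (mu : m \in unitmx) q (a a' b d d' : A) (aa : a * a' = 1)
    (dd : d * d' = 1), [/\ kO q, (g * q = diaG C mu * upper b aa dd)%g & adele_int a'].
Proof.
move=> v0 vi; have [m mu mv] := flag v0.
have [q qK h0] := iwasawa ((diaG C mu)^-1 * g)%g.
have [a [a' [b [d [d' [aa [dd E]]]]]]] := upper_form h0.
exists m, mu, q, a, a', b, d, d', aa, dd; split=> //.
  by rewrite -E !mulgA mulgV mul1g.
have -> : a' = ginv (upper b aa dd) 0 0 by rewrite mxE.
rewrite -E /= mxE sum2.
have key j : (ginv g *m map_mx (dia C) m) j 0 = (ginv g *m map_mx (dia C) v) j 0.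
  by rewrite !mxE -mv; apply: eq_bigr => i _; rewrite !mxE.
by rewrite !key; apply: aintD; apply: aintM => //; have [] := qK 0 0; have [] := qK 0 1.
Qed.

Lemma exists_reps : exists R : (place X -> int) -> set A, forall D, finite_set (R D) /\
  (fsup D -> forall c, exists2 r, R D r & sumset (AD D) (GF (C := C)) (c - r)).
Proof.
have /choice[R RP] : forall D, exists R : set A, finite_set R /\
  (fsup D -> forall c, exists2 r, R r & sumset (AD D) (GF (C := C)) (c - r)).
  move=> D; have [fD|nD] := pselect (fsup D); last by exists set0.
  have [kap [_ /(_ D fD)[h [T [r [_ _ rP]]] _]]] := riemann_roch C.
  exists (range r); split=> [|_ c]; first by apply: finite_image; exact: finite_finset.
  by have [i [ri _]] := rP c I; exists (r i) => //; exists i.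
by exists R.
Qed.

(** After scaling, g has bounded degree and a nonzero section, so it is an extension whose subbundle
    has an effective divisor D1 and whose quotient has divisor - div d. If D = D1 + div d has large
    degree, the extension splits and D is equivalent to an effective divisor: this is a c_D.
    Otherwise D1 and div d have bounded degree, which leaves finitely many divisors up to
    equivalence and, for each pair, finitely many extension classes in H^1. *)
Lemma finite_classes : exists2 L : set (GL2 A), finite_set L & forall g,
  (exists2 D : divisor X, effective D & deq (pgl g) (pgl (cpt D))) \/
  (exists2 l, L l & deq (pgl g) (pgl l)).
Proof.
have [x0 _] := ex_place X.
have [B2 [B20 B2P]] := rank2_section C.
have [Be [Be0 BeP]] := large_effective C; have [Ba [Ba0 BaP]] := large_approx C.
have [R RP] := exists_reps.
pose N0 := resN x0; pose M := (N0 * N0)%N.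
have M1 : (1 < M)%N by have := resN_gt1 x0; rewrite /M /N0; nia.
have M0 : 0 < M%:R :> rat by rewrite ltr0n ltnW.
pose B4 := Num.max Ba Be; have B40 : 0 < B4 by rewrite lt_max Ba0.
(* Since nrm D = (nrm D1)^2 nrm (dord g1), the bounds nrm D <= B4 and nrm (dord g1) >= B2 / M,
   together with nrm D1 >= 1, give nrm D1 <= B5. *)
pose B5 := B4 * M%:R / B2; have B50 : 0 < B5 by rewrite divr_gt0 ?mulr_gt0.
(* The multiple E0 of x0 makes E0 - div d equivalent to an effective divisor D2, whose norm is at
   most B6; finitely many D2 then represent div d. *)
have [n0 n0P] : exists n0 : nat, Be * (B2 * B5) < N0%:R ^+ n0 :> rat.
  exists (Num.bound (Be * (B2 * B5))); apply: lt_trans (archi_boundP _) _.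
    by apply/ltW/mulr_gt0 => //; exact: mulr_gt0.
  by rewrite -natrX ltr_nat ltn_expl // resN_gt1.
pose E0 y : int := if y == x0 then n0%:Z else 0.
have fE0 : fsup E0 by exact: fsup_single.
have nE0 : nrm E0 = N0%:R ^+ n0 by rewrite nrm_single.
pose B6 := N0%:R ^+ n0 / (B2 / M%:R) : rat.
pose Eff (B : rat) := [set D : place X ->
  int | [/\ fsup D, forall x, 0 <= D x & nrm D <= (Num.bound B)%:R]].
have finEff B : finite_set (Eff B) by exact: finite_effective.
pose L := \bigcup_(D1 in Eff B5) \bigcup_(D2 in Eff B6)
  (fun r => upper (r * pow C (fun x => E0 x - D2 x)) (powV C (fun x => - D1 x))
     (powV C (fun x => E0 x - D2 x))) @` R (fun x => D1 x + (E0 x - D2 x)).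
exists L.
  apply: bigcup_finite => // D1 _; apply: bigcup_finite => // D2 _.
  by apply: finite_image; have [] := RP (fun x => D1 x + (E0 x - D2 x)).
move=> g.
have [m [mlo mhi]] := normalize_power M1 (nrm_gt0 (dord g)) B20.
pose Dm y : int := if y == x0 then m else 0.
have fDm : fsup Dm by exact: fsup_single.
pose g1 := (scal (powV C Dm) * g)%g.
have fg := fsup_dord g.
have nrm1 : nrm (dord g1) = nrm (dord g) * M%:R ^ m.
  have -> : dord g1 = fun x => Dm x + Dm x + dord g x.
    by apply/funext => x; rewrite dordM dord_scal iord_pow.
  rewrite nrmD ?(nrmD fDm fDm) //; last exact: fsupD.
  by rewrite nrm_single mulrC /M natrM exprzMl // unitfE resN_rat_neq0.
rewrite -nrm1 in mlo mhi.
have [v v0 vi] := B2P g1 mhi.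
have [m' [mu [q [a [a' [b [d [d' [aa [dd [qK E ai]]]]]]]]]]] := flag_form v0 vi.
have geq : deq (pgl g) (pgl (upper b aa dd)).
  rewrite -(pgl_scal (powV C Dm)) -/g1 -[g1](mulgK q) E !pglMg.
  exists (pgl (diaG C mu)), (pgl q^-1)%g; split=> //.
    by apply/PGL2FP; exists m', mu.
  by apply/PGL2OP; exists q^-1%g => //; exact: kOV.
have fa := fsup_iord aa; have fd := fsup_iord dd.
pose D1 x := - iord a x.
have fD1 : fsup D1 by exact: fsupN.
have D10 x : 0 <= D1 x.
  rewrite /D1 -(iordV x aa); have := ai x.
  by rewrite vgeE // (unit_neq0' _ aa).
have nad : nrm (iord d) = nrm (dord g1) * nrm D1.
  have -> : dord g1 = fun x => ord x (\det m') + (iord a x + iord d x).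
    apply/funext => x; rewrite -(dord_diaG C mu) -(dord_upper b aa dd) -dordM -E dordM.
    by rewrite (kO_dord _ qK) addr0.
  have dm0 : \det m' != 0 by rewrite -unitfE -unitmxE.
  rewrite nrmD ?nrm_principal //; last 2 first.
  - exact: fsup_ord.
  - exact: fsupD.
  rewrite mul1r nrmD // /D1 nrmN //.
  by rewrite mulrAC divff ?mul1r // nrm_neq0.
pose D x := D1 x + iord d x.
have fD : fsup D by exact: fsupD.
have [ltB4|leB4] := ltP B4 (nrm D).
  left; move: ltB4; rewrite gt_max => /andP[lta lte].
  have [f f0 fP] := BeP D fD lte.
  have fDf : fsup (fun x => D x + ord x f) by apply: fsupD => //; exact: fsup_ord.
  exists (Divisor fDf); first exact: fP.
  apply: deq_trans geq _.
  (* The class of the extension in A / (A(D) + F) is that of b / d, and this quotient is trivial. *)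
  have := BaP D fD lta => /seteqP[_ /(_ (d' * b) I)[e eD [f2 _ f2E]]].
  apply: deq_trans (deq_translate (f := f2) (o := a' * d * e) (b1 := 0) aa dd _ _) _.
  - have oo : (a' * d) * (a * d') = 1 by rewrite mulrACA [a' * a]mulrC aa dd mulr1.
    apply/aintP/(AD_iord _ _ oo) => x; apply: vge_le (eD x); rewrite add0r.
    by rewrite (iordM x (etrans (mulrC _ _) aa) dd) (iordV x aa).
  - rewrite add0r f2E mulrBr !mulrA dd mul1r aa mul1r; ring.
  (* diag(a, d) ~ diag(f^-1 a/d, 1) *)
  have ee : (a * d') * (a' * d) = 1 by rewrite mulrACA aa [d' * d]mulrC dd mulr1.
  apply: deq_trans (_ : deq _ (pgl (upper 0 ee (mulr1 (1 : A))))) _.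
    apply: (@deq_mx _ _ 1%g 1%:M d' d); rewrite ?unitmx1 //.
    - by rewrite mulrC.
    - exact: kO1.
    rewrite map_mx1 mul1mx /= mulmx1 mx2_1 mx2M !mul0r !mulr0 !addr0 !add0r.
    by rewrite [d' * a]mulrC [d' * d]mulrC dd.
  apply: deq_diag f0 _ => x; rewrite iord_pow; last exact: fsupN.
  rewrite (iordM x aa (etrans (mulrC _ _) dd)) (iordV x dd) /= /D /D1; ring.
right.
have nD1 : 1 <= nrm D1 by exact: nrm_ge1.
have nDE : nrm D = nrm D1 * (nrm (dord g1) * nrm D1) by rewrite nrmD // nad.
have g1lo : 0 < B2 / M%:R by rewrite divr_gt0.
have n5 : nrm D1 <= B5.
  apply: le_trans (_ : nrm D1 * nrm D1 <= _).
    by rewrite ler_peMl // ltW // nrm_gt0.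
  have -> : B5 = B4 / (B2 / M%:R) by rewrite /B5 invf_div mulrA.
  rewrite ler_pdivlMr //; apply: le_trans leB4; rewrite nDE.
  by rewrite [X in _ <= X]mulrCA [X in _ <= X]mulrC ler_wpM2l // mulr_ge0 // ltW // nrm_gt0.
have nd : nrm (iord d) <= B2 * B5.
  by rewrite nad; apply: ler_pM => //; rewrite ltW // nrm_gt0.
have fEd : fsup (fun x => E0 x - iord d x) by exact: fsupB.
have [|f f0 fP] := BeP _ fEd.
  rewrite nrmB // ltr_pdivlMr ?nrm_gt0 // nE0; apply: le_lt_trans n0P.
  by rewrite ler_pM2l.
pose D2 x := E0 x - iord d x + ord x f.
have ff := fsup_ord f0.
have fD2 : fsup D2 by exact: fsupD.
have n6 : nrm D2 <= B6.
  rewrite nrmD // (nrm_principal C f0) mulr1 nrmB // nE0 /B6.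
  rewrite ler_pM2l ?exprn_gt0 ?ltr0n ?(ltnW (resN_gt1 _)) // lef_pV2 ?posrE ?nrm_gt0 //.
  by rewrite nad; apply: le_trans mlo _; rewrite ler_peMr // ltW // nrm_gt0.
have bound B x : 0 < B -> x <= B -> x <= (Num.bound B)%:R :> rat.
  by move=> B0 xB; apply: le_trans xB _; rewrite ltW // archi_boundP // ltW.
have B60 : 0 < B6 by rewrite divr_gt0 // exprn_gt0 // ltr0n ltnW // resN_gt1.
pose E2 x := E0 x - D2 x.
have fE2 : fsup E2 by exact: fsupB.
have E2E x : iord (pow C E2) x = iord d x - ord x f.
  by rewrite iord_pow // /E2 /D2; ring.
have pf : (dia C f^-1 * d) * (dia C f * d') = 1 by rewrite mulrACA dd mulr1 mulrC diaV.
have ff' : dia C f^-1 * dia C f = 1 by rewrite mulrC diaV.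
pose c := b * (dia C f * d').
have [r Rr [e eD [f2 _ f2E]]] := (RP (fun x => D1 x + E2 x)).2 (fsupD fD1 fE2) c.
exists (upper (r * pow C E2) (powV C (fun x => - D1 x)) (powV C E2)).
  by exists D1; [split=> //; exact: bound|exists D2; [split=> //; exact: bound|exists r]].
apply: deq_trans geq _.
apply: deq_trans (deq_left b aa dd pf (invr_neq0 f0) erefl) _.
apply: deq_trans (deq_units _ aa pf (powV C (fun x => - D1 x)) (powV C E2) _ _) _.
- by move=> x; rewrite iord_pow; [rewrite /D1 opprK|exact: fsupN].
- by move=> x; rewrite E2E (iordM x ff' dd) iord_dia (dvalV (ord_dval x)) // addrC.
rewrite -/c; apply: (deq_translate (f := f2) (o :=
  pow C (fun x => - - D1 x) * pow C E2 * e) (powV C _) (powV C _)).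
  have fND : fsup (fun x => - - D1 x) by do 2 apply: fsupN.
  have oo : (pow C (fun x => - - D1 x) * pow C E2) *
      (pow C (fun x => - D1 x) * pow C (fun x => - E2 x)) = 1.
    by rewrite mulrACA powV mulr1 mulrC powV.
  apply/aintP/(AD_iord _ _ oo) => x; apply: vge_le (eD x); rewrite add0r.
  rewrite (iordM x (etrans (mulrC _ _) (powV C (fun x => - D1 x))) (powV C E2)).
  by rewrite !iord_pow // opprK.
have PP : pow C (fun x => - D1 x) * pow C (fun x => - - D1 x) = 1 := powV C _.
rewrite f2E 2!(mulrA (pow C (fun x => - D1 x))) PP mul1r /c; ring.
Qed.

End ProjectiveGroup.

(** * Integral matrices of bounded determinant *)

Section IntegralCosets.
Variables (k : finFieldType) (X : curve k).
Variable C : forall x : place X, completion x.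
Local Notation A := (adele C).

(** Hermite normal form: the diagonal ideles have effective divisors of bounded norm, and the corner
    entry matters only modulo A(-D1). *)
Lemma integral_cosets (B : nat) : exists2 L : set (GL2 A), finite_set L &
  forall w : GL2 A, mxint w -> nrm (dord w) <= B%:R ->
    exists l q, [/\ L l, kO q & w = (l * q)%g].
Proof.
have [R RP] : exists R : (place X -> int) -> set A, forall D, finite_set (R D) /\
    (fsup D -> (forall x, 0 <= D x) -> forall c, adele_int c ->
       exists2 r, R D r & AD (fun x => - D x) (c - r)).
  have /choice[R RP] : forall D : place X -> int, exists R : set A, finite_set R /\
    (fsup D -> (forall x, 0 <= D x) -> forall c, adele_int c ->
       exists2 r, R r & AD (fun x => - D x) (c - r)).
    move=> D; have [[fD D0]|nD] := pselect (fsup D /\ forall x, 0 <= D x); last first.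
      by exists set0; split=> // fD D0; case: nD.
    have D0' x : - D x <= 0 by rewrite oppr_le0.
    have [n [T [r [_ _ rP]]] _] := idx_AD C (fsupN fD) (fsup0 X) D0'.
    exists (range r); split=> [|_ _ c /aintP cD]; first by apply: finite_image;
      exact: finite_finset.
    by have [i [ri _]] := rP c cD; exists (r i) => //; exists i.
  by exists R.
pose Eff := [set D : place X -> int | [/\ fsup D, forall x, 0 <= D x & nrm D <= B%:R]].
have finEff : finite_set Eff by exact: finite_effective.
exists (\bigcup_(D1 in Eff) \bigcup_(D2 in Eff)
  (fun r => upper r (powV C D1) (powV C D2)) @` R D1).
  apply: bigcup_finite => // D1 _; apply: bigcup_finite => // D2 _.
  by apply: finite_image; have [] := RP D1.
move=> w wi wB; have [q qK w0] := iwasawa w.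
have [a [a' [b [d [d' [aa [dd E]]]]]]] := upper_form w0.
have ui : mxint (upper b aa dd).
  by rewrite -E; apply: integralM => // i j; have [] := qK i j.
have ai : adele_int a by have := ui 0 0; rewrite mxE.
have bi : adele_int b by have := ui 0 1; rewrite mxE.
have di : adele_int d by have := ui 1 1; rewrite mxE.
have fa := fsup_iord aa; have fd := fsup_iord dd.
have a0 x : 0 <= iord a x by have := ai x; rewrite vgeE // (unit_neq0 _ aa).
have d0 x : 0 <= iord d x by have := di x; rewrite vgeE // (unit_neq0 _ dd).
have nw : nrm (dord w) = nrm (iord a) * nrm (iord d).
  rewrite -nrmD //; congr nrm; apply/funext => x.
  by rewrite -(dord_upper b aa dd) -E dordM (kO_dord _ qK) addr0.
have na : nrm (iord a) <= B%:R.
  by apply: le_trans wB; rewrite nw ler_peMr ?nrm_ge1 // ltW // nrm_gt0.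
have nd : nrm (iord d) <= B%:R.
  by apply: le_trans wB; rewrite nw ler_peMl ?nrm_ge1 // ltW // nrm_gt0.
pose P1 := pow C (iord a); pose P1' := pow C (fun x => - iord a x).
pose P2 := pow C (iord d); pose P2' := pow C (fun x => - iord d x).
have pp1 : P1 * P1' = 1 := powV C _; have pp2 : P2 * P2' = 1 := powV C _.
have uu : (P1' * a) * (P1 * a') = 1 by rewrite mulrACA [P1' * P1]mulrC pp1 aa mulr1.
have vv : (P2' * d) * (P2 * d') = 1 by rewrite mulrACA [P2' * P2]mulrC pp2 dd mulr1.
have u0 x : iord (P1' * a) x = 0.
  rewrite (iordM x (etrans (mulrC _ _) pp1) aa) (iordV x pp1) iord_pow //; ring.
have v0 x : iord (P2' * d) x = 0.
  rewrite (iordM x (etrans (mulrC _ _) pp2) dd) (iordV x pp2) iord_pow //; ring.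
have [uI _] := unit_int uu u0; have [vI vI'] := unit_int vv v0.
have [r Rr rP] := (RP (iord a)).2 fa a0 _ (aintM bi vI').
pose o := P1' * (b * (P2 * d') - r).
have oi : adele_int o.
  apply/aintP/(AD_iord _ _ (etrans (mulrC _ _) pp1)) => x; apply: vge_le (rP x).
  by rewrite add0r (iordV x pp1) iord_pow.
exists (upper r (powV C (iord a)) (powV C (iord d))), (upper (o * (P2' * d)) uu vv * q^-1)%g.
split.
- by exists (iord a); [split|exists (iord d); [split|exists r]].
- by apply: kOM; [apply: kO_upper => //; exact: aintM|exact: kOV].
rewrite mulgA -[w](mulgK q) E; congr (_ * _)%g; apply: GL2P; rewrite /= mx2M.
rewrite -/P1 -/P2 !mul0r !mulr0 !addr0 add0r !mulrA pp1 pp2 !mul1r.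
congr mx2.
have -> : (b * P2 * d' - r) * P2' * d + r * P2' * d = b * (P2 * P2') * (d * d') by ring.
by rewrite pp2 dd !mulr1.
Qed.

End IntegralCosets.

(** * The torus *)

Section TorusAlgebra.
Variables (k : finFieldType) (X : curve k) (E : const_ext X).
Local Notation bs := (cbasis E).

Lemma cincl_span (th : Fq2 E) : cincl E th = \sum_i const X (coord (qbasis E) i th) *: bs`_i.
Proof.
rewrite {1}(coord_basis (qbasisP E) (memvf th)) rmorph_sum; apply: eq_bigr => i _.
rewrite (nth_map 0) ?size_tuple // -mulr_algl rmorphM cincl_const mulr_algl //.
Qed.

Lemma bs_cincl (i : 'I_2) : bs`_i = cincl E (qbasis E)`_i.
Proof. by rewrite (nth_map 0) ?size_tuple. Qed.

Lemma cincl_mem (th : Fq2 E) : cincl E th \in <<bs>>%VS.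
Proof.
rewrite cincl_span; apply: memv_suml => i _; apply: memvZ; apply: memv_span.
by rewrite mem_nth // size_tuple.
Qed.

(** The F-span of the basis contains F_q2 and is closed under products, so it is a subfield, and
    [cext_gen] says that it is all of E. *)
Lemma bs_full : <<bs>>%VS = fullv.
Proof.
have S1 : (1 : cext E) \in <<bs>>%VS by rewrite -(rmorph1 (cincl E)) cincl_mem.
have SM : (<<bs>> * <<bs>> <= <<bs>>)%VS.
  apply/prodvP => u v; rewrite (span_def bs); move=> uS vS.
  have [cu ->] : exists c, u = \sum_(i < 2) c i *: bs`_i.
    by exists (fun i => coord bs i u); rewrite -span_def in uS; exact: coord_span.
  have [cv ->] : exists c, v = \sum_(i < 2) c i *: bs`_i.
    by exists (fun i => coord bs i v); rewrite -span_def in vS; exact: coord_span.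
  rewrite -span_def mulr_suml; apply: memv_suml => i _; rewrite mulr_sumr;
    apply: memv_suml => j _.
  by rewrite -scalerAl -scalerAr !bs_cincl -rmorphM; do 2 apply: memvZ; exact: cincl_mem.
have aS : is_aspace <<bs>>%VS by rewrite /is_aspace (has_algid1 S1) SM.
exact: (@cext_gen _ _ E (ASpace aS) cincl_mem).
Qed.

Lemma bs_basis : basis_of fullv bs.
Proof. by rewrite basisEfree cbasis_free bs_full subvv /= size_tuple -bs_full (eqnP
  (cbasis_free E)) size_tuple. Qed.

Local Notation M := (@mulE_mx _ _ E).

Lemma mulE_col z (j : 'I_2) : z * bs`_j = \sum_i M z i j *: bs`_i.
Proof.
rewrite {1}(coord_basis bs_basis (memvf (z * bs`_j))).
by apply: eq_bigr => i _; rewrite mxE.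
Qed.

Lemma mulE_mxM z w : M (z * w) = M z *m M w.
Proof.
apply/matrixP => i j; rewrite !mxE -mulrA mulE_col mulr_sumr linear_sum.
by apply: eq_bigr => l _; rewrite -scalerAr linearZ /= mulrC; congr (_ * _); rewrite mxE.
Qed.

Lemma mulE_mx_unit z : z != 0 -> M z \in unitmx.
Proof.
move=> z0; have : M z *m M z^-1 = 1%:M by rewrite -mulE_mxM divff // mulE_mx1.
by move/mulmx1_unit => [].
Qed.

Lemma mulE_mxZD (c : 'I_2 -> X) : M (\sum_s c s *: bs`_s) = \sum_s c s *: M bs`_s.
Proof. by rewrite !sum2 mulE_mxD. Qed.

Lemma mulE_mx_coord z : M z = \sum_s coord bs s z *: M bs`_s.
Proof. by rewrite -mulE_mxZD -(coord_basis bs_basis (memvf z)). Qed.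

Lemma bs_mul (s r : 'I_2) : exists c : 'I_2 -> k, bs`_s * bs`_r = \sum_l const X (c l) *: bs`_l.
Proof.
rewrite !bs_cincl -rmorphM cincl_span.
by exists (fun i => coord (qbasis E) i ((qbasis E)`_s * (qbasis E)`_r)).
Qed.

(** Products of basis elements stay in F_q2, so their coordinates are constants. *)
Lemma mulE_const (s i j : 'I_2) : exists c, M bs`_s i j = const X c.
Proof.
have [c cE] := bs_mul s j; exists (c i).
by rewrite mxE cE coord_sum_free ?cbasis_free.
Qed.

End TorusAlgebra.

(** * The adelic points of the torus *)

Section AdelicTorus.
Variables (k : finFieldType) (X : curve k) (E : const_ext X).
Variable C : forall x : place X, completion x.
Local Notation A := (adele C).
Local Notation bs := (cbasis E).
Local Notation M := (@mulE_mx _ _ E).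
Implicit Types (g h t w : GL2 A).

(** Multiplication by the element with coordinates a in the tensor product of E and A over F. *)
Definition tmx (a : 'I_2 -> A) : 'M[A]_2 := \sum_s a s *: map_mx (dia C) (M bs`_s).

Lemma tmxE a i j : tmx a i j = \sum_s a s * dia C (M bs`_s i j).
Proof. by rewrite summxE; apply: eq_bigr => s _; rewrite 2![in LHS]mxE. Qed.

Lemma torA'P g : torA' E C g <-> exists a, gmx g = tmx a.
Proof.
split=> [[a ga]|[a ga]]; exists a.
  by apply/matrixP => i j; apply: adeleP => x; rewrite ga tmxE !sum2.
by move=> x i j; rewrite ga tmxE !sum2.
Qed.

Lemma tmxD a b : tmx a + tmx b = tmx (fun s => a s + b s).
Proof. by rewrite /tmx -big_split; apply: eq_bigr => s _; rewrite scalerDl. Qed.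

Lemma tmxZ c a : c *: tmx a = tmx (fun s => c * a s).
Proof. by rewrite /tmx scaler_sumr; apply: eq_bigr => s _; rewrite scalerA. Qed.

Lemma tmx_dia z : map_mx (dia C) (M z) = tmx (fun s => dia C (coord bs s z)).
Proof.
rewrite mulE_mx_coord /tmx !sum2; apply/matrixP => i j.
by rewrite !mxE rmorphD !rmorphM.
Qed.

Lemma tmx1 : exists c, 1%:M = tmx c.
Proof. by eexists; rewrite -(map_mx1 (dia C)) -(mulE_mx1 E) tmx_dia. Qed.

Lemma tmxM a b : tmx a *m tmx b = tmx b *m tmx a /\ exists c, tmx a *m tmx b = tmx c.
Proof.
have MC s r : map_mx (dia C) (M bs`_s) *m map_mx (dia C) (M bs`_r) =
    map_mx (dia C) (M (bs`_s * bs`_r)) by rewrite -map_mxM mulE_mxM.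
have exp a' b' : tmx a' *m tmx b' = \sum_s \sum_r (a' s * b' r) *:
  map_mx (dia C) (M (bs`_s * bs`_r)).
  rewrite /tmx mulmx_suml; apply: eq_bigr => s _; rewrite mulmx_sumr; apply: eq_bigr => r _.
  by rewrite -scalemxAl -scalemxAr scalerA MC.
split.
  rewrite !exp exchange_big; apply: eq_bigr => s _; apply: eq_bigr => r _.
  by rewrite mulrC [bs`_r * _]mulrC.
rewrite exp.
have cl (F : 'I_2 -> 'M[A]_2) : (forall i, exists c, F i = tmx c) -> exists c, \sum_i F i = tmx c.
  by move=> H; rewrite sum2; have [c0 ->] := H 0; have [c1 ->] := H 1; rewrite tmxD; eexists.
by apply: (cl) => s; apply: (cl) => r; rewrite tmx_dia tmxZ; eexists.
Qed.

Lemma torA'_comm g h : torA' E C g -> torA' E C h -> (g * h = h * g)%g.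
Proof.
by move=> /torA'P[a ga] /torA'P[b hb]; apply: GL2P; rewrite /= ga hb; have [] := tmxM a b.
Qed.

Lemma torA'M g h : torA' E C g -> torA' E C h -> torA' E C (g * h)%g.
Proof.
move=> /torA'P[a ga] /torA'P[b hb]; apply/torA'P; rewrite /= ga hb.
by have [_] := tmxM a b.
Qed.

(** For 2x2 matrices the adjugate is tr(g) - g, and scalars are A-combinations of the basis
    matrices. *)
Lemma torA'V g : torA' E C g -> torA' E C g^-1%g.
Proof.
move=> /torA'P[a ga]; apply/torA'P => /=; have [c cE] := tmx1.
have -> : ginv g = \det (ginv g) *: ((g 0 0 + g 1 1) *: 1%:M - gmx g).
  have [gV _] : ginv g = \det (ginv g) *: \adj g /\ True.
    split=> //; rewrite -[\adj g]mul1mx -(ginvK g) -mulmxA mul_mx_adj mul_mx_scalar scalerA.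
    by rewrite mulrC det_gmxK scale1r.
  rewrite {1}gV; congr (_ *: _).
  apply/matrixP; apply: forall_ord2; apply: forall_ord2; rewrite !mxE /cofactor det_mx11 !mxE /=;
    rewrite ?expr0 ?expr1 ?expr2 ?mulrNN ?mulr1 ?mul1r ?mulN1r ?mulr0 ?add0r.
  - by rewrite addrAC subrr add0r; congr (g _ _); apply: val_inj.
  - by congr (- g _ _); apply: val_inj.
  - by congr (- g _ _); apply: val_inj.
  by rewrite addrK; congr (g _ _); apply: val_inj.
by rewrite cE ga -scaleN1r !tmxZ tmxD tmxZ; eexists.
Qed.

Lemma torA'_scal (a a' : A) (aa : a * a' = 1) : torA' E C (scal aa).
Proof.
by apply/torA'P => /=; have [c cE] := tmx1; rewrite -scalemx1 cE tmxZ; eexists.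
Qed.

Definition torG (z : cext E) (z0 : z != 0) : GL2 A := diaG C (mulE_mx_unit z0).

Lemma torF'P g : torF' E C g <-> exists z (z0 : z != 0), g = torG z0.
Proof.
split=> [[z z0 gz]|[z [z0 ->]]]; last by exists z => // x i j; rewrite /= mxE.
by exists z, z0; apply: GL2P; apply/matrixP => i j; apply: adeleP => x; rewrite gz /= [in RHS]mxE.
Qed.

Lemma torA'_torG z (z0 : z != 0) : torA' E C (torG z0).
Proof. by apply/torA'P; rewrite /= tmx_dia; eexists. Qed.

Lemma torF_PGL2F : torF E C `<=` PGL2F C.
Proof. by move=> _ [g /torF'P[z [z0 ->]] <-]; apply/PGL2FP; exists (M z), (mulE_mx_unit z0). Qed.

Lemma torF_torA : torF E C `<=` torA E C.
Proof. by move=> _ [g /torF'P[z [z0 ->]] <-]; exists (torG z0) => //; exact: torA'_torG. Qed.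

Lemma torA_M p p' : torA E C p -> torA E C p' -> torA E C (p * p')%g.
Proof.
by move=> [g gT <-] [h hT <-]; exists (g * h)%g; [exact: torA'M|rewrite pglMg].
Qed.

Lemma torA_V p : torA E C p -> torA E C p^-1%g.
Proof. by move=> [g gT <-]; exists g^-1%g; [exact: torA'V|rewrite pglVg]. Qed.

Lemma torA_comm p p' : torA E C p -> torA E C p' -> (p * p' = p' * p)%g.
Proof. by move=> [g gT <-] [h hT <-]; rewrite -!pglMg torA'_comm. Qed.

Lemma torF1 : torF E C 1%g.
Proof.
exists (torG (oner_neq0 (cext E))); first by apply/torF'P; exists 1, (oner_neq0 _).
by rewrite -pgl1; congr pgl; apply: GL2P; rewrite /= mulE_mx1 map_mx1.
Qed.

Lemma torF_M p p' : torF E C p -> torF E C p' -> torF E C (p * p')%g.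
Proof.
move=> [g /torF'P[z [z0 ->]] <-] [h /torF'P[w [w0 ->]] <-].
have zw : z * w != 0 by rewrite mulf_neq0.
exists (torG zw); first by apply/torF'P; exists (z * w), zw.
by rewrite -pglMg; congr pgl; apply: GL2P; rewrite /= mulE_mxM map_mxM.
Qed.

Lemma torF_V p : torF E C p -> torF E C p^-1%g.
Proof.
move=> [g /torF'P[z [z0 ->]] <-]; have zV : z^-1 != 0 by rewrite invr_eq0.
exists (torG zV); first by apply/torF'P; exists z^-1, zV.
apply: (@mulgI _ (pgl (torG z0))); rewrite mulgV -pglMg -pgl1; congr pgl; apply: GL2P.
by rewrite /= -map_mxM -mulE_mxM divff // mulE_mx1 map_mx1.
Qed.

Definition e1 : 'cV[X]_2 := \col_i coord bs i 1.

Lemma mulE_e1 z i : (M z *m e1) i 0 = coord bs i z.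
Proof.
rewrite mxE -[z in RHS]mulr1 [in RHS](coord_basis (bs_basis E) (memvf 1)) mulr_sumr.
rewrite linear_sum; apply: eq_bigr => j _.
by rewrite -scalerAr linearZ /= !mxE mulrC.
Qed.

(** The vector [e1] is 1 in E, so an element of the torus algebra is recovered from its action on
    [e1]. *)
Lemma tmx_e1 a i : (tmx a *m map_mx (dia C) e1) i 0 = a i.
Proof.
rewrite /tmx mulmx_suml summxE.
under eq_bigr => s _ do rewrite -scalemxAl -map_mxM mxE mxE mulE_e1 coord_free ?cbasis_free //.
rewrite (bigD1 i) //= eqxx rmorph1 mulr1 big1 ?addr0 // => s /negbTE si.
by rewrite si rmorph0 mulr0.
Qed.

Lemma aint_const c : adele_int (dia C (const X c)).
Proof. by move=> x; rewrite vge_emb; exact: vge_const. Qed.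

Lemma torus_integral t : torA' E C t ->
  (forall i, adele_int ((t *m map_mx (dia C) e1) i 0)) -> mxint t.
Proof.
move=> /torA'P[a ta] te i j.
have ai s : adele_int (a s) by rewrite -tmx_e1 -ta.
rewrite ta tmxE sum2.
by have [c0 ->] := mulE_const E 0 i j; have [c1 ->] := mulE_const E 1 i j;
  apply: aintD; apply: aintM => //; exact: aint_const.
Qed.

Lemma ex_e1 (v : 'cV[X]_2) : v != 0 -> exists2 z, z != 0 & M z *m e1 = v.
Proof.
move=> v0; have zE i : coord bs i (\sum_s v s 0 *: bs`_s) = v i 0.
  by rewrite coord_sum_free ?cbasis_free.
exists (\sum_s v s 0 *: bs`_s).
  apply: contraNneq v0 => z0; apply/eqP/matrixP => i j; rewrite ord1 -zE z0 mxE.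
  by rewrite linear0.
by apply/matrixP => i j; rewrite ord1 mulE_e1 zE.
Qed.

Lemma nrm_torG z (z0 : z != 0) : nrm (dord (torG z0)) = 1.
Proof.
have d0 : \det (M z) != 0 by rewrite -unitfE -unitmxE mulE_mx_unit.
rewrite -(nrm_principal C d0); congr nrm; apply/funext => x.
exact: (dord_diaG C (mulE_mx_unit z0)).
Qed.

(** Every nonzero vector of F^2 is z 1 for some z in E^x. The determinant of z is principal, so the
    norm of w = t^-1 z is the inverse of that of t. *)
Lemma torus_section t (v : 'cV[X]_2) : torA' E C t -> v != 0 ->
  (forall i, adele_int ((ginv t *m map_mx (dia C) v) i 0)) ->
  exists w z (z0 : z != 0), [/\ torA' E C w, mxint w, t = (torG z0 * w^-1)%g
    & nrm (dord w) = (nrm (dord t))^-1].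
Proof.
move=> tT v0 tv; have [z z0 zv] := ex_e1 v0.
exists (t^-1 * torG z0)%g, z, z0; have wT := torA'M (torA'V tT) (torA'_torG z0).
split=> //.
- by apply: torus_integral => // i; rewrite /= -mulmxA -map_mxM zv; exact: tv.
- by rewrite invgM invgK mulgA mulgV mul1g.
have -> : dord (t^-1 * torG z0)%g = fun x => - dord t x + dord (torG z0) x.
  by apply/funext => x; rewrite dordM dord_inv.
rewrite nrmD ?nrm_torG ?mulr1 ?nrmN //; first exact: fsup_dord.
- by apply: fsupN; exact: fsup_dord.
exact: fsup_dord.
Qed.

(** Finiteness of the class group of T: scaling gives t a section while keeping its degree bounded,
    so the integral matrix w of [torus_section] has bounded determinant and lies in one of the
    cosets of [integral_cosets]. *)
Lemma torus_classes : exists2 L : set (GL2 A), finite_set L & forall t, torA' E C t ->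
  exists l q w z (z0 : z != 0), [/\ L l, kO q, torA' E C w, w = (l * q)%g
    & pgl t = (pgl (torG z0) * pgl w^-1)%g].
Proof.
have [x0 _] := ex_place X; have [B2 [B20 B2P]] := rank2_section C.
pose N := (resN x0 * resN x0)%N.
have N1 : (1 < N)%N by have := resN_gt1 x0; rewrite /N; nia.
have N0 : 0 < N%:R :> rat by rewrite ltr0n ltnW.
pose B := (B2 / N%:R)^-1; have B0 : 0 < B by rewrite invr_gt0 divr_gt0.
have [L Lfin LP] := integral_cosets C (Num.bound B).
exists L => // t tT.
have [m [mlo mhi]] := normalize_power N1 (nrm_gt0 (dord t)) B20.
pose Dm y : int := if y == x0 then m else 0.
have fDm : fsup Dm by exact: fsup_single.
pose t1 := (scal (powV C Dm) * t)%g.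
have nrm1 : nrm (dord t1) = nrm (dord t) * N%:R ^ m.
  have ft := fsup_dord t.
  have -> : dord t1 = fun x => Dm x + Dm x + dord t x.
    by apply/funext => x; rewrite dordM dord_scal iord_pow.
  rewrite nrmD ?(nrmD fDm fDm) //; last exact: fsupD.
  by rewrite nrm_single mulrC /N natrM exprzMl // unitfE resN_rat_neq0.
rewrite -nrm1 in mlo mhi; have [v v0 tv] := B2P t1 mhi.
have t1T : torA' E C t1 by apply: torA'M => //; exact: torA'_scal.
have [w [z [z0 [wT wi t1E nw]]]] := torus_section t1T v0 tv.
have [|l [q [Ll qK wE]]] := LP w wi.
  rewrite nw; apply: (@le_trans _ _ B); last by rewrite ltW // archi_boundP // ltW.
  by rewrite lef_pV2 ?posrE ?nrm_gt0 ?divr_gt0.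
exists l, q, w, z, z0; split=> //.
by rewrite -pglMg -t1E pgl_scal.
Qed.

Lemma lin_equiv_deq (D D' : divisor X) : lin_equiv D D' -> deq (pgl (cpt C D)) (pgl (cpt C D')).
Proof.
have fD : fsup D by exact: dmult_fin. have fD' : fsup D' by exact: dmult_fin.
move=> [f f0 DD']; apply: (@deq_diag _ _ _ _ _ _ _ _ _ (f^-1)); first by rewrite invr_eq0.
by move=> x; rewrite !iord_pow ?DD' ?(dvalV (ord_dval x)) //; [ring|exact: fsupN|exact: fsupN].
Qed.

(* The key step: if t h lies in the double coset of c_D' for some h in K c_D K
   and deg D' >= deg D, then comparing degrees shows that t is trivial in
   T(F) \ T(A) / K_T and that D and D' are linearly equivalent. *)
Lemma torus_key t q1 q2 (D D' : divisor X) : torA' E C t -> kO q1 -> kO q2 ->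
  effective D -> nrm D <= nrm D' ->
  deq (pgl t * pgl q1 * pgl (cpt C D) * pgl q2)%g (pgl (cpt C D')) ->
  (exists z (z0 : z != 0) q, [/\ kO q, torA' E C q & pgl t = (pgl (torG z0) * pgl q)%g]) /\
  lin_equiv D D'.
Proof.
move=> tT q1K q2K D0 nDD' [c [a [/PGL2FP[m [mu ->]] /PGL2OP[q qK ->] E1]]].
have fD : fsup D by exact: dmult_fin. have fD' : fsup D' by exact: dmult_fin.
(* Up to scalars [cpt C D] is this matrix, which is integral because D is effective. *)
pose aD := upper 0 (mulr1 (1 : A)) (powV C D); pose aD' := upper 0 (mulr1 (1 : A)) (powV C D').
have {}E1 : pgl (t * q1 * aD * q2)%g = pgl (diaG C mu * aD' * q)%g.
  by rewrite !pglMg /aD /aD' -!scal_cpt !pgl_scal E1.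
have /pgl_eqP[ze [a1 zeE] E2] := esym E1.
pose t1 := (ze^-1 * t)%g.
have [b1 zeVE] := centreV zeE.
have t1T : torA' E C t1.
  apply: torA'M => //; apply/torA'P; have [c' cE'] := tmx1.
  by rewrite zeVE -scalemx1 cE' tmxZ; eexists.
have t1E : (t1 * (q1 * aD * q2) = diaG C mu * aD' * q)%g.
  have -> : (t1 * (q1 * aD * q2) = ze^-1 * (t * q1 * aD * q2))%g by rewrite /t1 !mulgA.
  by rewrite E2 mulKg.
have v0 : col 0 m != 0.
  apply/negP => /eqP m0; have := mu; rewrite unitmxE unitfE det2.
  have mi i : m i 0 = 0 by have /matrixP/(_ i 0) := m0; rewrite !mxE.
  by rewrite !mi mul0r mulr0 subr0 eqxx.
have aDi : mxint aD by exact: mxint_upper_pow.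
have ki (r : GL2 A) : kO r -> mxint r by move=> rK i j; have [] := rK i j.
(* As aD' fixes the first basis vector, this is an entry of the first column of the integral matrix
   q1 aD q2 q^-1. *)
have t1v i : adele_int ((ginv t1 *m map_mx (dia C) (col 0 m)) i 0).
  have -> : (ginv t1 *m map_mx (dia C) (col 0 m)) i 0 = gmx (q1 * aD * q2 * q^-1)%g i 0.
    have -> : (q1 * aD * q2 * q^-1)%g = (t1^-1 * (diaG C mu * aD'))%g.
      apply: (@mulgI _ t1); rewrite mulVKg !mulgA -[(t1 * _ * _ * _)%g]mulgA.
      by apply: (@mulIg _ q); rewrite -mulgA mulVg mulg1 -t1E !mulgA.
    rewrite [RHS]mxE !mxE; apply: eq_bigr => j _; congr (_ * _).
    by rewrite [RHS]mxE sum2 !mxE /= mulr1 mulr0 addr0.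
  apply: integralM; last by apply: ki; exact: kOV.
  by apply: integralM; [apply: integralM => //|]; exact: ki.
have [w [z [z0 [wT wi tE nw]]]] := torus_section t1T v0 t1v.
have dm0 : \det m != 0 by rewrite -unitfE -unitmxE.
have ordE x : dord t1 x + D x = ord x (\det m) + D' x.
  have := congr1 (fun g => dord g x) t1E; rewrite !dordM !dord_upper dord_diaG.
  rewrite (kO_dord x q1K) (kO_dord x q2K) (kO_dord x qK) !iord_pow // !iord1.
  by rewrite !addr0 !add0r.
have nt : nrm (dord t1) * nrm D = nrm D'.
  rewrite -nrmD //; last exact: fsup_dord.
  rewrite -[RHS]mul1r -(nrm_principal C dm0) -nrmD //; last exact: fsup_ord.
  by congr nrm; apply/funext => x; exact: ordE.
(* The determinant of w is integral and its norm is nrm D / nrm D' <= 1, so it is a unit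
   everywhere. *)
have w0 x : dord w x = 0.
  apply: nrm_eq0; [exact: fsup_dord|by move=> y; exact: dord_ge0|].
  rewrite nw invf_le1 ?nrm_gt0 //.
  by rewrite -(ler_pM2r (nrm_gt0 D)) mul1r nt.
have wK : kO w by exact: integral_kO.
split.
  exists z, z0, w^-1%g; split; [exact: kOV|exact: torA'V|].
  rewrite -pglMg -tE; apply/pgl_eqP; exists ze^-1%g; first by exists b1.
  by [].
exists (\det m / \det (M z)).
  by rewrite mulf_neq0 // invr_eq0 -unitfE -unitmxE mulE_mx_unit.
have dz0 : \det (M z) != 0 by rewrite -unitfE -unitmxE mulE_mx_unit.
move=> x; rewrite (dvalM (ord_dval x)) ?invr_eq0 // (dvalV (ord_dval x)) //.
have : dord t1 x = ord x (\det (M z)).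
  by rewrite tE dordM dord_inv w0 oppr0 addr0 (dord_diaG C (mulE_mx_unit z0)).
by have := ordE x; lia.
Qed.

End AdelicTorus.

Lemma subrB_chain (V : zmodType) (a b c : V) : b - c = (a - c) - (a - b).
Proof. by rewrite opprB [RHS]addrC addrA subrK. Qed.

(** * Topology *)

Section AdeleLimits.
Variables (k : finFieldType) (X : curve k).
Variable C : forall x : place X, completion x.
Local Notation A := (adele C).
Local Notation cv x := (@cval _ _ _ (C x)).

(** Convergence with respect to the subgroups A(D), a basis of neighbourhoods of 0; [tendsP]
    compares it with the topology generated by boxes. *)
Definition tends (T : Type) (F : set_system T) (f : T -> A) (a : A) :=
  forall D, fsup D -> F [set t | AD D (f t - a)].

Lemma AD_D D (a b : A) : AD D a -> AD D b -> AD D (a + b).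
Proof. by move=> aD bD x; apply: (vgeD (cval_dval (C x))). Qed.

Lemma AD_M D E (a b : A) : AD D a -> AD E b -> AD (fun x => D x + E x) (a * b).
Proof. by move=> aD bE x; rewrite opprD; apply: (vgeM (cval_dval (C x))). Qed.

Lemma AD_ex (a : A) : exists2 E, fsup E & AD E a.
Proof.
exists (fun x => Num.max (- cv x (a x)) 0).
  apply: sub_finite_set (acomp_int a) => x /=; rewrite /vge negb_or.
  have [->|ax] /= := eqVneq (a x) 0; first by rewrite (dval0 (cval_dval (C x))) oppr0 maxxx eqxx.
  by lia.
by move=> x; rewrite /vge; case: eqVneq => //= _; lia.
Qed.

Section Filters.
Variables (T : Type) (F : set_system T).
Context {FF : Filter F}.
Implicit Types f g : T -> A.

Lemma tends_cst a : tends F (fun=> a) a.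
Proof. by move=> D _; apply: filterE => t; rewrite /= subrr => x; exact: vge0. Qed.

Lemma tendsD f g a b : tends F f a -> tends F g b -> tends F (fun t => f t + g t) (a + b).
Proof.
move=> fa gb D fD; apply: filterS2 (fa D fD) (gb D fD) => t /= ft gt.
by rewrite opprD addrACA; exact: AD_D.
Qed.

(** The error is (f - a) b + a (g - b) + (f - a)(g - b). The bound min(D, 0) on both factors serves
    the last product, as 2 min(D, 0) <= D. *)
Lemma tendsM f g a b : tends F f a -> tends F g b -> tends F (fun t => f t * g t) (a * b).
Proof.
move=> fa gb D fD; have [Da fDa aD] := AD_ex a; have [Db fDb bD] := AD_ex b.
have f1 : fsup (fun x => D x - Db x) by exact: fsupB.
have f2 : fsup (fun x => D x - Da x) by exact: fsupB.
have f3 : fsup (fun x => Num.min (D x) 0) by apply: (fsup1 (f := fun d => Num.min d 0)).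
apply: filterS2 (filterI (fa _ f1) (fa _ f3)) (filterI (gb _ f2) (gb _ f3)) => t /= [ft1 ft3]
  [gt2 gt3].
have -> : f t * g t - a * b = (f t - a) * b + (a * (g t - b) + (f t - a) * (g t - b)) by ring.
apply: AD_D; last apply: AD_D.
- by apply: AD_le (AD_M ft1 bD) => x; lia.
- by apply: AD_le (AD_M aD gt2) => x; lia.
- by apply: AD_le (AD_M ft3 gt3) => x; lia.
Qed.

Lemma tends_mulmx m n (f : T -> 'M[A]_(m, 2)) (g : T ->
  'M[A]_(2, n)) (a : 'M[A]_(m, 2)) (b : 'M[A]_(2, n)) :
  (forall i j, tends F (fun t => f t i j) (a i j)) ->
  (forall i j, tends F (fun t => g t i j) (b i j)) ->
  forall i j, tends F (fun t => (f t *m g t) i j) ((a *m b) i j).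
Proof.
move=> fa gb i j; rewrite mxE sum2.
rewrite (_ : (fun t => _) = (fun t => f t i 0 * g t 0 j + f t i 1 * g t 1 j)).
  by apply: tendsD; apply: tendsM.
by apply/funext => t; rewrite mxE sum2.
Qed.

End Filters.

Lemma tends_unique T (F : set_system T) (FF : ProperFilter F) f a b :
  tends F f a -> tends F f b -> a = b.
Proof.
move=> fa fb; apply: adeleP => x; apply/eqP; rewrite -subr_eq0; apply/negPn/negP => ab0.
pose D y : int := if y == x then - (cv x (a x - b x) + 1) else 0.
have fD : fsup D by apply: (fsup_of (s := [:: x])) => y; rewrite inE /D => /negbTE ->.
have [t [/= /(_ x) ta /(_ x) tb]] := filter_ex (filterI (fa _ fD) (fb _ fD)).
have := vgeB (cval_dval (C x)) tb ta; rewrite /D eqxx opprK /=.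
rewrite -[X in vge _ _ X]/(f t x - b x - (f t x - a x)) -subrB_chain.
by rewrite /vge (negbTE ab0) /= gerDl ler10.
Qed.

Lemma nbhs_AD D (a : A) : fsup D -> nbhs a [set b | AD D (b - a)].
Proof.
move=> fD; rewrite nbhsE; exists [set b : A | AD D (b - a)] => //; split; last first.
  by rewrite /= subrr => x; exact: vge0.
pose U x := [set c : C x | vge (cv x) (- D x) (c - a x)].
have UB : adele_box U.
  split=> [x c cU|].
    exists (- D x) => b bc; rewrite /U /=.
    by rewrite -[b](subrK c) -addrA; apply: (vgeD (cval_dval (C x))).
  have fin : finite_set ([set x | D x != 0] `|` [set x | ~~ vge (cv x) 0 (a x)]).
    by rewrite finite_setU; split; [exact: fD|exact: acomp_int].
  apply: sub_finite_set fin => x /= Ux; apply: contrapT => /not_orP[].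
  move=> /negP/negPn/eqP Dx /negP/negPn ax; apply: Ux.
  apply/seteqP; split=> c; rewrite /U /= Dx oppr0 => cx.
    by rewrite -[c](subrK (a x)); apply: (vgeD (cval_dval (C x))).
  exact: (vgeB (cval_dval (C x))).
exists [set [set b : A | forall x, U x (b x)]]; last first.
  by rewrite bigcup_set1.
move=> _ ->; exists [fset (U : forall x, set (C x))]%fset.
  by move=> V; rewrite inE => /eqP ->; rewrite in_setE.
apply/seteqP; split=> b.
  by move=> /(_ U); apply; rewrite /= inE.
by move=> bU V /=; rewrite inE => /eqP ->.
Qed.

Lemma nbhs_ADP (a : A) W : nbhs a W -> exists2 D, fsup D & [set b | AD D (b - a)] `<=` W.
Proof.
rewrite nbhsE => -[U0 [[Q QB <-] [V QV Va]] OW].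
have GF : Filter (filter_from [set D : place X ->
  int | fsup D] (fun D => [set b : A | AD D (b - a)])).
  apply: filter_from_filter; first by exists (fun=> 0); exact: fsup0.
  move=> D D' fD fD'; exists (fun x => Num.min (D x) (D' x)).
    exact: (fsup2 (f := fun d d' => Num.min d d')).
  by move=> b /= bD; split; apply: AD_le bD => x; lia.
suff [D fD DV] : filter_from [set D : place X ->
  int | fsup D] (fun D => [set b : A | AD D (b - a)]) V.
  by exists D => // b /DV Vb; apply: OW; exists V.
have [S SB VE] := QB V QV; move: Va; rewrite -VE => Va; apply: filter_bigI => U US.
have [Uo Uf] : adele_box U by have := SB U US; rewrite in_setE.
have aU : forall x, U x (a x) := Va U US.
have /choice[n nP] : forall x, exists n, [set c | vge (cv x) n (c - a x)] `<=` U x.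
  by move=> x; have [n nU] := Uo x (a x) (aU x); exists n.
exists (fun x => if `[< U x = [set c | vge (cv x) 0 c] >] then 0 else - n x).
  by apply: sub_finite_set Uf => x; rewrite /=; case: asboolP.
move=> b /= bD x; have := bD x; case: asboolP => [Ux|_]; last first.
  by rewrite opprK; exact: nP.
rewrite Ux oppr0 /= => bx; rewrite -[b x](subrK (a x)); apply: (vgeD (cval_dval (C x))) => //.
by have := aU x; rewrite Ux.
Qed.

Lemma tendsP T (F : set_system T) (FF : Filter F) (f : T -> A) a : tends F f a <-> f @ F --> a.
Proof.
split=> [fa W /nbhs_ADP[D fD DW]|fa D fD];
  first by apply: (@filterS _ F FF _ _ _ (fa D fD)) => t tD; apply: DW.
exact: fa (nbhs_AD a fD).
Qed.

Lemma filter_forall2 T (F : set_system T) (FF : Filter F) (P : 'I_2 -> 'I_2 -> set T) :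
  (forall i j, F (P i j)) -> F [set t | forall i j, P i j t].
Proof.
move=> FP; apply: (@filter_forall _ _ (fun i => [set t | forall j, P i j t])) => i.
exact: (@filter_forall _ _ (P i) _ _ (FP i)).
Qed.

Lemma GL2_cvgP T (F : set_system T) (FF : Filter F) (f : T ->
  GL2 A) (g : GL2 A) : (f @ F --> g) <->
  forall i j, tends F (fun t => f t i j) (g i j) /\ tends F (fun t => ginv (f t) i j) (ginv g i
    j).
Proof.
split=> [fg i j|fg W]; last first.
  rewrite nbhsE => -[V [[U oU <-] gU] VW].
  have : nbhs (gmx g, ginv g) U by exact: open_nbhs_nbhs.
  move=> [[U1 U2] /= [[P1 P1g U1P] [P2 P2g U2P]] UU].
  have : F [set t | forall i j, P1 i j (f t i j) /\ P2 i j (ginv (f t) i j)].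
    apply: filter_forall2 => i j; have [f1 f2] := fg i j; apply: filterI.
      by move/tendsP: f1; apply; exact: P1g.
    by move/tendsP: f2; apply; exact: P2g.
  apply: (@filterS _ F) => t tP; apply: VW; apply: UU; split => /=.
    by apply: U1P => i j; have [] := tP i j.
  by apply: U2P => i j; have [] := tP i j.
have cont : continuous (fun g : GL2 A => (gmx g, ginv g)) by exact: initial_continuous.
have fg' : (fun t => (gmx (f t), ginv (f t))) @ F --> (gmx g, ginv g).
  exact: cvg_comp fg (cont g).
have proj (m : 'M[A]_2) W : nbhs (m i j) W -> nbhs m [set m' : 'M[A]_2 | W (m' i j)].
  move=> Wm; exists (fun i' j' => if (i' == i) && (j' == j) then W else setT).
    by move=> i' j'; case: ifP => [/andP[/eqP -> /eqP ->] //|_]; exact: filterT.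
  by move=> m' /= /(_ i j); rewrite !eqxx.
split; apply/tendsP => W Wg.
  apply: (fg' [set p : 'M[A]_2 * 'M[A]_2 | W (p.1 i j)]).
  exists ([set m : 'M[A]_2 | W (m i j)], setT); last by move=> m [].
  by split; [exact: proj|exact: filterT].
apply: (fg' [set p : 'M[A]_2 * 'M[A]_2 | W (p.2 i j)]).
exists (setT, [set m : 'M[A]_2 | W (m i j)]); last by move=> m [].
by split; [exact: filterT|exact: proj].
Qed.

(** Compactness of O_A. For each D an ultrafilter of integral adeles picks one of finitely many
    cosets of A(min(D, 0)). The representatives for divisors supported at x have a Cauchy sequence
    of components at x, and its limit is the component sought. *)
Lemma tends_ultra T (F : set_system T) (f : T -> A) : UltraFilter F ->
  F [set t | adele_int (f t)] -> exists2 a, adele_int a & tends F f a.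
Proof.
move=> UF fint.
have /choice[r rP] : forall D, exists r, fsup D -> F [set t | AD D (f t - r)].
  move=> D; have [fD|] := pselect (fsup D); last by move=> h; exists 0.
  have f3 : fsup (fun x => Num.min (D x) 0) by apply: (fsup1 (f := fun d => Num.min d 0)).
  have le0 x : Num.min (D x) 0 <= 0 by lia.
  have [n [J [r [_ r0 rP]]] _] := idx_AD C f3 (fsup0 X) le0.
  apply: contrapT => /forallNP nF.
  have : F [set t | forall j, ~ AD D (f t - r j)].
    apply: (@filter_forall _ _ (fun j => [set t | ~ AD D (f t - r j)])) => j.
    by have [Fj|//] := in_ultra_setVsetC [set t | AD D (f t - r j)] UF; case: (nF (r j)).
  move=> /(filterI fint) /filter_ex[t [/aintP /rP[j [jD _]] /(_ j)]]; apply.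
  by apply: AD_le jD => x; lia.
have rD D D' : fsup D -> fsup D' -> exists t, AD D (f t - r D) /\ AD D' (f t - r D').
  by move=> fD fD'; have [t] := filter_ex (filterI (rP D fD) (rP D' fD')); exists t.
pose d (x : place X) (n : nat) (y : place X) : int := if y == x then - n%:Z else 0.
have fd x n : fsup (d x n) by apply: (fsup_of (s := [:: x])) => y; rewrite inE /d => /negbTE ->.
have close x n D : fsup D -> vge (cv x) (Num.min n%:Z (- D x)) (r (d x n) x - r D x).
  move=> fD; have [t [/(_ x) tn /(_ x) tD]] := rD _ _ (fd x n) fD.
  rewrite (subrB_chain (f t x)).
  apply: (vgeB (cval_dval (C x))); first by apply: vge_le tD; lia.
  by apply: vge_le tn; rewrite /d eqxx; lia.
have exl x : exists l, forall n : int, exists N : nat, forall i : nat,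
       (N <= i)%N -> vge (cv x) n (r (d x i) x - l).
  apply: cval_complete => n; exists `|n|%N => i j ni nj.
  by have := close x i (d x j) (fd x j); apply: vge_le; rewrite /d eqxx; lia.
pose l x := sval (cid (exl x)).
have lP x : forall n : int, exists N : nat, forall i : nat, (N <= i)%N ->
    vge (cv x) n (r (d x i) x - l x) := svalP (cid (exl x)).
have lim D x : fsup D -> vge (cv x) (- D x) (r D x - l x).
  move=> fD; have [N NP] := lP x (- D x).
  rewrite (subrB_chain (r (d x (maxn N `|D x|)) x)).
  apply: (vgeB (cval_dval (C x))); first by apply: NP; lia.
  by apply: vge_le (close x (maxn N `|D x|) D fD); lia.
have lint x : vge (cv x) 0 (l x).
  have [t [/= /aintP/(_ x) tx /(_ x) /= tr]] := filter_ex (filterI fint (rP _ (fsup0 X))).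
  have := lim _ x (fsup0 X); rewrite /= oppr0 in tx tr *.
  move=> h; rewrite -[l x](subKr (r (fun=> 0) x)); apply: (vgeB (cval_dval (C x))) => //.
  by rewrite -[r _ x](subKr (f t x)); apply: (vgeB (cval_dval (C x))).
have fin : finite_set [set x | ~~ vge (cv x) 0 (l x)].
  by apply: (sub_finite_set (B := set0)) => // x /=; rewrite lint.
exists (Adele fin); first exact: lint.
move=> D fD; apply: filterS (rP D fD) => t tD x.
have -> : (f t - Adele fin) x = f t x - r D x + (r D x - l x) by rewrite addrA subrK.
by apply: (vgeD (cval_dval (C x))); [exact: tD|exact: lim].
Qed.

Lemma GL2_mul_continuous (a : GL2 A) : continuous (fun g : GL2 A => (a * g)%g).
Proof.
move=> g; apply: (proj2 (GL2_cvgP (nbhs_filter g) _ _)) => i j.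
have /(proj1 (GL2_cvgP (nbhs_filter g) _ _)) gg : (fun h : GL2 A => h) @ nbhs g --> g by exact:
  cvg_id.
split; apply: tends_mulmx => {i j} i j; first exact: tends_cst.
- by have [] := gg i j.
- by have [] := gg i j.
- exact: tends_cst.
Qed.

Lemma kO_nbhs (g : GL2 A) : nbhs g [set h | kO (g^-1 * h)%g].
Proof.
have kO1 : nbhs (1%g : GL2 A) (@kO _ _ C).
  have /(proj1 (GL2_cvgP (nbhs_filter _) _ _)) gg : (fun h : GL2 A => h) @ nbhs (1%g :
    GL2 A) --> (1%g : GL2 A) by exact: cvg_id.
  apply: filter_forall2 => i j; have [g1 g2] := gg i j.
  have int1 : adele_int ((1%:M : 'M[A]_2) i j).
    by rewrite mxE; case: (_ == _); [exact: aint1|exact: aint0].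
  apply: filterS (filterI (g1 _ (fsup0 X)) (g2 _ (fsup0 X))) => t /= [t1 t2].
  have sub a (b : A) : adele_int a -> AD (fun=> 0) (b - a) -> adele_int b.
    by move=> ai /aintP bi; rewrite -[b](subrK a); exact: aintD.
  by split; [exact: sub t1|exact: sub t2].
have := @GL2_mul_continuous g^-1%g g; rewrite /continuous_at mulVg; exact.
Qed.

(** Along an ultrafilter the entries of g and of its inverse have integral limits, and the limit
    matrices are still inverse to each other. *)
Lemma kO_compact : compact (@kO _ _ C).
Proof.
rewrite compact_ultra => F UF FkO.
have ex1 i j : exists2 a, adele_int a & tends F (fun g : GL2 A => g i j) a.
  by apply: tends_ultra; apply: filterS FkO => g /(_ i j)[].
have ex2 i j : exists2 a, adele_int a & tends F (fun g : GL2 A => ginv g i j) a.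
  by apply: tends_ultra; apply: filterS FkO => g /(_ i j)[].
pose m := \matrix_(i, j) sval (cid2 (ex1 i j)).
pose m' := \matrix_(i, j) sval (cid2 (ex2 i j)).
have mP i j : adele_int (m i j) /\ tends F (fun g : GL2 A => g i j) (m i j).
  by rewrite mxE; case: cid2.
have mP' i j : adele_int (m' i j) /\ tends F (fun g : GL2 A => ginv g i j) (m' i j).
  by rewrite mxE; case: cid2.
have mm' : m *m m' = 1%:M.
  apply/matrixP => i j; apply: (tends_unique (F := F)).
    by apply: tends_mulmx => i' j'; [exact: (mP i' j').2|exact: (mP' i' j').2].
  by rewrite (_ : (fun t => _) = (fun=> (1%:M : 'M[A]_2) i j));
    [exact: tends_cst|apply/funext => t; rewrite gmxK].
have m'm : m' *m m = 1%:M.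
  apply/matrixP => i j; apply: (tends_unique (F := F)).
    by apply: tends_mulmx => i' j'; [exact: (mP' i' j').2|exact: (mP i' j').2].
  by rewrite (_ : (fun t => _) = (fun=> (1%:M : 'M[A]_2) i j));
    [exact: tends_cst|apply/funext => t; rewrite ginvK].
exists (MkGL2 mm' m'm); split.
  by move=> i j; split; [exact: (mP i j).1|exact: (mP' i j).1].
by apply: (proj2 (@GL2_cvgP _ F _ (fun g => g) _)) => i j; split;
  [exact: (mP i j).2|exact: (mP' i j).2].
Qed.

End AdeleLimits.

(** * Right K-invariant sets and the quotient of the torus *)

Section PGLTopology.
Variables (k : finFieldType) (X : curve k).
Variable C : forall x : place X, completion x.
Local Notation A := (adele C).
Local Notation P := (PGL2A C).
Local Open Scope quotient_scope.

Lemma pgl_continuous : continuous (@pgl _ _ C : GL2 A -> P).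
Proof. exact: pi_continuous. Qed.

Definition rKinv (U : set P) := forall p a, U p -> PGL2O C a -> U (p * a)%g.

Lemma rKinvC U : rKinv U -> rKinv (~` U).
Proof. by move=> UK p a nU aO Upa; apply: nU; rewrite -(mulgK a p); apply: UK => //;
  exact: PGL2OV. Qed.

(** K is open, so unions of cosets p K are open; applied to complements, they are closed as well. *)
Lemma rKinv_open U : rKinv U -> open U.
Proof.
move=> UK; suff : open ((@pgl _ _ C : GL2 A -> P) @^-1` U) by [].
rewrite openE => g Ug; apply: filterS (kO_nbhs g) => h /= gh.
rewrite -[h](mulVKg g) pglMg; apply: UK => //.
by apply/PGL2OP; exists (g^-1 * h)%g.
Qed.

Lemma rKinv_closed U : rKinv U -> closed U.
Proof. by move=> UK; rewrite -[U]setCK closedC; apply: rKinv_open; exact: rKinvC. Qed.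

Definition coset p : set P := [set q | exists2 a, PGL2O C a & q = (p * a)%g].

Lemma coset_rKinv p : rKinv (coset p).
Proof. by move=> q b [a aO ->] bO; exists (a * b)%g; [exact: PGL2OM|rewrite mulgA]. Qed.

Lemma coset_refl p : coset p p.
Proof. by exists 1%g; [exact: PGL2O1|rewrite mulg1]. Qed.

Lemma coset_compact p : compact (coset p).
Proof.
have [g gE] := pgl_surj p.
rewrite (_ : coset p = (fun h : GL2 A => pgl (g * h)%g) @` @kO _ _ C).
  apply: continuous_compact; last exact: kO_compact.
  apply: continuous_subspaceT => h.
  apply: (@continuous_comp _ _ _ (fun h : GL2 A => (g * h)%g) (@pgl _ _ C : GL2 A -> P)).
    exact: GL2_mul_continuous.
  exact: pgl_continuous.
apply/seteqP; split=> q.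
  by move=> [a /PGL2OP[b bO ->] ->]; exists b => //; rewrite pglMg gE.
by move=> [b bO <-]; exists (pgl b); [apply/PGL2OP; exists b|rewrite pglMg gE].
Qed.

Variable E : const_ext X.

(** The torus is closed: its elements are the matrices that can be rebuilt from their action on
    [e1], a condition preserved by limits. *)
Lemma torA'_kO_compact : compact (@kO _ _ C `&` torA' E C).
Proof.
rewrite compact_ultra => F UF FA.
have := @kO_compact _ _ C; rewrite compact_ultra => /(_ F UF) [|g [gO Fg]].
  by apply: filterS FA => g [].
exists g; split=> //; split=> //; apply/torA'P.
have /(@GL2_cvgP _ _ _ _ F _ (fun g => g)) gg := Fg.
have ge1 i j : tends F (fun h :
  GL2 A => (h *m map_mx (dia C) (e1 E)) i j) ((g *m map_mx (dia C) (e1 E)) i j).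
  by apply: tends_mulmx => i' j'; [have [] := gg i' j'|exact: tends_cst].
exists (fun i => (g *m map_mx (dia C) (e1 E)) i 0); apply/matrixP => i j.
have [gij _] := gg i j; apply: (tends_unique _ gij).
have lim : tends F (fun h : GL2 A => tmx E (fun i => (h *m map_mx (dia C) (e1 E)) i 0) i j)
    (tmx E (fun i => (g *m map_mx (dia C) (e1 E)) i 0) i j).
  rewrite tmxE sum2; rewrite (_ : (fun h => _) = (fun h : GL2 A =>
    (h *m map_mx (dia C) (e1 E)) 0 0 * dia C (mulE_mx (cbasis E)`_0 i j) +
    (h *m map_mx (dia C) (e1 E)) 1 0 * dia C (mulE_mx (cbasis E)`_1 i j))).
    by apply: tendsD; apply: tendsM => //; exact: tends_cst.
  by apply/funext => h; rewrite tmxE sum2.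
move=> D fD; apply: filterS2 (lim D fD) FA => h /= hD [_ /torA'P[a ha]].
move: hD; rewrite (_ : tmx E (fun i => (h *m _) i 0) = gmx h) // ha.
by congr tmx; apply/funext => l; rewrite tmx_e1.
Qed.

Local Notation TA := (TA E C).
Local Notation TFA := (TFA E C).

Definition tA p (tp : torA E C p) : TA := exist _ p (mem_set tp).

Lemma TA_torA (t : TA) : torA E C (val t). Proof. by case: t => p /= /set_mem. Qed.

Lemma TA_eq (t s : TA) : val t = val s -> t = s. Proof. exact: val_inj. Qed.

Definition tpi (t : TA) : TFA := \pi t.

Lemma tpi_surj u : exists t, u = tpi t.
Proof. by exists (repr u); rewrite /tpi reprK. Qed.

Lemma tpi_eqP t s : tpi t = tpi s <-> exists2 c, torF E C c & val t = (c * val s)%g.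
Proof.
split=> [/eqmodP/asboolP ts|[c cF ts]].
  have : [set (c * val t)%g | c in torF E C] (val t) by exists 1%g; [exact: torF1|rewrite mul1g].
  by rewrite ts => -[c cF <-]; exists c.
apply/eqmodP/asboolP; apply/seteqP; split=> _ [d dF <-].
  by rewrite ts mulgA; exists (d * c)%g => //; exact: torF_M.
exists (d * c^-1)%g; first by apply: torF_M => //; exact: torF_V.
by rewrite ts mulgA mulgVK.
Qed.

Lemma trepr_tpi t : exists2 c, torF E C c & trepr (tpi t) = (c * val t)%g.
Proof. by apply/tpi_eqP; rewrite /tpi reprK. Qed.

Lemma ttransE t s : ttrans t (tpi s) = tpi (tA (torA_M (TA_torA t) (TA_torA s))).
Proof.
apply/tpi_eqP; have [c cF rE] := trepr_tpi s.
exists c => //; rewrite insubdK rE; last first.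
  by apply: mem_set; apply: torA_M; [exact: TA_torA|apply: torA_M;
    [exact: torF_torA|exact: TA_torA]].
by rewrite /= !mulgA (torA_comm (TA_torA t) (torF_torA cF)).
Qed.

(** Stability under K_T, the intersection of K with T(A), phrased on representatives in T(A). *)
Definition KTinv (U : set TFA) := forall t s : TA, U (tpi t) ->
  (exists2 a, PGL2O C a & val s = (val t * a)%g) -> U (tpi s).

(** Since T(A) carries the subspace topology, the preimage has to be cut out by an open subset of
    PGL_2(A); the union of its K-cosets serves. *)
Lemma KTinv_open U : KTinv U -> open U.
Proof.
move=> UK; suff : open (tpi @^-1` U) by [].
pose V : set P := [set p | exists t, U (tpi t) /\ coset (val t) p].
exists V.
  apply: rKinv_open => p a [t [Ut tp]] aO; exists t; split => //; exact: coset_rKinv.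
apply/seteqP; split=> t /=; last by move=> Ut; exists t; split=> //; exact: coset_refl.
by move=> [s [Us [a aO ta]]]; apply: UK Us _; exists a.
Qed.

(** The image of t K_T in T(F)\T(A). *)
Definition KTc (t : TA) : set TFA := [set u | exists2 s, coset (val t) (val s) & u = tpi s].

Lemma KTc_inv t : KTinv (KTc t).
Proof.
move=> t' s' [s ts /tpi_eqP[c cF tE]] [a aO sE].
have cs : torA E C (c^-1 * val s')%g.
  by apply: torA_M; [apply: torA_V; exact: torF_torA|exact: TA_torA].
exists (tA cs) => /=.
  by rewrite sE tE !mulgA mulVg mul1g; exact: coset_rKinv.
by apply/tpi_eqP; exists c => //=; rewrite mulgA mulgV mul1g.
Qed.

Lemma torA_pgl g : torA E C (pgl g) -> torA' E C g.
Proof.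
move=> [t tT /pgl_eqP[z [a za] ->]]; have /torA'P[b tb] := tT.
by apply/torA'P; exists (fun s => a * b s); rewrite -tmxZ -tb /= za mul_scalar_mx.
Qed.

Lemma KTc1_compact : compact (KTc (TA_one E C)).
Proof.
pose f (h : GL2 A) : TFA := tpi (insubd (TA_one E C) (pgl h)).
rewrite (_ : KTc _ = f @` (@kO _ _ C `&` torA' E C)); last first.
  apply/seteqP; split=> u.
    move=> [s [a /PGL2OP[q qO ->]] /=]; rewrite mul1g => sE ->.
    exists q; first by split=> //; apply: torA_pgl; rewrite -sE; exact: TA_torA.
    by congr tpi; apply: TA_eq; rewrite insubdK // -sE; apply: mem_set; exact: TA_torA.
  move=> [q [qO qT] <-]; exists (insubd (TA_one E C) (pgl q)) => //.
  rewrite insubdK; last by apply: mem_set; exists q.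
  by exists (pgl q); [apply/PGL2OP; exists q|rewrite mul1g].
apply: continuous_compact; last exact: torA'_kO_compact.
apply/subspace_continuousP => h hA W; rewrite nbhsE => -[V [oV Vh] VW].
have [Q oQ QV] : open (tpi @^-1` V) by exact: oV.
have val_f h' : (@kO _ _ C `&` torA' E C) h' -> val (insubd (TA_one E C) (pgl h')) = pgl h'.
  by move=> [_ hT]; rewrite insubdK //; apply: mem_set; exists h'.
have tV (t : TA) : Q (val t) <-> V (tpi t) by rewrite -[V (tpi t)]/((tpi @^-1` V) t) -QV.
have Qh : nbhs h (@pgl _ _ C @^-1` Q).
  apply: pgl_continuous; apply: open_nbhs_nbhs; split => //.
  by rewrite -val_f //; apply/tV.
apply: filterS Qh => h' Qh' h'A; apply: VW; apply/tV; rewrite val_f //.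
Qed.

Lemma coset_1 : coset 1%g = PGL2O C.
Proof. by apply/seteqP; split=> [p [a aO ->]|p pO]; [rewrite mul1g|exists p; rewrite ?mul1g]. Qed.

Lemma KTc_cover : exists2 L : set TA, finite_set L & forall u, exists2 t, L t & KTc t u.
Proof.
have [L Lf LP] := torus_classes E C.
(* The elements of [L] need not lie in the torus. For a coset l K that meets it, [r l] is the
   inverse of an element of the intersection, since t agrees with w^-1 modulo T(F). *)
have /choice[r rP] : forall l : GL2 A, exists t : TA,
    (exists2 w, torA' E C w & exists2 q, kO q & w = (l * q)%g) ->
    exists w, [/\ torA' E C w, exists2 q, kO q & w = (l * q)%g & val t = (pgl w)^-1%g].
  move=> l; have [[w wT wl]|nw] := pselect (exists2 w, torA' E C w & exists2 q,
    kO q & w = (l * q)%g).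
    have tw : torA E C (pgl w)^-1%g by apply: torA_V; exists w.
    by exists (tA tw) => _; exists w.
  by exists (TA_one E C).
exists (r @` L); first exact: finite_image.
move=> u; have [t ->] := tpi_surj u; have [g gT gE] := TA_torA t.
have [l [q [w [z [z0 [Ll qO wT wE tE]]]]]] := LP g gT.
have [|w1 [w1T [q1 q1O w1E] rE]] := rP l; first by exists w => //; exists q.
exists (r l); first by exists l.
have kT : torA E C (pgl w1 * (pgl w)^-1)%g.
  by apply: torA_M; [exists w1|apply: torA_V; exists w].
exists (tA (torA_M (TA_torA (r l)) kT)) => /=.
  exists (pgl w1 * (pgl w)^-1)%g => //.
  rewrite (@torA_comm _ _ E) //; [|by exists w1|by apply: torA_V; exists w].
  rewrite wE w1E !pglMg invgM mulgA mulgVK; apply: PGL2OM.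
    by apply: PGL2OV; apply/PGL2OP; exists q.
  by apply/PGL2OP; exists q1.
apply/tpi_eqP; exists (pgl (torG C z0)); first by exists (torG C z0) => //; apply/torF'P;
  exists z, z0.
by rewrite /= rE mulKg -gE tE pglVg.
Qed.

End PGLTopology.

(** * Toroidal functions *)

Section Integration.
Variables (R : realType) (d : measure_display) (T : measurableType d).
Variable mu : {measure set T -> \bar R}.
Implicit Types (u v : T -> complex R) (f : T -> R).

Definition cintegrable u := mu.-integrable setT (EFin \o (fun x => complex.Re (u x))) /\
  mu.-integrable setT (EFin \o (fun x => complex.Im (u x))).

Lemma finite_bounded (B : set R) : finite_set B -> exists M, forall r, B r -> `|r| <= M.
Proof.
move=> /finite_seqP[s ->]; exists (\sum_(r <- s) `|r|) => r /= rs.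
by rewrite (big_rem r) //= lerDl sumr_ge0.
Qed.

Lemma step_integrable (g : T -> R) : (forall W, measurable (g @^-1` W)) -> finite_set (range g) ->
  (mu [set x | g x <> 0%R] < +oo)%E -> mu.-integrable setT (EFin \o g).
Proof.
move=> gm gf gA; have mA : measurable [set x | g x <> 0] := gm [set~ (0 : R)].
have : mu.-integrable [set x | g x <> 0] (EFin \o g).
  apply: measurable_bounded_integrable => //.
    by move=> _ W _; apply: measurableI => //; exact: gm.
  have [M MP] := finite_bounded gf.
  exists M; split; first exact: num_real.
  by move=> N MN x _; apply: ltW; apply: le_lt_trans MN; apply: MP; exists x.
move=> /(integrable_mkcond _ mA); apply: eq_integrable => // x _.
rewrite patchE; case: ifPn => //; rewrite notin_setE /=.
by move=> /contrapT ->.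
Qed.

(** Preimages of arbitrary sets are asked to be measurable: this holds for locally constant
    functions and passes to real and imaginary parts without a Borel structure on the complex
    numbers. *)
Definition step u := [/\ forall W, measurable (u @^-1` W), finite_set (range u)
  & (mu [set x | u x <> 0%R] < +oo)%E].

Lemma step_cintegrable u : step u -> cintegrable u.
Proof.
move=> [um uf uA].
have gen (p : complex R -> R) : p 0 = 0 -> mu.-integrable setT (EFin \o (p \o u)).
  move=> p0; apply: step_integrable.
  - by move=> W; rewrite comp_preimage; exact: um.
  - by have := finite_image p uf; rewrite image_comp.
  - apply: le_lt_trans uA; apply: le_measure.
    + by apply: mem_set; exact: (um [set z | p z <> 0]).
    + by apply: mem_set; exact: (um [set z | z <> 0]).
    by move=> x /= pu0 u0; apply: pu0; rewrite u0.
by split; exact: gen.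
Qed.

Lemma cintegralD u v : cintegrable u -> cintegrable v ->
  cintegral mu (fun x => u x + v x) = cintegral mu u + cintegral mu v.
Proof.
move=> [u1 u2] [v1 v2]; rewrite /cintegral; apply/eqP; rewrite eq_complex /=; apply/andP;
  split; apply/eqP.
  by rewrite -RintegralD //; apply: eq_Rintegral => x _; case: (u x) (v x) => ? ? [].
by rewrite -RintegralD //; apply: eq_Rintegral => x _; case: (u x) (v x) => ? ? [].
Qed.

Lemma integrableZ (a : R) f : mu.-integrable setT (EFin \o f) ->
  mu.-integrable setT (EFin \o (fun x => a * f x)).
Proof. by move=> fi; exact: (integrableZl measurableT a fi). Qed.

Lemma cintegralZ (c : complex R) u : cintegrable u ->
  cintegral mu (fun x => c * u x) = c * cintegral mu u.
Proof.
case: c => a b [u1 u2]; rewrite /cintegral; apply/eqP; rewrite eq_complex /=; apply/andP;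
  split; apply/eqP.
  rewrite -!RintegralZl // -RintegralB //; try exact: integrableZ.
  by apply: eq_Rintegral => x _; case: (u x).
rewrite -!RintegralZl // -RintegralD //; try exact: integrableZ.
by apply: eq_Rintegral => x _; case: (u x).
Qed.

Lemma cintegral_indic (B : set T) (c : complex R) : measurable B ->
  cintegral mu (fun x => if `[< B x >] then c else 0) = c * (fine (mu B))%:C%C.
Proof.
move=> mB; have gen (r : R) : \int[mu]_x (if `[< B x >] then r else 0) = r * fine (mu B).
  rewrite -Rintegral_cst // [RHS]Rintegral_mkcond; apply: eq_Rintegral => x _.
  by rewrite patchE; case: asboolP => h; [rewrite mem_set|rewrite memNset].
rewrite /cintegral; case: c => a b; apply/eqP; rewrite eq_complex /= !mulr0 subr0 add0r.
apply/andP; split; apply/eqP; rewrite -gen; apply: eq_Rintegral => x _; by case: ifP.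
Qed.

Lemma cintegral_eq u v : u =1 v -> cintegral mu u = cintegral mu v.
Proof. by move=> /funext ->. Qed.

Lemma measure_cover (I : choiceType) (s : seq I) (F : I -> set T) (m : \bar R) :
  (forall i, measurable (F i)) -> (forall i, mu (F i) = m) ->
  (mu (\big[setU/set0]_(i <- s) F i) <= (size s)%:R%:E * m)%E.
Proof.
move=> Fm FE; elim: s => [|i s IH]; first by rewrite big_nil measure0 mul0e.
have m0 : (0 <= m)%E by rewrite -(FE i).
rewrite big_cons /= -natr1 EFinD ge0_muleDl ?lee_fin // mul1e addeC.
apply: le_trans (leeD2l _ IH).
rewrite -{1}(FE i); apply: measureU2 => //; exact: bigsetU_measurable.
Qed.

End Integration.

(** * Haar measures, Hecke operators and the toroidal condition *)

Section ToroidalSpace.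
Variables (R : realType) (k : finFieldType) (X : curve k) (E : const_ext X).
Variable C : forall x : place X, completion x.
Variable mu : {measure set (borel (PGL2A C)) -> \bar R}.
Variable dt : {measure set (borel (TFA E C)) -> \bar R}.
Local Notation A := (adele C).
Local Notation P := (PGL2A C).
Hypothesis mu_haar : is_haar (fun g h : P => (g * h)%g) mu.
Hypothesis mu_K : mu (PGL2O C) = 1%E.
Hypothesis dt_haar : is_haar (@ttrans _ _ E C) dt.
Implicit Types (f Phi : P -> complex R) (p g h : P).

Lemma rKinv_measurable (U : set P) : rKinv U -> measurable (U : set (borel P)).
Proof. by move=> /rKinv_open oU; exact: sub_sigma_algebra. Qed.

Lemma KTinv_measurable (U : set (TFA E C)) : KTinv U -> measurable (U : set (borel (TFA E C))).
Proof. by move=> /KTinv_open oU; exact: sub_sigma_algebra. Qed.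

Lemma mu_translate (U : set P) g : rKinv U -> mu [set h | U (g * h)%g] = mu U.
Proof.
by move=> UK; have [_ _ inv] := mu_haar; rewrite -(inv g U) //; exact: rKinv_measurable.
Qed.

Lemma mu_coset p : mu (coset p) = 1%E.
Proof.
rewrite -mu_K -coset_1 -(mu_translate p^-1%g (@coset_rKinv _ _ C 1%g)); congr (mu _).
apply/seteqP; split=> q; rewrite /coset /=.
  by move=> [a aO ->]; exists a => //; rewrite mulKg mul1g.
by move=> [a aO qa]; exists a => //; rewrite -[q](mulVKg p) qa mul1g.
Qed.

Lemma rK_compact_mu (U : set P) : rKinv U -> compact U -> (mu U < +oo)%E.
Proof. by move=> UK Uc; have [_ fin _] := mu_haar; apply: fin => //; exact: rKinv_measurable. Qed.

Lemma compact_cosets (U : set P) : compact U ->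
  exists2 L : set P, finite_set L & forall p, U p -> exists2 q, L q & coset q p.
Proof.
rewrite compact_cover => /(_ P setT (@coset _ _ C)) [].
- by move=> p _; apply: rKinv_open; exact: coset_rKinv.
- by move=> p _; exists p => //; exact: coset_refl.
move=> L _ LP; exists [set` L]; first exact: finite_fset.
by move=> p /LP [q Lq pq]; exists q.
Qed.

Definition rKfun f := forall p a, PGL2O C a -> f (p * a)%g = f p.

(** The support is closed and compact, hence covered by finitely many cosets p K, on each of which f
    is constant. *)
Lemma rKfun_step f : rKfun f -> compact (closure [set p | f p != 0]) -> step mu (f : borel P ->
  _).
Proof.
move=> fK fc.
have inv W : rKinv (f @^-1` W) by move=> p a /= Wp aO; rewrite fK.
have suppE : [set p | f p <> 0] = [set p | f p != 0].
  by apply/seteqP; split=> p /= /eqP.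
have suppK : rKinv [set p | f p != 0] by move=> p a /= fp aO; rewrite fK.
have sc : compact [set p | f p != 0].
  by move: fc; rewrite -((closure_id _).1 (rKinv_closed suppK)).
split=> [W||].
- exact: rKinv_measurable.
- have [L Lf LP] := compact_cosets sc.
  apply: (@sub_finite_set _ _ ([set 0] `|` f @` L)).
    move=> _ [p _ <-]; have [fp0|/eqP fp0] := eqVneq (f p) 0; [by left|right].
    by have [|q Lq [a aO ->]] := LP p; [apply/eqP|exists q; rewrite ?fK].
  by rewrite finite_setU; split; [exact: finite_set1|exact: finite_image].
- by rewrite suppE; exact: rK_compact_mu.
Qed.

Definition automorphic f := forall g c a, PGL2F C c -> PGL2O C a -> f (c * g * a)%g = f g.

Lemma automorphic_rK f : automorphic f -> rKfun f.
Proof. by move=> fa p a aO; have := fa p 1%g a (@PGL2F1 _ _ C) aO; rewrite mul1g. Qed.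

Lemma automorphic_lF f g c : automorphic f -> PGL2F C c -> f (c * g)%g = f g.
Proof. by move=> fa cF; have := fa g c 1%g cF (@PGL2O1 _ _ C); rewrite mulg1. Qed.

Lemma hecke_rK Phi : hecke_algebra Phi -> rKfun Phi.
Proof. by move=> [_ _ bi] p a aO; have := bi p 1%g a (@PGL2O1 _ _ C) aO; rewrite mul1g. Qed.

Lemma hecke_step Phi f g : hecke_algebra Phi -> automorphic f ->
  step mu (fun h : borel P => Phi h * f (g * h)%g).
Proof.
move=> HP fa; apply: (@rKfun_step (fun h => Phi h * f (g * h)%g)).
  by move=> p a aO /=; rewrite (hecke_rK HP) // mulgA (automorphic_rK fa (g * p)%g aO).
have [_ cP _] := HP; apply: (subclosed_compact _ cP); first exact: closed_closure.
by apply: closureS => p /=; rewrite mulf_eq0 negb_or => /andP[].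
Qed.

Lemma hecke_act_lin Phi f f' (c : complex R) g : hecke_algebra Phi -> automorphic f ->
  automorphic f' ->
  hecke_act mu Phi (fun p => c * f p + f' p) g = c * hecke_act mu Phi f g + hecke_act mu Phi f' g.
Proof.
move=> HP fa fa'; have sf := hecke_step g HP fa.
have scf : automorphic (fun p => c * f p) by move=> h d a dF aO; rewrite fa.
have s1 := step_cintegrable (hecke_step g HP scf).
have s2 := step_cintegrable (hecke_step g HP fa').
rewrite /hecke_act -(cintegralZ c (step_cintegrable sf)).
have -> : cintegral mu (fun h : borel P => c * (Phi h * f (g * h)%g)) =
    cintegral mu (fun h : borel P => Phi h * (c * f (g * h)%g)).
  by apply: cintegral_eq => h; rewrite mulrCA.
by rewrite -cintegralD //; apply: cintegral_eq => h; rewrite mulrDr.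
Qed.

Lemma mul_continuous g : continuous (fun h : P => (g * h)%g).
Proof.
apply/continuousP => V oV; have [g0 ->] := pgl_surj g.
suff : open ((@pgl _ _ C : GL2 A -> P) @^-1` ((fun h : P => (pgl g0 * h)%g) @^-1` V)) by [].
rewrite (_ : _ @^-1` _ = (fun h : GL2 A => (g0 * h)%g) @^-1` ((@pgl _ _ C : GL2 A -> P) @^-1` V)).
  by move/continuousP: (@GL2_mul_continuous _ _ C g0); apply; exact: oV.
by apply/seteqP; split=> h /=; rewrite pglMg.
Qed.

Lemma mul_measurable g : measurable_fun setT ((fun h : borel P => (g * h)%g) : borel P ->
  borel P).
Proof.
apply: (measurability (@open P : set (set (borel P)))) => // _ [V oV <-]; rewrite setTI.
apply: sub_sigma_algebra; move/continuousP: (@mul_continuous g); apply; exact: oV.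
Qed.

Lemma cintegral_translate (u : P -> complex R) g : step mu (u : borel P -> _) ->
  cintegral mu (fun h : borel P => u (g * h)%g) = cintegral mu (u : borel P -> _).
Proof.
move=> su; have [um _ _] := su; pose phi : borel P -> borel P := fun h => (g * h)%g.
have mphi : measurable_fun setT phi by exact: mul_measurable.
have mu_inv (B : set (borel P)) : measurable B -> mu (phi @^-1` B) = mu B.
  by move=> mB; have [_ _ inv] := mu_haar; exact: inv.
have sphi : step mu (u \o phi).
  have [_ uf uA] := su; split.
  - by move=> W; rewrite comp_preimage; have := mphi measurableT _ (um W); rewrite setTI.
  - by apply: sub_finite_set uf => _ [h _ <-]; exists (phi h).
  - by have := mu_inv [set x | u x <> 0] (um [set z | z <> 0]); rewrite /= => ->.
have [i1 i2] := step_cintegrable sphi.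
have gen (p : complex R -> R) : (forall W, measurable ((p \o u : borel P -> R) @^-1` W)) ->
    mu.-integrable setT (EFin \o (p \o (u \o phi))) ->
    \int[mu]_h p (u (g * h)%g) = \int[mu]_h p (u h).
  move=> mp ip; rewrite /Rintegral; congr fine.
  have := @integral_pushforward _ _ _ _ R phi mphi mu setT (EFin \o (p \o u)).
  rewrite preimage_setT => <- //; last first.
    by move=> _ W _; rewrite setTI; exact: (mp [set r | W r%:E]).
  by apply: eq_measure_integral => B mB _; exact: mu_inv.
by rewrite /cintegral; congr Complex; apply: gen => // W; rewrite comp_preimage; exact: um.
Qed.

(** Translation of the variable of integration by a, under which Phi is invariant. *)
Lemma hecke_act_K Phi f g a : hecke_algebra Phi -> automorphic f -> PGL2O C a ->
  hecke_act mu Phi f (g * a)%g = hecke_act mu Phi f g.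
Proof.
move=> HP fa aO; rewrite /hecke_act -(cintegral_translate a (hecke_step g HP fa)).
apply: cintegral_eq => h; rewrite mulgA; congr (_ * _).
by have [_ _ bi] := HP; have := bi h a 1%g aO (@PGL2O1 _ _ C); rewrite mulg1.
Qed.

Lemma hecke_act_F Phi f g c : automorphic f -> PGL2F C c ->
  hecke_act mu Phi f (c * g)%g = hecke_act mu Phi f g.
Proof.
by move=> fa cF; apply: cintegral_eq => h; rewrite -mulgA (automorphic_lF (g * h)%g fa cF).
Qed.

Lemma KTc_translate (t : TA E C) :
  KTc t = ttrans (tA (torA_V (TA_torA t))) @^-1` KTc (TA_one E C).
Proof.
have VE s : val (tA (torA_M (TA_torA (tA (torA_V (TA_torA t)))) (TA_torA s))) = ((val t)^-1 *
  val s)%g by [].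
apply/seteqP; split=> u; have [s ->] := tpi_surj u; rewrite /preimage /= ttransE.
  move=> [r tr /tpi_eqP[c cF sE]];
    exists (tA (torA_M (TA_torA (tA (torA_V (TA_torA t)))) (TA_torA r))).
    have [a aO rE] := tr; exists a => //; by rewrite VE rE mulKg mul1g.
  apply/tpi_eqP; exists c => //; rewrite !VE sE !mulgA; congr (_ * _)%g.
  by apply: (@torA_comm _ _ E) => //; [apply: torA_V; exact: TA_torA|exact: torF_torA].
move=> [r [a aO rE] /tpi_eqP[c cF]]; rewrite VE => sE.
exists (tA (torA_M (TA_torA t) (TA_torA r))).
  by exists a => //=; rewrite rE mul1g.
apply/tpi_eqP; exists c => //=; rewrite -[val s](mulVKg (val t)) sE !mulgA; congr (_ * _)%g.
by apply: (@torA_comm _ _ E) => //; [exact: TA_torA|exact: torF_torA].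
Qed.

Lemma dt_KTc t : dt (KTc t) = dt (KTc (TA_one E C)).
Proof.
by have [_ _ inv] := dt_haar; rewrite KTc_translate; apply: inv; apply: KTinv_measurable;
  exact: KTc_inv.
Qed.

Lemma dt_KTc_fin t : (dt (KTc t) < +oo)%E.
Proof.
rewrite dt_KTc; have [_ fin _] := dt_haar; apply: fin; first exact: KTc1_compact.
by apply: KTinv_measurable; exact: KTc_inv.
Qed.

Lemma dt_le : exists n, (dt setT <= n%:R%:E * dt (KTc (TA_one E C)))%E.
Proof.
have [L /finite_seqP[s ->] LP] := KTc_cover C E.
exists (size s); rewrite (_ : setT = \big[setU/set0]_(t <- s) KTc t).
  apply: measure_cover => t; last exact: dt_KTc.
  by apply: KTinv_measurable; exact: KTc_inv.
by apply/esym/seteqP; split=> // u _; have [t ts tu] := LP u; rewrite -bigcup_seq; exists t.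
Qed.

(** Finitely many translates of this set cover T(F)\T(A); if it had measure zero, dt would be
    zero. *)
Lemma dt_KTc1_gt0 : (0 < dt (KTc (TA_one E C)))%E.
Proof.
rewrite lt_neqAle measure_ge0 andbT; apply/negP => /eqP dt0.
have [n] := dt_le; rewrite -dt0 mule0 => dtT.
have [[B mB B0] _ _] := dt_haar; apply: B0.
apply/eqP; rewrite eq_le measure_ge0 andbT; apply: le_trans dtT.
by apply: le_measure; rewrite ?mem_set.
Qed.

Lemma dt_fin : (dt setT < +oo)%E.
Proof.
have [n dtT] := dt_le; apply: le_lt_trans dtT _.
by apply: lte_mul_pinfty; rewrite ?lee_fin // dt_KTc_fin.
Qed.

(** The integrand depends only on the class modulo K_T; there are finitely many classes, each of
    finite measure. *)
Lemma outer_step Phi f : hecke_algebra Phi -> automorphic f ->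
  step dt (fun t : borel (TFA E C) => hecke_act mu Phi f (trepr t)).
Proof.
move=> HP fa.
have val_t (t : TA E C) : hecke_act mu Phi f (trepr (tpi t)) = hecke_act mu Phi f (val t).
  by have [c cF ->] := trepr_tpi t; apply: hecke_act_F => //; exact: (torF_PGL2F cF).
split.
- move=> W; apply: KTinv_measurable => t s; rewrite /preimage /mkset !val_t => Wt [a aO ->].
  by rewrite hecke_act_K.
- have [L Lf LP] := KTc_cover C E.
  apply: (@sub_finite_set _ _ ((fun t : TA E C => hecke_act mu Phi f (val t)) @` L));
    last exact: finite_image.
  move=> _ [u _ <-]; have [t Lt [s [a aO sE] ->]] := LP u.
  by exists t => //; rewrite val_t sE hecke_act_K.
- apply: le_lt_trans dt_fin; apply: le_measure; rewrite ?mem_set //.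
  apply: (@KTinv_measurable [set u | hecke_act mu Phi f (trepr u) <> 0]).
  by move=> t s; rewrite /mkset !val_t => Wt [a aO ->]; rewrite hecke_act_K.
Qed.

Lemma Vtor_automorphic f : Vtor mu dt f -> automorphic f.
Proof. by case. Qed.

(** Additivity holds only for integrable functions; [hecke_step] provides integrability for the
    inner integral and [outer_step] for the outer one. *)
Lemma Vtor_lin f f' (c : complex R) : Vtor mu dt f -> Vtor mu dt f' ->
  Vtor mu dt (fun p => c * f p + f' p).
Proof.
move=> [fa ft] [fa' ft']; split; first by move=> g d a dF aO; rewrite fa ?fa'.
move=> Phi HP; have s1 := step_cintegrable (outer_step HP fa).
have s2 := step_cintegrable (outer_step HP fa').
rewrite (_ : cintegral _ _ = c * cintegral dt (fun t :
  borel (TFA E C) => hecke_act mu Phi f (trepr t))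
  + cintegral dt (fun t : borel (TFA E C) => hecke_act mu Phi f' (trepr t))).
  by rewrite ft // ft' // mulr0 addr0.
have scf : automorphic (fun p => c * f p) by move=> h d a dF aO; rewrite fa.
have s3 := step_cintegrable (outer_step HP scf).
have E0 g : hecke_act mu Phi (fun p => c * f p) g = c * hecke_act mu Phi f g.
  have := hecke_act_lin c g HP fa (f' := fun=> 0); rewrite /=.
  have z0 : automorphic (fun=> 0) by [].
  move=> /(_ z0); rewrite [X in _ + X](_ : _ = 0); last first.
    by rewrite /hecke_act (_ : cintegral _ _ = 0) //; under eq_fun do rewrite mulr0;
       rewrite /cintegral /= /Rintegral !integral0.
  by rewrite addr0 => <-; apply: cintegral_eq => h; rewrite addr0.
rewrite -cintegralZ // -cintegralD //; last first.
  by move: s3; rewrite (_ : (fun t => _) = fun t :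
    borel (TFA E C) => c * hecke_act mu Phi f (trepr t)) //;
     apply/funext => t; rewrite E0.
by apply: cintegral_eq => t; rewrite hecke_act_lin.
Qed.

Lemma Vtor0 : Vtor mu dt (fun=> 0).
Proof.
split=> // Phi HP; rewrite (_ : cintegral _ _ = 0) //.
have h0 g : hecke_act mu Phi (fun=> 0) g = 0.
  rewrite /hecke_act (cintegral_eq mu (v := fun=> 0)) => [|h]; last by rewrite mulr0.
  by rewrite /cintegral /= /Rintegral !integral0.
rewrite (cintegral_eq dt (v := fun=> 0)) => [|h]; last by rewrite h0.
by rewrite /cintegral /= /Rintegral !integral0.
Qed.

Definition KaK a : set P := [set h | exists c d, [/\ PGL2O C c, PGL2O C d & h = (c * a * d)%g]].

Lemma KaK_K a c d h : PGL2O C c -> PGL2O C d -> KaK a (c * h * d)%g <-> KaK a h.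
Proof.
move=> cO dO; split=> [[c' [d' [c'O d'O hE]]]|[c' [d' [c'O d'O ->]]]].
  exists (c^-1 * c')%g, (d' * d^-1)%g; split.
  - by apply: PGL2OM => //; exact: PGL2OV.
  - by apply: PGL2OM => //; exact: PGL2OV.
  - have -> : h = (c^-1 * (c * h * d) * d^-1)%g by rewrite !mulgA mulVg mul1g mulgK.
    by rewrite hE !mulgA.
exists (c * c')%g, (d' * d)%g; split; [exact: PGL2OM|exact: PGL2OM|].
by rewrite !mulgA.
Qed.

Lemma KaK_rKinv a : rKinv (KaK a).
Proof.
move=> p b pa bO; rewrite -[(p * b)%g]mul1g mulgA; apply/KaK_K => //; exact: PGL2O1.
Qed.

Lemma KaK_refl a : KaK a a.
Proof. by exists 1%g, 1%g; rewrite mul1g mulg1; split=> //; exact: PGL2O1. Qed.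

(** Up to scalars the elements of this double coset are integral matrices whose determinant has
    divisor D, so [integral_cosets] covers them by finitely many compact cosets. *)
Lemma KaK_compact (D : divisor X) : effective D -> compact (KaK (pgl (cpt C D))).
Proof.
move=> Deff; have fD : fsup D by exact: dmult_fin.
have [L Lf LP] := integral_cosets C (Num.bound (nrm D)).
have /finite_seqP[s sE] := finite_image (@pgl _ _ C) Lf.
have cov : KaK (pgl (cpt C D)) `<=` \big[setU/set0]_(p <- s) coset p.
  move=> _ [_ [_ [/PGL2OP[q1 q1O ->] /PGL2OP[q2 q2O ->] ->]]].
  pose w := (scal (powV C D) * (q1 * cpt C D * q2))%g.
  have wE : (pgl q1 * pgl (cpt C D) * pgl q2)%g = pgl w by rewrite pgl_scal !pglMg.
  pose aD := upper 0 (mulr1 (1 : A)) (powV C D).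
  have wE' : w = (q1 * aD * q2)%g.
    rewrite /aD -scal_cpt /w !mulgA; congr (_ * _ * _)%g; exact: (@centre_comm _ _ _ (pow C D)).
  have ki (r : GL2 A) : kO r -> mxint r by move=> rK i j; have [] := rK i j.
  have wi : mxint w.
    rewrite wE'; apply: integralM; last exact: ki.
    by apply: integralM; [exact: ki|exact: mxint_upper_pow].
  have wd : dord w = D.
    apply/funext => x; rewrite wE' !dordM dord_upper (kO_dord x q1O) (kO_dord x q2O).
    by rewrite iord1 iord_pow // !add0r addr0.
  have [|l [q [Ll qO lE]]] := LP w wi.
    by rewrite wd ltW // archi_boundP // ltW // nrm_gt0.
  have : (@pgl _ _ C @` L) (pgl l) by exists l.
  rewrite wE sE => ls; rewrite -bigcup_seq; exists (pgl l) => //.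
  by exists (pgl q); [apply/PGL2OP; exists q|rewrite -pglMg -lE].
apply: subclosed_compact cov.
  by apply: rKinv_closed; exact: KaK_rKinv.
by apply: bigsetU_compact => p _; exact: coset_compact.
Qed.

Lemma KaK_hecke a : compact (KaK a) ->
  hecke_algebra (fun h => if `[< KaK a h >] then 1 else 0 : complex R).
Proof.
move=> cK; have suppE : [set g : P | (if `[< KaK a g >] then 1 else 0 : complex R) != 0] = KaK a.
  by apply/seteqP; split=> h /=; case: asboolP => //; rewrite ?eqxx ?oner_neq0.
have biK g c d : PGL2O C c -> PGL2O C d -> `[< KaK a (c * g * d)%g >] = `[< KaK a g >].
  by move=> cO dO; apply/asboolP/asboolP => /KaK_K; apply.
split=> [g||g c d cO dO]; last by rewrite biK.
  pose U := [set h | `[< KaK a h >] = `[< KaK a g >]].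
  have UK : rKinv U by move=> h b; rewrite /U /= => <- bO;
    rewrite -[(h * b)%g]mul1g mulgA biK //; exact: PGL2O1.
  have Ug : nbhs g U by apply: open_nbhs_nbhs; split => //; exact: rKinv_open.
  by apply: filterS Ug => h; rewrite /U /= => ->.
by rewrite suppE -((closure_id _).1 (rKinv_closed (@KaK_rKinv a))).
Qed.

Lemma automorphic_deq f p p' : automorphic f -> deq p p' -> f p = f p'.
Proof. by move=> fa [c [a [cF aO ->]]]; exact: fa. Qed.

Lemma Vtor_eq0 f : Vtor mu dt f ->
  (forall p, (forall D : divisor X, effective D -> ~ deq p (pgl (cpt C D))) -> f p = 0) ->
  forall p, f p = 0.
Proof.
move=> [fa ft] f0.
suff ind : forall n (D : divisor X), effective D -> nrm D <= n%:R -> f (pgl (cpt C D)) = 0.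
  move=> p; have [[D [De pD]]|nD] :=
    pselect (exists D : divisor X, effective D /\ deq p (pgl (cpt C D))).
    rewrite (automorphic_deq fa pD).
    by apply: (ind (Num.bound (nrm D))) => //; rewrite ltW // archi_boundP // ltW // nrm_gt0.
  by apply: f0 => D De pD; apply: nD; exists D.
elim=> [|n IH] D De Dn; first by have := lt_le_trans (nrm_gt0 D) Dn; rewrite ltxx.
(* The norm of an effective divisor is an integer, being an index; a strictly smaller one is
   therefore at most n. *)
have small (D' : divisor X) : effective D' -> nrm D' < nrm D -> f (pgl (cpt C D')) = 0.
  move=> De' lt; apply: IH => //; have fD' : fsup D' by exact: dmult_fin.
  have [m _ mE] := idx_AD C (fsup0 X) fD' De'.
  have {}mE : nrm D' = m%:R by rewrite mE; congr nrm; apply/funext => x; rewrite subr0.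
  by have := lt_le_trans lt Dn; rewrite mE ltr_nat ler_nat.
pose a := pgl (cpt C D); have cK := KaK_compact De.
pose Phi h : complex R := if `[< KaK a h >] then 1 else 0.
have HP : hecke_algebra Phi := KaK_hecke cK.
(* The hypothesis [f0] and the induction leave only classes c_D' with nrm D <= nrm D', the situation
   of [torus_key]. *)
have key t h : torA E C t -> KaK a h -> f (t * h)%g <> 0 ->
    (exists c q, [/\ torF E C c, PGL2O C q, torA E C q & t = (c * q)%g]) /\ deq (t * h)%g a.
  move=> [t0 t0T <-] [_ [_ [/PGL2OP[q1 q1O ->] /PGL2OP[q2 q2O ->] ->]]] fth.
  have [[D' [De' thD']]|nD'] := pselect (exists D' : divisor X, effective D' /\
      deq (pgl t0 * (pgl q1 * a * pgl q2))%g (pgl (cpt C D'))); last first.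
    by case: fth; apply: f0 => D' De' h'; apply: nD'; exists D'.
  have leDD' : nrm D <= nrm D'.
    by rewrite leNgt; apply/negP => /(small _ De'); rewrite -(automorphic_deq fa thD').
  rewrite !mulgA in thD' *.
  have [[z [z0 [q [qO qT tE]]]] DD'] := torus_key t0T q1O q2O De leDD' thD'.
  split; last by apply: deq_trans thD' _; apply: deq_sym; exact: lin_equiv_deq.
  exists (pgl (torG C z0)), (pgl q); split => //.
  - by exists (torG C z0) => //; apply/torF'P; exists z, z0.
  - by apply/PGL2OP; exists q.
  - by exists q.
(* On the support of Phi, f takes the value f a on [B] and vanishes elsewhere, by [key] with t =
   1. *)
pose B := [set h | KaK a h /\ deq h a].
have BK : rKinv B.
  move=> h b [hK hd] bO; split; first exact: KaK_rKinv.
  apply: deq_trans hd; exists 1%g, b; split=> //; [exact: PGL2F1|by rewrite mul1g].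
have valE u : hecke_act mu Phi f (trepr u) =
    if `[< KTc (TA_one E C) u >] then f a * (fine (mu B))%:C%C else 0.
  case: asboolP => [[s [q qO sE] ->]|nu].
    have [c cF ->] := trepr_tpi s; rewrite (hecke_act_F _ _ fa (torF_PGL2F cF)) sE hecke_act_K
      //=.
    rewrite -(cintegral_indic mu (f a) (rKinv_measurable BK)); apply: cintegral_eq => h.
    rewrite mul1g /Phi; case: (asboolP (KaK a h)) => [hK|hK]; last first.
      by rewrite mul0r; case: asboolP => // -[].
    rewrite mul1r; case: asboolP => [[_ hd]|nB]; first exact: automorphic_deq.
    apply: contrapT => fh; apply: nB; split=> //.
    by have [] := key 1%g h (@torA1 _ _ E C) hK; rewrite mul1g.
  rewrite /hecke_act (cintegral_eq mu (v := fun=> 0)) => [|h].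
    by rewrite /cintegral /= /Rintegral !integral0.
  rewrite /Phi; case: asboolP => [hK|]; rewrite ?mul0r // mul1r.
  apply: contrapT => fh; apply: nu; have [s us] := tpi_surj u.
  have [[c [q [cF qO qT tE]]] _] := key (trepr u) h (TA_torA _) hK fh.
  exists (tA qT); first by exists q; rewrite ?mul1g.
  by have := tE; rewrite us; have [c' c'F ->] := trepr_tpi s => sE; apply/tpi_eqP;
     exists (c'^-1 * c)%g; [apply: torF_M => //; exact: torF_V|rewrite /= -mulgA -sE mulKg].
have := ft Phi HP; rewrite (cintegral_eq dt valE) cintegral_indic; last first.
  by apply: KTinv_measurable; exact: KTc_inv.
(* [B] contains the coset a K, which has measure 1. *)
have muB : (1 <= mu B)%E.
  rewrite -(mu_coset a); apply: le_measure; rewrite ?mem_set //; try exact: rKinv_measurable.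
    by apply: rKinv_measurable; exact: coset_rKinv.
  move=> _ [b bO ->]; apply: BK => //; split; [exact: KaK_refl|exact: deq_refl].
have muBfin : (mu B < +oo)%E.
  apply: rK_compact_mu => //; apply: subclosed_compact cK _; first exact: rKinv_closed.
  by move=> h [].
move=> /eqP; rewrite !mulf_eq0 => /orP[/orP[/eqP //|]|].
  rewrite eq_complex /= eqxx andbT => /eqP muB0.
  by move: muB; rewrite -(fineK (x := mu B)) ?ge0_fin_numE // muB0 lee_fin ler10.
rewrite eq_complex /= eqxx andbT => /eqP dt0.
have := dt_KTc1_gt0; rewrite -(fineK (x := dt _)) ?ge0_fin_numE ?dt_KTc_fin // dt0.
by rewrite ltxx.
Qed.

End ToroidalSpace.

(** * Lattices and bundles *)

Section LocalLattices.
Variables (k : finFieldType) (X : curve k).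
Variable C : forall x : place X, completion x.
Local Notation A := (adele C).
Local Notation vx x := (cval_dval (C x)).
Local Notation cv x := (@cval _ _ _ (C x)).
Implicit Types (x : place X) (g h : GL2 A).

Lemma mx_entryB x m n (M N : 'M[A]_(m, n)) i j : (M - N) i j x = M i j x - N i j x.
Proof. by rewrite 2!mxE. Qed.

Lemma mintM x m n (M : 'M[A]_(m, 2)) (N : 'M[A]_(2, n)) : mint x M -> mint x N -> mint x (M *m N).
Proof.
move=> Mi Ni i j; rewrite mxE sum2.
by apply: (vgeD (vx x)); apply: (vgeM0 (vx x)).
Qed.

Lemma mintD x m n (M N : 'M[A]_(m, n)) : mint x M -> mint x N -> mint x (M + N).
Proof. by move=> Mi Ni i j; rewrite mxE; apply: (vgeD (vx x)). Qed.

Lemma mint1 x n : mint x (1%:M : 'M[A]_n).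
Proof. by move=> i j; rewrite mxE; case: (_ == _); [exact: (vge1 (vx x))|exact: vge0]. Qed.

Lemma lower_bound x m n (M : 'M[A]_(m, n)) : exists N :
  nat, forall i j, vge (cv x) (- N%:Z) (M i j x).
Proof.
exists (\sum_i \sum_j `|cv x (M i j x)|)%N => i j; rewrite /vge; case: eqVneq => //= _.
rewrite (bigD1 i) //= (bigD1 j) //=; lia.
Qed.

Lemma local_approx x g (n : nat) : exists B : 'M[X]_2, forall i j,
  vge (cv x) n%:Z ((1%:M - ginv g *m map_mx (dia C) B) i j x).
Proof.
have [N NP] := lower_bound x (ginv g).
have /choice[f fP] : forall p :
  'I_2 * 'I_2, exists a, vge (cv x) (n%:Z + N%:Z) (g p.1 p.2 x - emb (C x) a).
  by move=> p; exact: emb_dense.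
pose B := \matrix_(i, j) f (i, j); exists B => i j; rewrite -(ginvK g) -mulmxBr mxE sum2.
have key (l : 'I_2) : vge (cv x) n ((ginv g i l * (gmx g - map_mx (dia C) B) l j) x).
  have -> : n%:Z = - N%:Z + (n%:Z + N%:Z) by lia.
  by apply: (vgeM (vx x)) => //; rewrite !mxE; exact: (fP (l, j)).
by apply: (vgeD (vx x)); exact: key.
Qed.

(** Approximate g by a matrix B over F so closely that the error 1 - g^-1 B absorbs the poles of
    h^-1 g. The columns of B lie in the lattice of g, hence in that of h. *)
Lemma lattice_incl x g h :
  (forall v : 'cV[X]_2, mint x (ginv g *m map_mx (dia C) v) ->
    mint x (ginv h *m map_mx (dia C) v)) ->
  mint x (ginv h *m g).
Proof.
move=> gh; have [N NP] := lower_bound x (ginv h *m g).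
have [B BP] := local_approx x g N.
have -> : ginv h *m g = ginv h *m map_mx (dia C) B + (ginv h *m g) *m (1%:M - ginv g *m map_mx
  (dia C) B).
  rewrite mulmxBr mulmx1 -mulmxA [g *m _]mulmxA gmxK mul1mx addrC subrK //.
apply: mintD.
  move=> i j.
  have colE (g' : GL2 A) i' : (ginv g' *m map_mx (dia C) (col j B)) i' 0 = (ginv g' *m map_mx
    (dia C) B) i' j.
    by rewrite !mxE; apply: eq_bigr => l _; rewrite !mxE.
  rewrite -colE; apply: gh => i' j'; rewrite ord1 colE.
  have -> : (ginv g *m map_mx (dia C) B) i' j x =
      (1%:M : 'M[A]_2) i' j x - (1%:M - ginv g *m map_mx (dia C) B) i' j x.
    by rewrite mx_entryB subKr.
  apply: (vgeB (vx x)); first exact: mint1.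
  by apply: vge_le (BP i' j).
move=> i j; rewrite mxE sum2; apply: (vgeD (vx x)).
  by rewrite -(addNr N%:Z); apply: (vgeM (vx x)).
by rewrite -(addNr N%:Z); apply: (vgeM (vx x)).
Qed.

(** For B over F close to g at x, the matrix g^-1 B is congruent to 1 modulo the maximal ideal and
    therefore lies in GL_2(O_x). *)
Lemma local_frame x g : exists B : 'M[X]_2, exists Bu : B \in unitmx,
  mint x (gmx (g^-1 * diaG C Bu)%g) /\ mint x (ginv (g^-1 * diaG C Bu)%g).
Proof.
have [B BP] := local_approx x g 1.
pose m := ginv g *m map_mx (dia C) B.
have mE i j : m i j x = (1%:M : 'M[A]_2) i j x - (1%:M - m) i j x.
  by rewrite mx_entryB subKr.
have mi : mint x m.
  by move=> i j; rewrite mE; apply: (vgeB (vx x)); [exact: mint1|apply: vge_le (BP i j)].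
have dm : vge (cv x) 1 ((1 - \det m) x).
  have r01 : vge (cv x) 1 (m 0 1 x) by rewrite -(vgeN (vx x)); have := BP 0 1;
    rewrite mxE [X in _ + X]mxE mxE /= add0r.
  have r00 : vge (cv x) 1 (1 - m 0 0 x) by have := BP 0 0; rewrite mxE [X in _ + X]mxE mxE /=.
  have r11 : vge (cv x) 1 (1 - m 1 1 x) by have := BP 1 1; rewrite mxE [X in _ + X]mxE mxE /=.
  rewrite det2 /=; have -> : 1 - (m 0 0 x * m 1 1 x - m 0 1 x * m 1 0 x) =
     (1 - m 0 0 x) + m 0 0 x * (1 - m 1 1 x) + m 0 1 x * m 1 0 x by ring.
  apply: (vgeD (vx x)); first apply: (vgeD (vx x)) => //.
    by rewrite -[X in vge _ X]add0r; apply: (vgeM (vx x)).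
  by rewrite -[X in vge _ X]addr0; apply: (vgeM (vx x)).
have dm0 : cv x (\det m x) = 0 /\ \det m x != 0.
  have d0 : \det m x != 0.
    apply/negP => /eqP d0; move: dm; rewrite /= d0 subr0 /vge oner_eq0 (dval1 (vx x)) //.
  split=> //; apply/eqP; rewrite eq_le; apply/andP; split; last first.
    have : vge (cv x) 0 (\det m x).
      by rewrite det2; apply: (vgeB (vx x)); apply: (vgeM0 (vx x)).
    by rewrite /vge (negbTE d0).
  rewrite leNgt; apply/negP => d1.
  have : vge (cv x) 1 (1 : C x).
    have -> : (1 : C x) = (1 - \det m) x + \det m x by rewrite /= subrK.
    apply: (vgeD (vx x)) => //.
    by rewrite /vge; apply/orP; right; lia.
  by rewrite /vge oner_eq0 (dval1 (vx x)).
have Bu : B \in unitmx.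
  rewrite unitmxE unitfE; apply/negP => /eqP B0; case: dm0 => _.
  by rewrite /m det_mulmx det_map_mx B0 rmorph0 mulr0 /= eqxx.
exists B, Bu; split; first exact: mi.
by apply: mint_ginv; [exact: mi|exact: dm0.1].
Qed.

End LocalLattices.

(** * The sheaf attached to an adelic matrix *)

Section LatticeSheaf.
Variables (k : finFieldType) (X : curve k).
Variable C : forall x : place X, completion x.
Local Notation A := (adele C).
Variable g : GL2 A.

Definition lat_sect (U : opn X) : pred 'cV[X]_2 :=
  fun v => `[< forall x, opn_set U x -> mint x (ginv g *m map_mx (dia C) v) >].

Lemma lat_sectP (U : opn X) v :
  reflect (forall x, opn_set U x -> mint x (ginv g *m map_mx (dia C) v)) (v \in lat_sect U).
Proof. exact: asboolP. Qed.

Lemma lat_sect_zmod (U : opn X) : zmod_closed (lat_sect U).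
Proof.
split=> [|v w /lat_sectP vU /lat_sectP wU]; apply/lat_sectP => x xU.
  by rewrite map_mx0 mulmx0 => i j; rewrite mxE; exact: vge0.
rewrite map_mxB mulmxBr => i j; rewrite mx_entryB.
by apply: (vgeB (cval_dval (C x))); [exact: vU|exact: wU].
Qed.
HB.instance Definition _ (U : opn X) :=
  GRing.isZmodClosed.Build 'cV[X]_2 (lat_sect U) (@lat_sect_zmod U).

Record latS (U : opn X) := LatS { lat_val : 'cV[X]_2; lat_P : lat_val \in lat_sect U }.
HB.instance Definition _ (U : opn X) := [isSub for @lat_val U].
HB.instance Definition _ (U : opn X) := [Choice of latS U by <:].
HB.instance Definition _ (U : opn X) := [SubChoice_isSubZmodule of latS U by <:].

Section Scale.
Variable U : opn X.

Fact lat_scale_subproof (a : OX U) (s : latS U) : OX_val a *: lat_val s \in lat_sect U.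
Proof.
apply/lat_sectP => x xU; rewrite map_mxZ -scalemxAr => i j; rewrite mxE.
apply: (vgeM0 (cval_dval (C x))); last exact: (lat_sectP _ _ (lat_P s)).
by rewrite vge_emb; exact: (regularP _ _ (OX_regular a)).
Qed.

Definition lat_scale (a : OX U) (s : latS U) : latS U := LatS (lat_scale_subproof a s).

Fact lat_scaleA a b s : lat_scale a (lat_scale b s) = lat_scale (a * b) s.
Proof. by apply: val_inj; rewrite /= scalerA. Qed.
Fact lat_scale1 : left_id 1 lat_scale.
Proof. by move=> s; apply: val_inj; rewrite /= scale1r. Qed.
Fact lat_scaleDr : right_distributive lat_scale +%R.
Proof. by move=> a s t; apply: val_inj; rewrite /= scalerDr. Qed.
Fact lat_scaleDl s : {morph lat_scale^~ s : a b / a + b}.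
Proof. by move=> a b; apply: val_inj; rewrite /= scalerDl. Qed.
HB.instance Definition _ := GRing.Zmodule_isLmodule.Build (OX U) (latS U)
  lat_scaleA lat_scale1 lat_scaleDr lat_scaleDl.
End Scale.

Fact lat_res_subproof (U V : opn X) (VU : V `<=` U) (s : latS U) : lat_val s \in lat_sect V.
Proof. by apply/lat_sectP => x /VU xU; exact: (lat_sectP _ _ (lat_P s)). Qed.

Definition lat_res (U V : opn X) (VU : V `<=` U) (s : latS U) : latS V :=
  LatS (lat_res_subproof VU s).

Fact lat_lin (U V : opn X) (VU : V `<=` U) (a : OX U) (s t : latS U) :
  lat_res VU (a *: s + t) = OX_res VU a *: lat_res VU s + lat_res VU t.
Proof. exact: val_inj. Qed.

Fact lat_id (U : opn X) (UU : U `<=` U) (s : latS U) : lat_res UU s = s.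
Proof. exact: val_inj. Qed.

Fact lat_comp (U V W : opn X) (VU : V `<=` U) (WV : W `<=` V)
  (WU : W `<=` U) (s : latS U) : lat_res WV (lat_res VU s) = lat_res WU s.
Proof. exact: val_inj. Qed.

Definition opnI (U V : opn X) : opn X.
Proof.
exists (U `&` V); rewrite setCI finite_setU; split; exact: opn_cofinite.
Defined.

Fact lat_glue (U : opn X) (I : Type) (V : I -> opn X)
    (VU : forall i, V i `<=` U) (s : forall i, latS (V i)) :
    inhabited I -> U `<=` \bigcup_i V i ->
    (forall i j (W : opn X) (Wi : W `<=` V i) (Wj : W `<=` V j),
       lat_res Wi (s i) = lat_res Wj (s j)) ->
    exists! t : latS U, forall i, lat_res (VU i) t = s i.
Proof.
move=> [i0] cov compat.
have sE i j : lat_val (s i) = lat_val (s j).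
  have := compat i j (opnI (V i) (V j)) (@subIsetl _ _ _) (@subIsetr _ _ _).
  by move/(congr1 (@lat_val _)).
have sU : lat_val (s i0) \in lat_sect U.
  apply/lat_sectP => x /cov[i _ xVi]; rewrite (sE i0 i).
  exact: (lat_sectP _ _ (lat_P (s i))).
exists (LatS sU); split=> [i|t tP]; apply: val_inj; first exact: sE.
by rewrite /= -(tP i0).
Qed.

(* Over a nonempty open subset of U, sections of the sheaf are the vectors of F^2 in the
   local lattices g_x O_x^2. *)
Definition lattice_sheaf : omodule X :=
  OModule (sect := fun U => (latS U : lmodType (OX U))) lat_lin lat_id lat_comp lat_glue.

Definition int_opn m n (M : 'M[A]_(m, n)) : opn X.
Proof.
exists [set x | mint x M].
apply: (@sub_finite_set _ _ (\bigcup_(p in [set: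
  'I_m * 'I_n]) [set x | ~~ vge (@cval _ _ _ (C x)) 0 (M p.1 p.2 x)])).
  move=> x /= nM; apply: contrapT => h; apply: nM => i j; apply/negP => /negP Mij.
  by apply: h; exists (i, j).
by apply: bigcup_finite => // p _; exact: acomp_int.
Defined.

(** A frame B at x remains a frame at all places where g^-1 B and its inverse are integral, and
    these form an open neighbourhood of x. *)
Lemma lattice_vector_bundle : vector_bundle 2 lattice_sheaf.
Proof.
move=> x; have [B [Bu [q1 q2]]] := local_frame x g.
pose q := (g^-1 * diaG C Bu)%g.
exists (opnI (int_opn (gmx q)) (int_opn (ginv q))); split; first by split.
set U := opnI _ _.
have bU i : col i B \in lat_sect U.
  apply/lat_sectP => y [yq _] a b; rewrite ord1.
  have -> : (ginv g *m map_mx (dia C) (col i B)) a 0 = gmx q a i.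
    by rewrite !mxE; apply: eq_bigr => l _; rewrite !mxE.
  exact: yq.
exists (fun i => LatS (bU i)) => V VU s.
have aV i : (invmx B *m lat_val s) i 0 \in regular V.
  apply/regularP => y yV; have [_ yq] := VU _ yV.
  have := mintM (yq) (lat_sectP _ _ (lat_P s) y yV).
  rewrite /= mulmxA -[_ *m gmx g *m _]mulmxA gmxK mulmx1 -map_mxM => /(_ i 0).
  by rewrite mxE vge_emb.
have sumE (a : 'I_2 -> OX V) : lat_val (\sum_i a i *: (res (o :=
  lattice_sheaf) VU (LatS (bU i)) : latS V)) =
    B *m \col_i OX_val (a i).
  rewrite sum2 /=; apply/matrixP => i j; rewrite ord1 !mxE sum2 !mxE mulrC; congr (_ + _).
  by rewrite mulrC.
exists [ffun i => MkOX (aV i)]; split.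
  apply: val_inj; rewrite /= sumE -[LHS]mul1mx -(mulmxV Bu) -mulmxA; congr (_ *m _).
  by apply/matrixP => i j; rewrite ord1 [in RHS]mxE ffunE.
move=> a sa; apply/ffunP => i; rewrite ffunE; apply: val_inj => /=.
by rewrite sa sumE mulKmx // mxE.
Qed.

End LatticeSheaf.

Section Restriction.
Variables (k : finFieldType) (X : curve k) (M : omodule X).

Lemma res0 (U V : opn X) (VU : V `<=` U) : res VU (0 : sect M U) = 0.
Proof.
have := res_lin VU 1 0 (0 : sect M U); have -> : OX_res VU 1 = 1 by exact: val_inj.
by rewrite !scale1r addr0 => /esym/eqP; rewrite -subr_eq0 addrK => /eqP.
Qed.

Lemma resZ (U V : opn X) (VU : V `<=` U) (c : OX U) (t : sect M U) :
  res VU (c *: t) = OX_res VU c *: res VU t.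
Proof. by have := res_lin VU c t 0; rewrite addr0 res0 addr0. Qed.

Definition subIr (U V : opn X) : opnI U V `<=` V := fun x xUV => xUV.2.
Definition subIl (U V : opn X) : opnI U V `<=` U := fun x xUV => xUV.1.
End Restriction.

(** * Line bundles inside the function field *)

Section LineBundleTrivialization.
Variables (k : finFieldType) (X : curve k).
Variable L : omodule X.
Hypothesis L1 : vector_bundle 1 L.

Definition generator (U : opn X) (l : sect L U) := forall (V : opn X) (VU : V `<=` U)
  (s : sect L V), exists! a : OX V, s = a *: res VU l.

Lemma exists_generator x : exists U, opn_set U x /\ exists l, @generator U l.
Proof.
have [U [xU [b bP]]] := L1 x; exists U; split=> //; exists (b ord0) => V VU s.
have [a [sa aU]] := bP V VU s; exists (a ord0); split.
  by rewrite sa big_ord_recl big_ord0 addr0.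
move=> c sc; have := aU [ffun => c]; rewrite big_ord_recl big_ord0 addr0 ffunE => /(_ sc) ->.
by rewrite ffunE.
Qed.

Variables (U0 : opn X) (l0 : sect L U0).
Hypothesis gen0 : generator l0.

Definition coef (U : opn X) (s : sect L U) : OX (opnI U U0) :=
  sval (cid (gen0 (@subIr _ _ U U0) (res (@subIl _ _ U U0) s))).

Lemma coefE (U : opn X) (s : sect L U) :
  res (@subIl _ _ U U0) s = coef s *: res (@subIr _ _ U U0) l0.
Proof. by rewrite /coef; case: cid => a [aE _] /=. Qed.

Lemma coef_uniq (U V : opn X) (VU : V `<=` U) (VU0 : V `<=` U0) (s : sect L U) a :
  res VU s = a *: res VU0 l0 -> OX_val a = OX_val (coef s).
Proof.
move=> sa; have VI : V `<=` opnI U U0 by move=> x xV; split; [exact (VU _ xV)|exact (VU0 _ xV)].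
have [b [sb bU]] := gen0 VU0 (res VU s).
have -> : a = b by rewrite (bU a sa).
have := bU (OX_res VI (coef s)); rewrite -(res_comp (@subIr _ _ U U0) VI VU0).
by rewrite -resZ -coefE (res_comp (@subIl _ _ U U0) VI VU) => /(_ erefl) ->.
Qed.

(** The coefficient of s with respect to the generator l0 at the generic point; sections of L
    thereby become elements of F. *)
Definition triv (U : opn X) (s : sect L U) : X := OX_val (coef s).

Lemma triv_res (U V : opn X) (VU : V `<=` U) (s : sect L U) : triv (res VU s) = triv s.
Proof.
have WU : opnI V U0 `<=` U by move=> x [xV _]; exact: (VU x xV).
by apply: (@coef_uniq _ _ WU (@subIr _ _ V U0)); rewrite -coefE (res_comp VU _ WU).
Qed.

Lemma triv_lin (U : opn X) (a : OX U) (s t : sect L U) :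
  triv (a *: s + t) = OX_val a * triv s + triv t.
Proof.
apply/esym; apply: (@coef_uniq _ _ (@subIl _ _ U U0) (@subIr _ _ U U0) _
  (OX_res (@subIl _ _ U U0) a * coef s + coef t)).
by rewrite scalerDl -scalerA -!coefE -res_lin.
Qed.

Lemma trivZ (U : opn X) (a : OX U) (s : sect L U) : triv (a *: s) = OX_val a * triv s.
Proof.
apply/esym; apply: (@coef_uniq _ _ (@subIl _ _ U U0) (@subIr _ _ U U0) _
  (OX_res (@subIl _ _ U U0) a * coef s)).
by rewrite -scalerA -coefE -resZ.
Qed.

Lemma triv_gen : triv l0 = 1.
Proof.
have sub : U0 `<=` U0 by [].
by apply/esym; apply: (@coef_uniq _ _ sub sub _ 1); rewrite scale1r.
Qed.

(** The order of a local generator at x is the least one among sections near x. On U0 the generator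
    is taken to be l0, so that the order is 0 at almost all places. *)
Lemma triv_ord x : exists d : int, [/\ opn_set U0 x -> d = 0,
  forall V (s : sect L V), opn_set V x -> vge (ord x) d (triv s)
  & exists V (s : sect L V), [/\ opn_set V x, triv s != 0 & ord x (triv s) = d]].
Proof.
have [Ux [xU [l lgen ldef]]] : exists Ux, opn_set Ux x /\ exists2 l : sect L Ux, generator l &
    opn_set U0 x -> triv l = 1.
  have [x0|nx0] := pselect (opn_set U0 x); first by exists U0; split=> //; exists l0 => // _;
    exact: triv_gen.
  by have [U [xU [l lgen]]] := exists_generator x; exists U; split=> //; exists l.
have l_neq0 : triv l != 0.
  have [a [la _]] := lgen _ (@subIl _ _ Ux U0) (res (@subIr _ _ Ux U0) l0).
  have := congr1 (@triv _) la; rewrite trivZ !triv_res triv_gen => /eqP.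
  by apply: contraTneq => ->; rewrite mulr0 oner_eq0.
exists (ord x (triv l)); split.
- by move=> /ldef ->; exact: dval1 (ord_dval x).
- move=> V s xV; have [a [sa _]] := lgen _ (@subIr _ _ V Ux) (res (@subIl _ _ V Ux) s).
  have := congr1 (@triv _) sa; rewrite trivZ !triv_res => ->.
  rewrite -[ord x _]add0r; apply: (vgeM (ord_dval x)).
    by apply: (regularP _ _ (OX_regular a)).
  by rewrite /vge lexx orbT.
- by exists Ux, l.
Qed.

End LineBundleTrivialization.

(** * Tensor products of lattice sheaves with line bundles *)

Section Tensor.
Variables (k : finFieldType) (X : curve k).
Variable C : forall x : place X, completion x.
Local Notation A := (adele C).

(** In the usual notation L is O(-D): sections have order at least D x at x, and the bound is
    attained locally. *)
Lemma line_bundle_order (L : omodule X) : vector_bundle 1 L ->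
  exists (ph : forall U, sect L U -> X) (D : place X -> int), fsup D /\
  [/\ forall (U : opn X) (a : OX U) s t, ph U (a *: s + t) = OX_val a * ph U s + ph U t,
     forall (U V : opn X) (VU : V `<=` U) s, ph V (res VU s) = ph U s,
     forall (U : opn X) s x, opn_set U x -> vge (ord x) (D x) (ph U s)
   & forall x, exists V s, [/\ opn_set V x, ph V s != 0 & ord x (ph V s) = D x]].
Proof.
move=> L1; have [x0 _] := ex_place X.
have [U0 [_ [l0 gen0]]] := exists_generator L1 x0.
have /choice[D DP] := triv_ord L1 gen0.
exists (@triv _ _ _ _ _ gen0), D; split.
  apply: sub_finite_set (@opn_cofinite _ _ U0) => x /= /eqP Dx xU; apply: Dx.
  by case: (DP x) => + _ _; exact.
split.
- exact: triv_lin.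
- exact: triv_res.
- by move=> U s x xU; have [_ + _] := DP x; exact.
- by move=> x; have [_ _] := DP x.
Qed.

(** Each v in F^2 is a section over some nonempty open set. Compatibility with restriction makes its
    image independent of that set, so the morphism is F-linear at the generic point. *)
Lemma lattice_hom_mx (h g : GL2 A) (f : omorphism (lattice_sheaf h) (lattice_sheaf g)) :
  exists m : 'M[X]_2, forall U (s : latS h U), lat_val (f U s : latS g U) = m *m lat_val s.
Proof.
pose Uv (v : 'cV[X]_2) := int_opn (ginv h *m map_mx (dia C) v).
have vU v : v \in lat_sect h (Uv v) by apply/lat_sectP.
pose F v : 'cV[X]_2 := lat_val (f (Uv v) (LatS (vU v) : sect (lattice_sheaf h) _) : latS g _).
have FE U (s : latS h U) : lat_val (f U s : latS g U) = F (lat_val s).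
  have e1 := congr1 (@lat_val _ _ _ _ _) (omor_res f (@subIl _ _ U (Uv (lat_val s))) s).
  have e2 := congr1 (@lat_val _ _ _ _ _) (omor_res f (@subIr _ _ U (Uv (lat_val s))) (LatS (vU
    (lat_val s)))).
  rewrite /= in e1 e2; rewrite -e1 /F -e2; congr lat_val; congr (f _ _); exact: val_inj.
have Flin a v w : F (a *: v + w) = a *: F v + F w.
  pose Ua := int_opn (const_mx (dia C a) : 'M[A]_1).
  pose W := opnI (opnI (Uv v) (Uv w)) Ua.
  have aW : a \in regular W.
    by apply/regularP => x [_ /(_ 0 0)]; rewrite mxE vge_emb.
  have vW : v \in lat_sect h W by apply/lat_sectP => x [[xv _] _].
  have wW : w \in lat_sect h W by apply/lat_sectP => x [[_ xw] _].
  have := FE W (MkOX aW *: (LatS vW : sect (lattice_sheaf h) W) + LatS wW).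
  by rewrite omor_lin /= !FE.
have F0 : F 0 = 0 by have := Flin 1 0 0; rewrite scaler0 !scale1r addr0 => /esym/eqP;
  rewrite -subr_eq0 addrK => /eqP.
exists (\matrix_(i, j) F (delta_mx j 0) i 0) => U s; rewrite FE; set v := lat_val s.
have vE : v = v 0 0 *: delta_mx 0 0 + (v 1 0 *: delta_mx 1 0 + 0).
  apply/matrixP; apply: forall_ord2 => j; rewrite ord1 !mxE /=;
    by rewrite ?mulr1 ?mulr0 ?addr0 ?add0r.
rewrite {1}vE !Flin F0 addr0; apply/matrixP => i j; rewrite ord1 !mxE sum2 !mxE.
by congr (_ + _); rewrite mulrC.
Qed.

Lemma scal_ginv (a a' : A) (aa : a * a' = 1) g (v : 'cV[A]_2) :
  ginv (g * scal aa)%g *m v = a' *: (ginv g *m v).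
Proof. by rewrite /= -mulmxA mul_scalar_mx. Qed.

(* The tensor product with a line bundle only rescales the local lattices by an idele. *)
Lemma tensor_deq (g h : GL2 A) (L M : omodule X) (i : omorphism (lattice_sheaf h) M) :
  vector_bundle 1 L -> is_tensor (lattice_sheaf g) L M ->
  (forall U s, exists t, i U t = s) -> deq (pgl g) (pgl h).
Proof.
move=> L1 [b bP] isurj.
have [ph [D [fD [phL phR phD phG]]]] := line_bundle_order L1.
(* Multiplying vectors by sections of L lands in the lattices of g scaled by an idele with divisor
   D. *)
pose g' := (g * scal (powV C D))%g.
have fND := fsupN fD.
have oU (x : place X) (n : int) : ord x (unif x ^ n) = n.
  by rewrite (dvalXz (ord_dval x)) ?unif_neq0 // ord_unif mul1r.
have cP (U : opn X) (v : latS g U) (s : sect L U) : ph U s *: lat_val v \in lat_sect g' U.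
  apply/lat_sectP => x xU; rewrite scal_ginv map_mxZ -scalemxAr scalerA => j l.
  rewrite mxE /= powE //.
  apply: (vgeM0 (cval_dval (C x))); last exact: (lat_sectP _ _ _ (lat_P v) x xU).
  rewrite -rmorphM /= vge_emb -(addNr (D x)); apply: (vgeM (ord_dval x)); last exact: phD.
  by rewrite /vge oU lexx orbT.
have [c cE] : exists c : obilinear (lattice_sheaf g) L (lattice_sheaf g'), forall (U :
  opn X) (v : latS g U) s,
    lat_val (c U (v : sect (lattice_sheaf g) U) s : latS g' U) = ph U s *: lat_val v.
  unshelve eexists; first unshelve eapply (@OBilinear _ _ (lattice_sheaf g) L (lattice_sheaf g')
    (fun U (v : latS g U) s => LatS (cP U v s))).
  - by move=> U a v v' s; apply: val_inj; rewrite /= scalerDr !scalerA mulrC.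
  - by move=> U a v s s'; apply: val_inj; rewrite /= phL scalerDl scalerA.
  - by move=> U V VU v s; apply: val_inj; rewrite /= phR.
  - by [].
have [f [fP _]] := bP _ c.
have [m mP] : exists m : 'M[X]_2, forall U (s : latS h U),
    lat_val (f U (i U (s : sect (lattice_sheaf h) U)) : latS g' U) = m *m lat_val s.
  have fl (U : opn X) (a : OX U) (s t : sect (lattice_sheaf h) U) :
      f U (i U (a *: s + t)) = a *: f U (i U s) + f U (i U t) by rewrite !omor_lin.
  have fr (U V : opn X) (VU : V `<=` U) (s : sect (lattice_sheaf h) U) :
      f V (i V (res VU s)) = res VU (f U (i U s)) by rewrite !omor_res.
  exact: (lattice_hom_mx (OMorphism fl fr)).
have incl x (v : 'cV[X]_2) : mint x (ginv h *m map_mx (dia C) v) ->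
    mint x (ginv g' *m map_mx (dia C) (m *m v)).
  move=> xv; pose U := int_opn (ginv h *m map_mx (dia C) v).
  have vU : v \in lat_sect h U by apply/lat_sectP.
  have := lat_sectP _ _ _ (lat_P (f U (i U (LatS vU : sect (lattice_sheaf h) U)) :
    latS g' U)) x xv.
  by rewrite mP.
(* The section s has exact order D x, so w / ph s lies in the lattice of g at x. Then w is the value
   of c at w / ph s and s, and c factors through the universal map. *)
have surj x (w : 'cV[X]_2) : mint x (ginv g' *m map_mx (dia C) w) ->
    exists2 v, mint x (ginv h *m map_mx (dia C) v) & w = m *m v.
  move=> xw; have [V [s [xV u0 uD]]] := phG x; pose u := ph V s.
  have xv : mint x (ginv g *m map_mx (dia C) (u^-1 *: w)).
    move=> j l; move: (xw j l); rewrite scal_ginv map_mxZ -scalemxAr !mxE /= powE //.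
    rewrite /vge !mulf_eq0 !fmorph_eq0 invr_eq0 (negbTE u0) expfz_eq0 (negbTE (unif_neq0 x))
      andbF /=.
    case: eqVneq => //= y0; rewrite !(dvalM (cval_dval (C x))) ?fmorph_eq0 ?invr_eq0 //;
      last first.
      by rewrite expfz_eq0 (negbTE (unif_neq0 x)) andbF.
    rewrite !cval_emb -/u (dvalV (ord_dval x)) // uD.
    by rewrite oU.
  pose W := opnI V (int_opn (ginv g *m map_mx (dia C) (u^-1 *: w))).
  have vW : u^-1 *: w \in lat_sect g W by apply/lat_sectP => y [].
  have [t it] := isurj W (b W (LatS vW : sect (lattice_sheaf g) W) (res (@subIl _ _ _ _) s)).
  have xW : opn_set W x by split.
  exists (lat_val (t : latS h W)); first exact: (lat_sectP _ _ _ (lat_P (t : latS h W)) x xW).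
  by rewrite -mP it fP cE /= phR scalerA mulfV // scale1r.
(* By surjectivity at one place, the image of m contains a basis of F^2. *)
have mu : m \in unitmx.
  have [x0 _] := ex_place X; have [B [Bu [q1 _]]] := local_frame x0 g'.
  have /choice[v vP] : forall j, exists v, col j B = m *m v.
    move=> j; have [|v _ ->] := surj x0 (col j B); last by exists v.
    move=> a l; have -> : (ginv g' *m map_mx (dia C) (col j B)) a l = gmx (g'^-1 * diaG C Bu)%g
      a j.
      by rewrite !mxE; apply: eq_bigr => r _; rewrite !mxE.
    exact: q1.
  have : B = m *m \matrix_(a, j) v j a 0.
    apply/matrixP => a j; have /matrixP/(_ a 0) := vP j; rewrite !mxE => ->.
    by apply: eq_bigr => r _; rewrite !mxE.
  by move=> BE; have := Bu; rewrite {1}BE unitmx_mul => /andP[].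
pose q := (g'^-1 * (diaG C mu * h))%g.
have q1 x : mint x (gmx q).
  have := @lattice_incl _ _ C x h ((diaG C mu)^-1 * g')%g;
    rewrite -[gmx q]/(ginv g' *m (map_mx (dia C) m *m h)).
  rewrite mulmxA; apply => v /incl; by rewrite map_mxM mulmxA.
have q2 x : mint x (ginv q).
  have := @lattice_incl _ _ C x g' (diaG C mu * h)%g; apply => w /surj[v hv ->].
  rewrite map_mxM mulmxA -[ginv (_ * _)%g]/(ginv h *m map_mx (dia C) (invmx m)).
  by rewrite -[_ *m _ *m map_mx _ m]mulmxA -map_mxM mulVmx // map_mx1 mulmx1.
have qO : kO q by move=> a j; split=> x; [exact: q1|exact: q2].
exists (pgl (diaG C mu)), (pgl q^-1%g); split.
- by apply/PGL2FP; exists m, mu.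
- by apply/PGL2OP; exists q^-1%g => //; exact: kOV.
rewrite -!pglMg /q invgM mulVKg invgK -(pgl_scal (powV C D)) /g'; congr pgl.
exact: (@centre_comm _ _ _ (pow C D)).
Qed.

End Tensor.

(** * Classes of bundles modulo line bundles *)

Section ProjectiveClasses.
Variables (k : finFieldType) (X : curve k).
Implicit Types (M N : omodule X).

Lemma omor_eq M N (f f' : omorphism M N) : (forall U s, f U s = f' U s) -> f = f'.
Proof.
case: f f' => [f f1 f2] [f' f1' f2'] /= ff'.
have {}ff' : f = f' by apply: functional_extensionality_dep => U; apply/funext => s.
by case: _ / ff' f1' f2' => f1' f2'; congr OMorphism; exact: Prop_irrelevance.
Qed.

Lemma omor0 M N (f : omorphism M N) U : f U 0 = 0.
Proof.
have := omor_lin f (1 : OX U) 0 0; rewrite !scale1r addr0 => /esym/eqP.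
by rewrite -subr_eq0 addrK => /eqP.
Qed.

Lemma omor_sum M N (f : omorphism M N) U n (a : 'I_n -> OX U) (s : 'I_n -> sect M U) :
  f U (\sum_i a i *: s i) = \sum_i a i *: f U (s i).
Proof.
elim: n a s => [|n IH] a s; first by rewrite !big_ord0 omor0.
by rewrite !big_ord_recl omor_lin IH.
Qed.

Lemma iso_vector_bundle n M N (f : omorphism M N) : (forall U, injective (f U)) ->
  (forall U s, exists t, f U t = s) -> vector_bundle n M -> vector_bundle n N.
Proof.
move=> finj fsurj Mn x; have [U [xU [b bP]]] := Mn x.
exists U; split=> //; exists (fun i => f U (b i)) => V VU s.
have fE (a : 'I_n -> OX V) : \sum_i a i *: res VU (f U (b i)) = f V (\sum_i a i *: res VU (b i)).
  by rewrite omor_sum; apply: eq_bigr => i _; rewrite omor_res.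
have [t <-] := fsurj V s; have [a [ta aU]] := bP V VU t.
exists a; split; first by rewrite fE -ta.
by move=> a'; rewrite fE => /finj /aU.
Qed.

Lemma OX_div (U : opn X) (t : divS (fun=> 0) U) : divS_val t \in regular U.
Proof. by apply/regularP => x xU; have := div_sectP _ _ _ (divS_P t) x xU; rewrite oppr0. Qed.

Lemma div_one (U : opn X) : 1 \in div_sect (fun=> 0) U.
Proof. by apply/div_sectP => x _; rewrite oppr0; exact: vge1 (ord_dval x). Qed.

Definition opnT : opn X.
Proof. by exists setT; rewrite setCT; exact: finite_set0. Defined.

Lemma structure_sheaf_line_bundle : vector_bundle 1 (@line_bundle k X (fun=> 0)).
Proof.
move=> x; exists opnT; split => //.
exists (fun=> DivS (div_one opnT)) => V VU s.
exists [ffun=> MkOX (OX_div (s : divS (fun=> 0) V))]; split.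
  by apply: val_inj; rewrite big_ord_recl big_ord0 addr0 ffunE /= mulr1.
move=> a ->; apply/ffunP => i; rewrite ord1 ffunE; apply: val_inj.
by rewrite /= big_ord_recl big_ord0 addr0 /= mulr1.
Qed.

(** The universal map is scaling, and a bilinear c factors through its values at the section 1. *)
Lemma tensor_structure_sheaf M : is_tensor M (line_bundle (fun=> 0)) M.
Proof.
pose O := @line_bundle k X (fun=> 0).
have [b bE] : exists b : obilinear M O M, forall (U : opn X) s (t : divS (fun=> 0) U),
    b U s (t : sect O U) = MkOX (OX_div t) *: s.
  unshelve eexists; first unshelve eapply (@OBilinear _ _ M O M
    (fun U s (t : divS (fun=> 0) U) => MkOX (OX_div t) *: s)).
  - by move=> U a s s' t; rewrite scalerDr !scalerA mulrC.
  - move=> U a s t t'; rewrite scalerA -scalerDl; congr (_ *: _); exact: val_inj.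
  - by move=> U V VU s t; rewrite resZ; congr (_ *: _); exact: val_inj.
  - by [].
exists b => Q c; pose one U : sect O U := DivS (div_one U).
have fl (U : opn X) (a : OX U) (s t : sect M U) :
    c U (a *: s + t) (one U) = a *: c U s (one U) + c U t (one U) by rewrite obil_linl.
have fr (U V : opn X) (VU : V `<=` U) (s : sect M U) :
    c V (res VU s) (one V) = res VU (c U s (one U)).
  by rewrite -obil_res; congr (c V _ _); exact: val_inj.
have cZl U a s t : c U (a *: s) t = a *: c U s t.
  have c0 : c U 0 t = 0.
    have := obil_linl c 1 0 0 t; rewrite !scale1r addr0 => /esym/eqP.
    by rewrite -subr_eq0 addrK => /eqP.
  by have := obil_linl c a s 0 t; rewrite addr0 c0 addr0.
have cZr U a s t : c U s (a *: t) = a *: c U s t.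
  have c0 : c U s 0 = 0.
    have := obil_linr c 1 s 0 0; rewrite !scale1r addr0 => /esym/eqP.
    by rewrite -subr_eq0 addrK => /eqP.
  by have := obil_linr c a s t 0; rewrite addr0 c0 addr0.
exists (OMorphism fl fr); split=> [U s t|f fP].
  rewrite bE /= cZl -cZr; congr (c U _ _); apply: val_inj; by rewrite /= mulr1.
apply: omor_eq => U s /=; rewrite -fP bE; congr (f U _).
by rewrite (_ : MkOX _ = 1) ?scale1r //; exact: val_inj.
Qed.

(** Equalities of classes are exploited through membership: a bundle in its own class is a twist of
    any other representative of that class. *)
Lemma pclass_refl M : vector_bundle 2 M -> pclass M M.
Proof.
move=> M2; split=> //; exists (line_bundle (fun=> 0)); split.
  exact: structure_sheaf_line_bundle.
exact: tensor_structure_sheaf.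
Qed.

Variable C : forall x : place X, completion x.

Lemma pclass_deq (g h : GL2 (adele C)) M (i : omorphism (lattice_sheaf h) M) :
  (forall U, injective (i U)) -> (forall U s, exists t, i U t = s) ->
  pclass (lattice_sheaf g) = pclass M -> deq (pgl g) (pgl h).
Proof.
move=> iinj isurj gM.
have := pclass_refl (iso_vector_bundle iinj isurj (lattice_vector_bundle h)).
by rewrite -gM => -[_ [L [L1 LT]]]; exact: tensor_deq isurj.
Qed.

Lemma cpt_lattice (D : divisor X) (U : opn X) (v : 'cV[X]_2) :
  (v \in lat_sect (cpt C D) U) =
  (v 0 0 \in div_sect D U) && (v 1 0 \in div_sect (fun=> 0) U).
Proof.
have fD : fsup D by exact: dmult_fin.
have fND : fsup (fun x => - - D x) by do 2 apply: fsupN.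
have E0 x : (ginv (cpt C D) *m map_mx (dia C) v) 0 0 x = emb (C x) (unif x ^ D x * v 0 0).
  rewrite mx2_col !mxE /= mulr0 mul0r oppr0 mul0r addr0 powE // opprK rmorphM //.
have E1 x : (ginv (cpt C D) *m map_mx (dia C) v) 1 0 x = emb (C x) (v 1 0).
  by rewrite mx2_col !mxE /= mul0r add0r mul1r.
have oU (x : place X) : ord x (unif x ^ D x) = D x.
  by rewrite (dvalXz (ord_dval x)) ?unif_neq0 // ord_unif mul1r.
have uD x : vge (ord x) 0 (unif x ^ D x * v 0 0) = vge (ord x) (- D x) (v 0 0).
  rewrite -[RHS](vge_mul (ord_dval x) _ _ (c := unif x ^ D x)) ?oU ?addNr //.
  by rewrite expfz_neq0 // unif_neq0.
apply/lat_sectP/andP => [vP|[/div_sectP v0 /div_sectP v1] x xU]; last first.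
  apply: forall_ord2 => j; rewrite ord1 ?E0 ?E1 vge_emb; first by rewrite uD; exact: v0.
  by have := v1 x xU; rewrite oppr0.
split; apply/div_sectP => x xU.
  by have := vP x xU 0 0; rewrite E0 vge_emb uD.
by have := vP x xU 1 0; rewrite E1 vge_emb oppr0.
Qed.

(** The two coordinates of a vector identify the sheaf of [cpt C D] with the direct sum in [c_]. *)
Lemma pclass_cpt (g : GL2 (adele C)) (D : divisor X) :
  pclass (lattice_sheaf g) = c_ D -> deq (pgl g) (pgl (cpt C D)).
Proof.
pose N := osum (line_bundle D) (@line_bundle k X (fun=> 0)).
have p0 U (v : latS (cpt C D) U) : lat_val v 0 0 \in div_sect D U.
  by have := lat_P v; rewrite cpt_lattice => /andP[].
have p1 U (v : latS (cpt C D) U) : lat_val v 1 0 \in div_sect (fun=> 0) U.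
  by have := lat_P v; rewrite cpt_lattice => /andP[].
pose i0 U (v : sect (lattice_sheaf (cpt C D)) U) : sect N U := (DivS (p0 U v), DivS (p1 U v)).
have fl (U : opn X) (a : OX U) (s t : sect (lattice_sheaf (cpt C D)) U) :
    i0 U (a *: s + t) = a *: i0 U s + i0 U t.
  by congr pair; apply: val_inj; rewrite /= !mxE.
have fr (U V : opn X) (VU : V `<=` U) (s : sect (lattice_sheaf (cpt C D)) U) :
    i0 V (res VU s) = res VU (i0 U s).
  by congr pair; exact: val_inj.
apply: (pclass_deq (i := OMorphism fl fr)) => U.
  move=> v w /= [vw0 vw1]; apply: val_inj; apply/matrixP.
  by apply: forall_ord2 => j; rewrite ord1.
move=> [s t]; pose v : 'cV[X]_2 := \col_j (if j == 0 then divS_val s else divS_val t).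
have vU : v \in lat_sect (cpt C D) U.
  by rewrite cpt_lattice !mxE /=; apply/andP; split; exact: divS_P.
by exists (LatS vU); congr pair; apply: val_inj; rewrite /= mxE.
Qed.

Lemma pclass_lattice (g h : GL2 (adele C)) :
  pclass (lattice_sheaf g) = pclass (lattice_sheaf h) -> deq (pgl g) (pgl h).
Proof.
have fl (U : opn X) (a : OX U) (s t : sect (lattice_sheaf h) U) : a *: s + t = a *: s + t by [].
have fr (U V : opn X) (VU : V `<=` U) (s : sect (lattice_sheaf h) U) : res VU s = res VU s by [].
by apply: (pclass_deq (i := OMorphism fl fr)) => [U v w|U s]; last exists s.
Qed.

End ProjectiveClasses.

(** Take a family in V of maximal length whose value vectors at the N points are independent. The
    values of any f in V are a combination of theirs; the corresponding difference vanishes at the N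
    points and hence everywhere. *)
Lemma subspace_dim (S : Type) (K : fieldType) (V : set (S -> K)) (N : nat) (e : 'I_N -> S) :
  V (fun=> 0) -> (forall f f' c, V f -> V f' -> V (fun s => c * f s + f' s)) ->
  (forall f, V f -> (forall i, f (e i) = 0) -> forall s, f s = 0) ->
  exists2 n, (n <= N)%N & has_dim V n.
Proof.
move=> V0 Vlin Ve.
have Vsum n (c : 'I_n -> K) b : (forall i, V (b i)) -> V (fun s => \sum_i c i * b i s).
  elim: n c b => [|n IH] c b bV.
    by rewrite (_ : (fun s => _) = fun=> 0) //; apply/funext => s; rewrite big_ord0.
  rewrite (_ : (fun s => _) = fun s => c ord0 * b ord0 s + \sum_i c (lift ord0 i) * b (lift
    ord0 i) s).
    by apply: Vlin => //; exact: (IH (fun i => c (lift ord0 i)) (fun i => b (lift ord0 i))).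
  by apply/funext => s; rewrite big_ord_recl.
pose M n (b : 'I_n -> S -> K) : 'M[K]_(n, N) := \matrix_(i, j) b i (e j).
pose P n := `[< exists2 b : 'I_n -> S -> K, (forall i, V (b i)) & row_free (M n b) >].
have P0 : exists n, P n.
  exists 0%N; apply/asboolP; exists (fun _ _ => 0) => [[]//|];
    by rewrite /row_free eqn_leq rank_leq_row.
have PN n : P n -> (n <= N)%N.
  by move=> /asboolP[b _ /eqP <-]; exact: rank_leq_col.
case: (ex_maxnP P0 PN) => n /asboolP[b bV bfree] nmax.
exists n; first by apply: PN; apply/asboolP; exists b.
exists b; split=> [c c0 i|].
  have : \row_i c i *m M n b = 0.
    by apply/matrixP => r j; rewrite !mxE -[RHS](c0 (e j)); apply: eq_bigr => l _; rewrite !mxE.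
  move=> cM; have /matrixP/(_ 0 i) : \row_i c i = 0 :> 'rV_n by apply: (row_free_inj bfree);
    rewrite mul0mx.
  by rewrite !mxE.
apply/seteqP; split=> f; last first.
  by move=> [c fE]; rewrite (_ : f = fun s => \sum_i c i * b i s); [exact: Vsum|apply/funext].
move=> fV; pose r : 'rV_N := \row_j f (e j).
have /submxP[c rE] : (r <= M n b)%MS.
  apply: contraT => nr; suff : (n + 1 <= n)%N by rewrite addn1 ltnn.
  apply: nmax; apply/asboolP.
  pose b' (i : 'I_(n + 1)) := match fintype.split i with inl j => b j | inr _ => f end.
  exists b'; first by move=> i; rewrite /b'; case: fintype.split.
  have -> : M (n + 1)%N b' = col_mx (M n b) r.
    apply/matrixP => i j; rewrite !mxE /b'; case: fintype.split => l; by rewrite !mxE.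
  rewrite /row_free eqn_leq rank_leq_row /= -{1}(eqP bfree) addn1.
  rewrite -addsmxE; apply: rank_ltmx; rewrite ltmxE addsmxSl /=.
  by apply: contraNN nr; apply: submx_trans; exact: addsmxSr.
exists (fun i => c 0 i) => s.
pose g s := (-1) * (\sum_i c 0 i * b i s) + f s.
have : g s = 0.
  apply: Ve; first by apply: Vlin => //; exact: Vsum.
  move=> j; have /matrixP/(_ 0 j) := rE; rewrite !mxE /g => ->.
  by rewrite mulN1r; apply/eqP; rewrite addrC subr_eq0; apply/eqP; apply: eq_bigr => i _;
    rewrite mxE.
by rewrite /g mulN1r => /eqP; rewrite addrC subr_eq0 => /eqP.
Qed.

Section Representatives.
Variables (k : finFieldType) (X : curve k).
Variable C : forall x : place X, completion x.

Definition eff_class (g : GL2 (adele C)) :=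
  exists2 D : divisor X, effective D & deq (pgl g) (pgl (cpt C D)).

(** From the finite list of [finite_classes], elements equivalent to an effective c_D or to one
    already kept are discarded. *)
Lemma class_representatives : exists (N : nat) (r : 'I_N -> GL2 (adele C)),
  [/\ forall i j, deq (pgl (r i)) (pgl (r j)) -> i = j, forall i, ~ eff_class (r i)
    & forall g, eff_class g \/ exists i, deq (pgl g) (pgl (r i))].
Proof.
have [L /finite_seqP[s ->] LP] := finite_classes C.
have [t [tp te tP]] : exists t : seq (GL2 (adele C)),
    [/\ pairwise (fun a b => `[< ~ deq (pgl a) (pgl b) >]) t, forall g, g \in t -> ~ eff_class g
      & forall g, g \in s -> eff_class g \/ exists2 l, l \in t & deq (pgl g) (pgl l)].
  elim: s {LP} => [|a s [t [tp te tP]]]; first by exists [::].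
  have [ae|nae] := pselect (eff_class a \/ exists2 l, l \in t & deq (pgl a) (pgl l)).
    by exists t; split=> // g; rewrite inE => /orP[/eqP ->|/tP].
  exists (a :: t); split.
  - rewrite /= tp andbT; apply/allP => b bt; apply/asboolP => ab.
    by apply: nae; right; exists b.
  - move=> g; rewrite inE => /orP[/eqP -> ea|/te //]; by apply: nae; left.
  - move=> g; rewrite inE => /orP[/eqP ->|/tP[eg|[l lt gl]]]; [right|by left|right].
      by exists a; [rewrite mem_head|exact: deq_refl].
    by exists l => //; rewrite inE lt orbT.
exists (size t), (fun i => nth 1%g t i); split.
- move=> i j ij; apply: val_inj; apply: contrapT => /eqP nij.
  wlog lt : i j ij nij / (i < j)%N.
    move=> h; move: (nij); rewrite neq_ltn => /orP[|ji]; first exact: h.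
    by apply: (h j i) => //; [exact: deq_sym|rewrite eq_sym].
  by have /(pairwiseP 1%g)/(_ i j (ltn_ord i) (ltn_ord j) lt)/asboolP := tp.
- by move=> i; apply: te; exact: mem_nth.
- move=> g; have [eg|[l /tP[[D De lD]|[b bt lb]] gl]] := LP g; first by left.
    by left; exists D => //; exact: deq_trans gl lD.
  right; have bi : (index b t < size t)%N by rewrite index_mem.
  by exists (Ordinal bi); rewrite /= nth_index //; exact: deq_trans gl lb.
Qed.

End Representatives.

Theorem theorem10p9 (R : realType) (k : finFieldType) (X : curve k)
    (E : const_ext X) (C : forall x : place X, completion x)
    (mu : {measure set (borel (PGL2A C)) -> \bar R})
    (dt : {measure set (borel (TFA E C)) -> \bar R}) :
  is_haar (fun g h : PGL2A C => (g * h)%g) mu ->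
  mu (PGL2O C) = 1%E ->
  is_haar (@ttrans _ _ E C) dt ->
  exists n : nat, has_dim (Vtor mu dt) n /\ le_card_PBun2_diff X n.
Proof.
move=> mu_haar mu_K dt_haar.
have [N [r [rinj reff rP]]] := class_representatives C.
have [||| n nN Vdim] := @subspace_dim _ _ (Vtor mu dt) N (fun i => pgl (r i)).
- exact: Vtor0.
- by move=> f f' c; exact: Vtor_lin.
- move=> f fV f0; apply: (Vtor_eq0 mu_haar mu_K dt_haar fV) => p np.
  have [g pg] := pgl_surj p; rewrite pg in np *.
  have [[D De gD]|[i gi]] := rP g; first by case: (np D De).
  by rewrite (automorphic_deq (Vtor_automorphic fV) gi).
exists n; split=> //.
(* The dimension n is at most N, and the first n representatives give the injection. *)
pose M i := lattice_sheaf (r (widen_ord nN i)).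
have MP i : exists M', vector_bundle 2 M' /\ pclass (M i) = pclass M'.
  by exists (M i); split=> //; exact: lattice_vector_bundle.
exists (fun i => exist _ (pclass (M i)) (MP i));
  split=> [i j /(congr1 (@proj1_sig _ _))|i D [D' De' DD'] /pclass_cpt].
  by move=> /= /pclass_lattice/rinj/(congr1 val) /= /val_inj.
(* D is only linearly equivalent to the effective divisor D'; both have the same double coset. *)
move=> rD; apply: (reff (widen_ord nN i)); exists D' => //.
exact: deq_trans rD (lin_equiv_deq C DD').
Qed.
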